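(* Let $\mu$ be a positive Borel measure on $[0,1)$ and let $\gamma_1,\gamma_2,\beta>0$ be such that $\gamma_2<\gamma_1+\beta$. The following statements are equivalent. (i) $\mathcal C_{\mu,\beta}:A^\infty_{\gamma_1}\to A^\infty_{\gamma_2}$ is bounded. (ii) $\mu$ is a $(\beta+\gamma_1-\gamma_2)$-Carleson measure. (iii) $\mathcal C_{\mu,\beta}:H(p,\infty,\gamma_1)\to H(p,\infty,\gamma_2)$ is bounded for all $1\le p\le\infty$. (iv) $\mathcal C_{\mu,\beta}:H(p,q,\gamma_1)\to H(p,q,\gamma_2)$ is bounded for all $1\le p<\infty$ and $0<q<\infty$. (v) $\mathcal C_{\mu,\beta}:H(p,q,\gamma_1)\to H(p,q,\gamma_2)$ is bounded for some $1\le p<\infty$ and $0<q<\infty$. (vi) $\mathcal C_{\mu,\beta+\delta}:H(p,q,\gamma_1-\delta)\to H(p,q,\gamma_2)$ is bounded for some $1\le p<\infty$, $0<\delta<\gamma_1$ and $0<q<\infty$.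
   Context: $\mathbb D$ is the open unit disc of $\mathbb C$ and $\mathcal H(\mathbb D)$ the space of analytic functions on $\mathbb D$. Positive Borel measures on $[0,1)$ are understood to be finite. For $\beta>0$ and $f\in\mathcal H(\mathbb D)$, $\mathcal C_{\mu,\beta}(f)(z)=\int_0^1 \frac{f(tz)}{(1-tz)^\beta}\,d\mu(t)$, $z\in\mathbb D$; this belongs to $\mathcal H(\mathbb D)$. For $f\in\mathcal H(\mathbb D)$ and $0<r<1$: $M_p(f,r)=\left(\int_0^{2\pi}|f(re^{i\theta})|^p\frac{d\theta}{2\pi}\right)^{1/p}$ for $0<p<\infty$, and $M_\infty(f,r)=\max_{|z|=r}|f(z)|$. For $0<p\le\infty$ and $\gamma>0$, $H(p,q,\gamma)$ is the space of $f\in\mathcal H(\mathbb D)$ with $\|f\|_{(p,q,\gamma)}<\infty$, where $\|f\|_{(p,q,\gamma)}=\left(\int_0^1(1-r)^{\gamma q-1}M_p^q(f,r)\,dr\right)^{1/q}$ if $0<q<\infty$, and $\|f\|_{(p,\infty,\gamma)}=\sup_{0<r<1}(1-r)^\gamma M_p(f,r)$. Also $A^\infty_\gamma=H(\infty,\infty,\gamma)$. An operator $T$ is bounded from $H(p_1,q_1,\gamma_1)$ to $H(p_2,q_2,\gamma_2)$ if there is $C>0$ with $\|Tf\|_{(p_2,q_2,\gamma_2)}\le C\|f\|_{(p_1,q_1,\gamma_1)}$ for all $f\in H(p_1,q_1,\gamma_1)$. For $s>0$, $\mu$ on $[0,1)$ is $s$-Carleson if there is $C>0$ with $\mu([r,1))\le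 C(1-r)^s$ for all $0<r<1$. *)

(* Defs.v *)
From HB Require Import structures.
From mathcomp Require Import all_boot all_order all_algebra.
From mathcomp Require Import all_classical all_reals all_analysis.
From mathcomp Require Export complex.

Set Implicit Arguments.
Unset Strict Implicit.
Unset Printing Implicit Defensive.

Import Order.TTheory GRing.Theory Num.Theory.
Import numFieldNormedType.Exports.

Local Open Scope classical_set_scope.
Local Open Scope ring_scope.
Local Open Scope complex_scope.

Section ComplexFunctions.
Variable R : realType.
Implicit Types z : R[i].

(* The real-valued modulus; the norm `|z| of the numDomainType R[i] is itself
   an element of R[i]. *)
Definition cmod z : R := complex.Re `|z|.

Definition cexp z : R[i] :=
  (expR (complex.Re z))%:C * (cos (complex.Im z) +i* sin (complex.Im z)).

(* Principal argument, in ]-pi, pi] for z != 0. *)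
Definition carg z : R :=
  let t := acos (complex.Re z / cmod z) in
  if 0 <= complex.Im z then t else - t.

Definition clog z : R[i] := ln (cmod z) +i* carg z.

(* Principal branch of z ^ b, meant for z != 0. *)
Definition cpow z (b : R) : R[i] := cexp (b%:C * clog z).

Definition cintegral d (T : measurableType d)
    (mu : {measure set T -> \bar R}) (D : set T) (f : T -> R[i]) : R[i] :=
  Rintegral mu D (fun t => complex.Re (f t))
  +i* Rintegral mu D (fun t => complex.Im (f t)).

Definition unit_disc : set R[i] := [set z | cmod z < 1].

(* Functions on the disc are represented by functions on R[i] whose values
   outside the disc are irrelevant. The field of scalars of [derivable] is
   R[i] here, so that this is complex differentiability. *)
Definition analytic_disc : set (R[i] -> R[i]) :=
  [set f | forall z, unit_disc z -> derivable (f : R[i]^o -> R[i]^o) z 1].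

End ComplexFunctions.

Section MixedNorm.
Variable R : realType.
Implicit Types (f : R[i] -> R[i]) (p q : \bar R) (r gam : R).

Definition circle_mean p f r : \bar R :=
  match p with
  | p'%:E =>
      ((\int[lebesgue_measure]_(theta in `[0%R, (2 * pi)%R]%classic)
        (cmod (f (r%:C * cexp (0 +i* theta))) `^ p' / (2 * pi))%R%:E)
       `^ p'^-1)%E
  | +oo%E => ereal_sup [set (cmod (f z))%:E | z in [set z | cmod z = r]]
  | -oo%E => 0%E
  end.

Definition mixed_norm p q gam f : \bar R :=
  match q with
  | q'%:E =>
      ((\int[lebesgue_measure]_(r in `]0%R, 1%R[%classic)
        (((1 - r) `^ (gam * q' - 1))%R%:E * circle_mean p f r `^ q'))
       `^ q'^-1)%E
  | +oo%E =>
      ereal_sup [set (((1 - r) `^ gam)%R%:E * circle_mean p f r)%E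
                | r in `]0, 1[%classic]
  | -oo%E => 0%E
  end.

Definition mixed_space p q gam : set (R[i] -> R[i]) :=
  [set f | analytic_disc f /\ (mixed_norm p q gam f < +oo)%E].

Definition bounded_mixed (T : (R[i] -> R[i]) -> R[i] -> R[i])
    p1 q1 gam1 p2 q2 gam2 : Prop :=
  exists2 C : R, 0 < C & forall f, mixed_space p1 q1 gam1 f ->
    (mixed_norm p2 q2 gam2 (T f) <= C%:E * mixed_norm p1 q1 gam1 f)%E.

(* A^oo_gam1 -> A^oo_gam2 *)
Definition bounded_growth (T : (R[i] -> R[i]) -> R[i] -> R[i]) gam1 gam2 :=
  bounded_mixed T +oo%E +oo%E gam1 +oo%E +oo%E gam2.

End MixedNorm.

Section Cesaro.
Variables (R : realType) (mu : {finite_measure set (measurableTypeR R) -> \bar R}).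

Definition cesaro_op (beta : R) (f : R[i] -> R[i]) (z : R[i]) : R[i] :=
  cintegral mu `[0, 1[%classic
    (fun t : R => f (t%:C * z) / cpow (1 - t%:C * z) beta).

Definition carleson (s : R) : Prop :=
  exists2 C : R, 0 < C &
    forall r : R, 0 < r < 1 -> (mu `[r, 1%R[%classic <= (C * (1 - r) `^ s)%R%:E)%E.

End Cesaro.

(* Main.v *)
Require Import Defs.
From mathcomp Require Import all_boot all_order all_algebra.
From mathcomp Require Import all_classical all_reals all_analysis.
From mathcomp Require Import measurable_realfun.
From mathcomp Require Import ring lra.

(* Every boundedness statement is compared with the Carleson condition.

   Sufficiency. The radial means of |f|^p increase with the radius because
   |f|^p is subharmonic; the mean value property needed for this comes from
   Green's formula on rectangles (Goursat bisection) applied to f o exp. Thus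
   if f has norm N, then M_p(f, tr) <= L (1 - tr)^(-a), and Minkowski's
   inequality bounds M_p(C_mu f, r) by L times the integral of
   (1 - tr)^(-a - beta) dmu(t), which a dyadic decomposition of [0, 1)
   estimates by a power of 1 - r under the Carleson condition. For q = oo one
   takes a = gam1. For finite q one takes a slightly below gam1, with L^q a
   weighted integral of M_p(f, .)^q over x < (1 + r) / 2, and concludes by
   Tonelli.

   Necessity. Test on (1 - r z)^(-n) with n large. Its norm is controlled by
   the mean of the Poisson kernel. For z = rho e^(i theta) with
   r <= rho <= (1 + r) / 2 and theta <= c (1 - r), the integrand defining
   C_mu f stays in a narrow sector around the positive axis, so that
   |C_mu f(z)| is at least a constant times (1 - r)^(-n - beta) mu([r, 1)). *)

(** All six conditions are tied to one exponent, s = beta + gam1 - gam2. The hypotheses on the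
    parameters say that 0 < s < beta + gam1, the range in which the kernel integral with a = gam1
    has size (1 - r)^(-gam2).

    For finite q the choice a = gam1 fails. Against (1 - r)^(gam2 q - 1) it leaves the weight (1 -
    r)^(-1), and the integral in r diverges at 1. Lowering a by e leaves (1 - r)^(e q - 1), which is
    integrable. The factor L depends on r and is raised to the power q as it stands, so no duality
    or Hardy inequality in r enters, and q < 1 is treated like q >= 1.

    Minkowski's inequality is used in a linearised form, with x <= A + x^p A^(1 - p) for a free A >
    0. This costs a constant factor and needs nothing beyond Tonelli.

    For finite p and q a lower bound at the single point z = r says nothing about the norm, which is
    why a whole sector is needed. Its arc contributes (1 - r)^(1/p), exactly the factor by which the
    finite-p norm of the test function differs from its sup norm. The two cancel, and the same s
    appears for all p and q. *)

Import Order.TTheory GRing.Theory Num.Theory.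
Import numFieldNormedType.Exports.

Local Open Scope classical_set_scope.
Local Open Scope ring_scope.
Local Open Scope complex_scope.

Local Notation Re := complex.Re.
Local Notation Im := complex.Im.

(** * Modulus and exponential on the complex plane *)

Section Cmod.
Context {R : realType}.
Implicit Types (z w : R[i]) (x y : R).

Lemma ReM z w : Re (z * w) = Re z * Re w - Im z * Im w.
Proof. by case: z => a b; case: w => c d. Qed.

Lemma ImM z w : Im (z * w) = Re z * Im w + Im z * Re w.
Proof. by case: z => a b; case: w => c d. Qed.

Lemma ReD z w : Re (z + w) = Re z + Re w.
Proof. by case: z => a b; case: w => c d. Qed.

Lemma ImD z w : Im (z + w) = Im z + Im w.
Proof. by case: z => a b; case: w => c d. Qed.

Lemma ReN z : Re (- z) = - Re z. Proof. by case: z. Qed.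

Lemma ImN z : Im (- z) = - Im z. Proof. by case: z. Qed.

Lemma cmodE z : cmod z = Num.sqrt (Re z ^+ 2 + Im z ^+ 2).
Proof. by rewrite /cmod normc_def. Qed.

Lemma cmod_normc z : `|z| = (cmod z)%:C.
Proof. by rewrite cmodE normc_def. Qed.

Lemma cmod_ge0 z : 0 <= cmod z.
Proof. by rewrite cmodE sqrtr_ge0. Qed.

Lemma cmod_sqr z : cmod z ^+ 2 = Re z ^+ 2 + Im z ^+ 2.
Proof. by rewrite cmodE sqr_sqrtr// addr_ge0// sqr_ge0. Qed.

Lemma cmodM z w : cmod (z * w) = cmod z * cmod w.
Proof. by rewrite /cmod normrM !cmod_normc -rmorphM. Qed.

Lemma cmodD z w : cmod (z + w) <= cmod z + cmod w.
Proof. by rewrite -lecR rmorphD /= -!cmod_normc ler_normD. Qed.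

Lemma cmodN z : cmod (- z) = cmod z.
Proof. by rewrite /cmod normrN. Qed.

Lemma cmodB z w : cmod (z - w) <= cmod z + cmod w.
Proof. by rewrite -(cmodN w) cmodD. Qed.

Lemma cmodC x : cmod x%:C = `|x|.
Proof. by rewrite cmodE /= expr0n addr0 sqrtr_sqr. Qed.

Lemma cmod0 : cmod (0 : R[i]) = 0.
Proof. by rewrite (cmodC 0) normr0. Qed.

Lemma cmod1 : cmod (1 : R[i]) = 1.
Proof. by rewrite (cmodC 1) normr1. Qed.

Lemma cmod_eq0 z : (cmod z == 0) = (z == 0).
Proof.
by rewrite -(inj_eq (@complexI R)) -cmod_normc normr_eq0.
Qed.

Lemma cmodV z : cmod z^-1 = (cmod z)^-1.
Proof. by rewrite /cmod normfV cmod_normc -fmorphV. Qed.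

Lemma cmodX z n : cmod (z ^+ n) = cmod z ^+ n.
Proof. by elim: n => [|n IH]; rewrite ?expr0 ?cmod1// !exprS cmodM IH. Qed.

Lemma normRe_cmod z : `|Re z| <= cmod z.
Proof. by rewrite cmodE -sqrtr_sqr ler_wsqrtr// lerDl sqr_ge0. Qed.

Lemma normIm_cmod z : `|Im z| <= cmod z.
Proof. by rewrite cmodE -sqrtr_sqr ler_wsqrtr// lerDr sqr_ge0. Qed.

Lemma Re_le_cmod z : Re z <= cmod z.
Proof. by rewrite (le_trans _ (normRe_cmod z))// ler_norm. Qed.

Lemma cmod_le z : cmod z <= `|Re z| + `|Im z|.
Proof.
rewrite -[leRHS]ger0_norm ?addr_ge0// -sqrtr_sqr cmodE ler_wsqrtr//.
rewrite sqrrD !real_normK ?num_real// lerD2r lerDl.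
by rewrite mulrn_wge0// mulr_ge0.
Qed.

(** Balls of [R[i]] have radii in [R[i]], whose order is partial; a positive radius has imaginary
    part 0, so real radii suffice. *)
Lemma cmod_ltP (z0 : R[i]) (P : set R[i]) :
  nbhs (z0 : R[i]^o) P <->
  exists2 d : R, 0 < d & forall z, cmod (z - z0) < d -> P z.
Proof.
split=> [/nbhs_ballP[e /= e0 eP]|[d d0 dP]].
  move: e0; rewrite ltcE /= => /andP[/eqP ei e0].
  exists (Re e) => // z zd; apply: eP; rewrite /ball /= -normrN opprB cmod_normc.
  by rewrite ltcE /= ei eqxx.
apply/nbhs_ballP; exists d%:C; first by rewrite /= ltcR.
move=> z; rewrite /ball /= -normrN opprB cmod_normc ltcR; exact: dP.
Qed.

(** Continuity of complex maps is stated throughout by real and imaginary parts, so that it feeds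
    real integrals directly; this is the bridge to the epsilon form. *)
Lemma ccvgP T (F : set_system T) {FF : Filter F} (g : T -> R[i]) (z : R[i]) :
  (Re (g x) @[x --> F] --> Re z /\ Im (g x) @[x --> F] --> Im z) <->
  (forall e : R, 0 < e -> \forall x \near F, cmod (g x - z) < e).
Proof.
split=> [[rz iz] e e0|h].
  have e20 : 0 < e / 2 by rewrite divr_gt0.
  move/cvgrPdist_lt: rz => /(_ _ e20) h1.
  move/cvgrPdist_lt: iz => /(_ _ e20) h2.
  near=> x; rewrite (le_lt_trans (cmod_le _))//.
  rewrite ReD ImD ReN ImN [e]splitr; apply: ltrD.
    by rewrite distrC; near: x.
  by rewrite distrC; near: x.
split; apply/cvgrPdist_lt => e e0; near=> x; rewrite distrC.
  rewrite -ReN -ReD (le_lt_trans (normRe_cmod _))//.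
  by near: x; apply: h.
rewrite -ImN -ImD (le_lt_trans (normIm_cmod _))//.
by near: x; apply: h.
Unshelve. all: by end_near. Qed.

Lemma cderivP (f : R[i] -> R[i]) z : derivable (f : R[i]^o -> R[i]^o) z 1 ->
  exists l : R[i], forall e : R, 0 < e -> exists2 d : R, 0 < d &
    forall h, cmod h < d -> cmod (f (z + h) - f z - l * h) <= e * cmod h.
Proof.
move=> /cvg_ex[/= l fl]; exists l => e e0.
move/cvgrPdist_lt: fl => /(_ e%:C); rewrite ltcR => /(_ e0).
move=> /cmod_ltP[d d0 dP]; exists d => // h hd.
have [->|h0] := eqVneq h 0; first by rewrite addr0 subrr mulr0 subr0 cmod0 mulr0.
have := dP h; rewrite subr0 => /(_ hd h0).
rewrite cmod_normc ltcR => le.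
have -> : f (z + h) - f z - l * h = - (h * (l - h^-1 *: (f (h *: 1 + z) - f z))).
  rewrite /GRing.scale /= mulr1 [h + z]addrC.
  by field.
by rewrite cmodN cmodM mulrC ler_wpM2r ?cmod_ge0// ltW.
Qed.

Lemma analytic_eps (f : R[i] -> R[i]) (z : R[i]) :
  analytic_disc f -> cmod z < 1 -> forall e : R, 0 < e ->
  exists2 d : R, 0 < d & forall w, cmod (w - z) < d -> cmod (f w - f z) < e.
Proof.
move=> fa z1 e e0.
have [l hl] := cderivP _ _ (fa z z1).
have [d d0 hd] := hl 1 ltr01.
set m := Num.min d (e / (2 * (cmod l + 1))).
have l0 : 0 < cmod l + 1 by rewrite ltr_wpDl// cmod_ge0.
have m0 : 0 < m by rewrite lt_min d0 divr_gt0// mulr_gt0.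
exists m => // w; rewrite lt_min => /andP[xd xe].
have -> : f w - f z = (f (z + (w - z)) - f z - l * (w - z)) + l * (w - z).
  by rewrite addrNK [z + _]addrC subrK.
rewrite (le_lt_trans (cmodD _ _))// (le_lt_trans (lerD (hd _ xd) (lexx _)))//.
rewrite cmodM mul1r -{1}[cmod (_ - _)]mul1r -mulrDl addrC.
rewrite mulrC -ltr_pdivlMr// (lt_le_trans xe)// ler_pM2l// lef_pV2 ?posrE ?mulr_gt0//.
by rewrite ler_peMl ?ler1n// ltW.
Qed.

Lemma analytic_cvg (f : R[i] -> R[i]) (T : Type) (F : set_system T)
    {FF : Filter F} (g : T -> R[i]) (z : R[i]) :
  analytic_disc f -> cmod z < 1 ->
  Re (g x) @[x --> F] --> Re z -> Im (g x) @[x --> F] --> Im z ->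
  Re (f (g x)) @[x --> F] --> Re (f z) /\ Im (f (g x)) @[x --> F] --> Im (f z).
Proof.
move=> fa z1 gr gi; apply/ccvgP => e e0.
have [d d0 dP] := analytic_eps _ _ fa z1 _ e0.
have /ccvgP/(_ d d0) := conj gr gi.
by apply: filterS => x; exact: dP.
Qed.

(** The point of the unit circle with argument [t]; locked so that simplification does not unfold
    it. *)
Definition expi (t : R) : R[i] := locked (cexp (0 +i* t)).

Lemma cexp_expi t : cexp (0 +i* t) = expi t.
Proof. by rewrite /expi -lock. Qed.

Lemma expiE t : expi t = cos t +i* sin t.
Proof. by rewrite -cexp_expi /cexp /= expR0 mul1r. Qed.

Lemma cmod_expi t : cmod (expi t) = 1.
Proof. by rewrite expiE cmodE /= cos2Dsin2 sqrtr1. Qed.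

Lemma cmod_cexp z : cmod (cexp z) = expR (Re z).
Proof.
rewrite /cexp -expiE cmodM cmod_expi mulr1 cmodC ger0_norm//; exact: expR_ge0.
Qed.

Lemma expiD s t : expi (s + t) = expi s * expi t.
Proof.
rewrite !expiE; apply/eqP; rewrite eq_complex /= cosD sinD eqxx /=.
by rewrite addrC.
Qed.

Lemma expi0 : expi 0 = 1.
Proof. by rewrite expiE cos0 sin0. Qed.

Lemma cexpE z : cexp z = (expR (Re z))%:C * expi (Im z).
Proof. by rewrite expiE. Qed.

Lemma cexpD z w : cexp (z + w) = cexp z * cexp w.
Proof. by rewrite !cexpE ReD ImD expRD expiD rmorphM /= mulrACA. Qed.

Lemma Re_expi t : Re (expi t) = cos t. Proof. by rewrite expiE. Qed.
Lemma Im_expi t : Im (expi t) = sin t. Proof. by rewrite expiE. Qed.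

Lemma expi2pi : expi (2 * pi) = 1.
Proof. by rewrite expiE mulr_natl cos2pi sin2pi. Qed.

Lemma expi_periodic t : expi (t + 2 * pi) = expi t.
Proof. by rewrite expiD expi2pi mulr1. Qed.

End Cmod.

(** * Green's formula on a rectangle *)

Section SegmentIntegral.
Context {R : realType}.
Implicit Types (g : R -> R) (a b c : R).

(** Two-sided continuity also at the end points, which avoids the subspace topology; the functions
    at hand extend beyond their segments. *)
Definition seg_cont g a b := forall x, a <= x <= b -> {for x, continuous g}.

Definition seg_int g a b : R := Rintegral (@lebesgue_measure R) `[a, b] g.

Lemma seg_cont_sub g a b a' b' : a <= a' -> b' <= b -> seg_cont g a b ->
  seg_cont g a' b'.
Proof. by move=> h1 h2 h x /andP[h3 h4]; apply: h; lra. Qed.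

Lemma seg_cont_integrable g a b : seg_cont g a b ->
  (@lebesgue_measure R).-integrable `[a, b] (EFin \o g).
Proof.
move=> cg; apply: continuous_compact_integrable; first exact: segment_compact.
apply: continuous_in_subspaceT => x; rewrite inE /= in_itv /=; exact: cg.
Qed.

Lemma seg_cont_cst a b c : seg_cont (fun=> c) a b.
Proof. by move=> x _; exact: cvg_cst. Qed.

Lemma seg_contB g1 g2 a b : seg_cont g1 a b -> seg_cont g2 a b ->
  seg_cont (fun x => g1 x - g2 x) a b.
Proof. by move=> h1 h2 x xab; apply: cvgB; [exact: h1|exact: h2]. Qed.

Lemma seg_intB g1 g2 a b : seg_cont g1 a b -> seg_cont g2 a b ->
  seg_int (fun x => g1 x - g2 x) a b = seg_int g1 a b - seg_int g2 a b.
Proof.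
by move=> h1 h2; rewrite /seg_int RintegralB//; exact: seg_cont_integrable.
Qed.

Lemma seg_int_cst a b c : a <= b -> seg_int (fun=> c) a b = c * (b - a).
Proof.
move=> ab; rewrite /seg_int Rintegral_cst//.
have E : @lebesgue_measure R `[a, b]%classic = (b - a)%:E.
  rewrite lebesgue_measure_itv /= lte_fin; case: ltP => // ba.
  by have -> : b = a by [lra]; rewrite subrr.
by rewrite [X in fine X]E.
Qed.

Lemma seg_int_split g a b c : a <= b -> b <= c -> seg_cont g a c ->
  seg_int g a c = seg_int g a b + seg_int g b c.
Proof.
move=> ab bc cg; rewrite /seg_int.
have ig := @seg_cont_integrable _ _ _ cg.
have := @Rintegral_itvB _ g (BLeft a) (BRight c) b ig.
rewrite !bnd_simp => /(_ ab bc) h.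
have -> : Rintegral lebesgue_measure `[a, c] g =
    Rintegral lebesgue_measure `[a, b] g + Rintegral lebesgue_measure `]b, c] g.
  by rewrite -h addrC subrK.
congr (_ + _); apply: Rintegral_itv_obnd_cbnd.
apply: integrableS ig => //; apply: subset_itvr; by rewrite bnd_simp.
Qed.

Lemma le_seg_int g1 g2 a b : seg_cont g1 a b -> seg_cont g2 a b ->
  (forall x, a <= x <= b -> g1 x <= g2 x) -> seg_int g1 a b <= seg_int g2 a b.
Proof.
move=> h1 h2 h; apply: le_Rintegral => //; try exact: seg_cont_integrable.
Qed.

Lemma seg_int_near_cst g a b c (M : R) : a <= b -> seg_cont g a b ->
  (forall x, a <= x <= b -> `|g x - c| <= M) ->
  `|seg_int g a b - c * (b - a)| <= M * (b - a).
Proof.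
move=> ab cg h; rewrite ler_norml.
rewrite lerBrDr -mulNr -mulrDl lerBlDr -mulrDl.
rewrite -!seg_int_cst//; apply/andP; split; apply: le_seg_int => //;
  try exact: seg_cont_cst; by move=> x /h; rewrite ler_norml; lra.
Qed.

End SegmentIntegral.

(** * From local to global by bisection of rectangles *)

Section Bisection.
Context {R : realType}.
Variables (h k : R) (P : nat -> R -> R -> Prop).
Hypotheses (h0 : 0 <= h) (k0 : 0 <= k).

Let hn n := h / 2 ^+ n.
Let kn n := k / 2 ^+ n.

Let hnS n : hn n = hn n.+1 + hn n.+1.
Proof. by rewrite /hn exprS; field. Qed.

Let knS n : kn n = kn n.+1 + kn n.+1.
Proof. by rewrite /kn exprS; field. Qed.

Let hn_ge0 n : 0 <= hn n. Proof. by rewrite divr_ge0// exprn_ge0. Qed.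
Let kn_ge0 n : 0 <= kn n. Proof. by rewrite divr_ge0// exprn_ge0. Qed.

Hypothesis glue : forall n x y,
  P n.+1 x y -> P n.+1 (x + h / 2 ^+ n.+1) y -> P n.+1 x (y + k / 2 ^+ n.+1) ->
  P n.+1 (x + h / 2 ^+ n.+1) (y + k / 2 ^+ n.+1) -> P n x y.

(** [P n x y] concerns the rectangle with lower left corner [(x, y)] and sides [h / 2 ^+ n],
    [k / 2 ^+ n]. If [P] failed on the initial rectangle, [glue] would give a nested sequence of
    failing quarters, whose common point contradicts the local hypothesis. *)
Lemma bisection x0 y0 :
  (forall x y, x0 <= x <= x0 + h -> y0 <= y <= y0 + k -> exists n,
    forall x' y', x' <= x <= x' + h / 2 ^+ n -> y' <= y <= y' + k / 2 ^+ n ->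
      P n x' y') ->
  P 0%N x0 y0.
Proof.
move=> loc; apply: contrapT => nP0.
(* A failing rectangle has a failing quarter. The failure is kept inside the conclusion so that
   [choice] yields a total successor function. *)
have step (s : nat * (R * R)) : exists t : R * R,
    [/\ s.2.1 <= t.1 <= s.2.1 + hn s.1.+1, s.2.2 <= t.2 <= s.2.2 + kn s.1.+1 &
    ~ P s.1 s.2.1 s.2.2 -> ~ P s.1.+1 t.1 t.2].
  case: s => n [x y] /=; have hp := hn_ge0 n.+1; have kp := kn_ge0 n.+1.
  have [p1|p1] := pselect (P n.+1 x y); last first.
    by exists (x, y) => /=; split => //; lra.
  have [p2|p2] := pselect (P n.+1 (x + hn n.+1) y); last first.
    by exists (x + hn n.+1, y) => /=; split => //; lra.
  have [p3|p3] := pselect (P n.+1 x (y + kn n.+1)); last first.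
    by exists (x, y + kn n.+1) => /=; split => //; lra.
  exists (x + hn n.+1, y + kn n.+1) => /=; split; try lra.
  by move=> np p4; apply: np; exact: glue.
have [st stP] := choice step.
pose q := fix q n := if n is m.+1 then st (m, q m) else (x0, y0).
have qbad n : ~ P n (q n).1 (q n).2.
  elim: n => [//|n IH]; have [_ _] := stP (n, q n); exact.
have qx n : (q n).1 <= (q n.+1).1 /\ (q n.+1).1 + hn n.+1 <= (q n).1 + hn n.
  by have [/= + _ _] := stP (n, q n); rewrite (hnS n); lra.
have qy n : (q n).2 <= (q n.+1).2 /\ (q n.+1).2 + kn n.+1 <= (q n).2 + kn n.
  by have [/= _ + _] := stP (n, q n); rewrite (knS n); lra.
have nested (a d : nat -> R) : (forall n, 0 <= d n) ->
    (forall n, a n <= a n.+1 /\ a n.+1 + d n.+1 <= a n + d n) ->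
    exists x, forall n, a n <= x <= a n + d n.
  move=> d0 ad.
  have up m n : (m <= n)%N -> a m <= a n /\ a n + d n <= a m + d m.
    elim: n => [|n IH]; first by rewrite leqn0 => /eqP ->.
    rewrite leq_eqVlt => /predU1P[->//|]; rewrite ltnS => /IH.
    by have := ad n; lra.
  have bnd m n : a m <= a n + d n.
    have [mn|/ltnW mn] := leqP m n; have := up _ _ mn; have := d0 n; have := d0 m; lra.
  exists (sup (range a)) => n; apply/andP; split.
    apply: ub_le_sup; last by exists n.
    by exists (a 0%N + d 0%N) => _ [m _ <-].
  apply: sup_le_ub; first by exists (a 0%N); exists 0%N.
  by move=> _ [m _ <-].
have [x xP] := nested _ _ hn_ge0 qx.
have [y yP] := nested _ _ kn_ge0 qy.
have := xP 0%N; have := yP 0%N; rewrite /hn /kn expr0 !divr1 /= => y00 x00.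
have [n nP] := loc x y x00 y00.
by apply: (qbad n); apply: nP; [exact: xP|exact: yP].
Qed.

End Bisection.

Lemma dist_le_itv {R : realType} {a h x z : R} : a <= x <= a + h ->
  a <= z <= a + h -> `|z - x| <= h.
Proof. rewrite ler_norml; lra. Qed.

Section Green.
Context {R : realType}.
Variables (u v : R -> R -> R) (s1 s2 t1 t2 : R).
Hypotheses (s12 : s1 <= s2) (t12 : t1 <= t2).

(** The shared coefficient [c] is the equation u_s = v_t, one of the two Cauchy-Riemann equations.
    Only pointwise differentiability is assumed, so the partial derivatives cannot be integrated,
    and Goursat's bisection takes the place of the integral of u_s - v_t. *)
Hypothesis diff_uv : forall s t, s1 <= s <= s2 -> t1 <= t <= t2 ->
  exists b c d : R, forall e, 0 < e -> exists2 del : R, 0 < del &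
    forall s' t', `|s' - s| < del -> `|t' - t| < del ->
    `|u s' t' - u s t - (c * (s' - s) + b * (t' - t))|
       <= e * (`|s' - s| + `|t' - t|) /\
    `|v s' t' - v s t - (d * (s' - s) + c * (t' - t))|
       <= e * (`|s' - s| + `|t' - t|).

Lemma lip_cvg (g : R -> R) (x M : R) :
  (exists2 d, 0 < d & forall y, `|y - x| < d -> `|g y - g x| <= M * `|y - x|) ->
  {for x, continuous g}.
Proof.
move=> [d d0 gd]; apply/cvgrPdist_lt => e e0.
have M0 : 0 < `|M| + 1 by rewrite ltr_wpDl.
near=> y; rewrite distrC.
have yd : `|y - x| < d.
  by rewrite distrC; near: y; exact: (@nbhsx_ballx _ R^o x d d0).
have ye : `|y - x| < e / (`|M| + 1).
  rewrite distrC; near: y.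
  by apply: (@nbhsx_ballx _ R^o x); rewrite divr_gt0.
rewrite (le_lt_trans (gd _ yd))// (@le_lt_trans _ _ ((`|M| + 1) * `|y - x|))//.
  by rewrite ler_wpM2r// (le_trans (ler_norm _))// lerDl.
by rewrite mulrC -ltr_pdivlMr.
Unshelve. all: by end_near. Qed.

Lemma lip_bound (e c x y z : R) :
  `|z - (c * x + y * 0)| <= e * (`|x| + `|0:R|) ->
  `|z| <= (e + `|c|) * `|x|.
Proof.
rewrite mulr0 addr0 normr0 addr0 => h.
rewrite -(subrK (c * x) z) (le_trans (ler_normD _ _))//.
by rewrite normrM mulrDl lerD.
Qed.

Lemma Green_cont :
  [/\ forall t, t1 <= t <= t2 -> seg_cont (u ^~ t) s1 s2,
      forall s, s1 <= s <= s2 -> seg_cont (u s) t1 t2,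
      forall t, t1 <= t <= t2 -> seg_cont (v ^~ t) s1 s2 &
      forall s, s1 <= s <= s2 -> seg_cont (v s) t1 t2].
Proof.
split=> [t tt s ss|s ss t tt|t tt s ss|s ss t tt];
  have [b [c [d /(_ 1 ltr01)[del del0 H]]]] := diff_uv _ _ ss tt;
  have H0 (x : R) : `|x - x| < del by [rewrite subrr normr0].
- apply: (@lip_cvg _ _ (1 + `|c|)); exists del => // s' ss'.
  have [h _] := H s' t ss' (H0 t); rewrite subrr in h; exact: (@lip_bound _ _ _ b).
- apply: (@lip_cvg _ _ (1 + `|b|)); exists del => // t' tt'.
  have [h _] := H s t' (H0 s) tt'; rewrite subrr in h.
  by move: h; rewrite [c * 0 + _]addrC [`|0| + _]addrC; exact: lip_bound.
- apply: (@lip_cvg _ _ (1 + `|d|)); exists del => // s' ss'.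
  have [_ h] := H s' t ss' (H0 t); rewrite subrr in h; exact: (@lip_bound _ _ _ c).
- apply: (@lip_cvg _ _ (1 + `|c|)); exists del => // t' tt'.
  have [_ h] := H s t' (H0 s) tt'; rewrite subrr in h.
  by move: h; rewrite [d * 0 + _]addrC [`|0| + _]addrC; exact: lip_bound.
Qed.

(** The integral of v ds + u dt along the boundary of the rectangle, counterclockwise; for F = u +
    iv it is the imaginary part of the contour integral of F. *)
Let flux a b c d : R :=
  (seg_int (u b) c d - seg_int (u a) c d) -
  (seg_int (v ^~ d) a b - seg_int (v ^~ c) a b).

Lemma flux_quarters x y h k : 0 <= h -> 0 <= k ->
  s1 <= x -> x + (h + h) <= s2 -> t1 <= y -> y + (k + k) <= t2 ->
  flux x (x + (h + h)) y (y + (k + k)) =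
  flux x (x + h) y (y + k) + flux (x + h) (x + h + h) y (y + k)
  + flux x (x + h) (y + k) (y + k + k)
  + flux (x + h) (x + h + h) (y + k) (y + k + k).
Proof.
move=> h0 k0 sx xs ty yt; have [cus cut cvs cvt] := Green_cont.
rewrite /flux !addrA.
have Et z : s1 <= z <= s2 -> seg_int (u z) y (y + k + k) =
    seg_int (u z) y (y + k) + seg_int (u z) (y + k) (y + k + k).
  move=> zz; apply: seg_int_split; rewrite ?lerDl//.
  by apply: seg_cont_sub (cut z zz) => //; rewrite -addrA.
have Es z : t1 <= z <= t2 -> seg_int (v ^~ z) x (x + h + h) =
    seg_int (v ^~ z) x (x + h) + seg_int (v ^~ z) (x + h) (x + h + h).
  move=> zz; apply: seg_int_split; rewrite ?lerDl//.
  by apply: seg_cont_sub (cvs z zz) => //; rewrite -addrA.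
rewrite (Et x) ?(Et (x + h)) ?(Et (x + h + h)) ?(Es y) ?(Es (y + k)) ?(Es (y + k + k));
  first (by ring); clear -h0 k0 sx xs ty yt; lra.
Qed.

(** The affine parts of [u] and [v] both contribute [c * h * k] and cancel. What remains is the
    error [e * (h + k)], once for each of the two opposite sides, hence [2 * e], integrated over
    lengths [k] and [h]. *)
Lemma flux_small e b c d u0 v0 x y x' y' h k : 0 <= h -> 0 <= k ->
  s1 <= x' -> x' + h <= s2 -> t1 <= y' -> y' + k <= t2 ->
  (forall z w, x' <= z <= x' + h -> y' <= w <= y' + k ->
    `|u z w - u0 - (c * (z - x) + b * (w - y))| <= e * (h + k) /\
    `|v z w - v0 - (d * (z - x) + c * (w - y))| <= e * (h + k)) ->
  `|flux x' (x' + h) y' (y' + k)| <= 2 * e * (h + k) ^+ 2.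
Proof.
move=> h0 k0 sx xs ty yt near; have [cus cut cvs cvt] := Green_cont.
have xh : x' <= x' + h by rewrite lerDl.
have yk : y' <= y' + k by rewrite lerDl.
have x1 : s1 <= x' <= s2 by rewrite sx (le_trans xh xs).
have x2 : s1 <= x' + h <= s2 by rewrite xs (le_trans sx xh).
have y1 : t1 <= y' <= t2 by rewrite ty (le_trans yk yt).
have y2 : t1 <= y' + k <= t2 by rewrite yt (le_trans ty yk).
have cu z : s1 <= z <= s2 -> seg_cont (u z) y' (y' + k).
  by move=> zz; apply: seg_cont_sub (cut z zz).
have cv z : t1 <= z <= t2 -> seg_cont (v ^~ z) x' (x' + h).
  by move=> zz; apply: seg_cont_sub (cvs z zz).
have Iu : `|seg_int (u (x' + h)) y' (y' + k) - seg_int (u x') y' (y' + k)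
     - c * h * k| <= 2 * e * (h + k) * k.
  rewrite -seg_intB; [|exact: cu|exact: cu].
  have := @seg_int_near_cst _ (fun t => u (x' + h) t - u x' t) y' (y' + k)
    (c * h) (2 * e * (h + k)).
  rewrite [y' + k - y']addrC addKr; apply=> //; first by apply: seg_contB; exact: cu.
  move=> w ww.
  have [+ _] := near (x' + h) w ltac:(by rewrite xh lexx) ww.
  have [+ _] := near x' w ltac:(by rewrite xh lexx) ww.
  by rewrite !ler_norml -mulrA; set ee := e * _; clear; lra.
have Iv : `|seg_int (v ^~ (y' + k)) x' (x' + h) - seg_int (v ^~ y') x' (x' + h)
     - c * k * h| <= 2 * e * (h + k) * h.
  rewrite -seg_intB; [|exact: cv|exact: cv].
  have := @seg_int_near_cst _ (fun t => v t (y' + k) - v t y') x' (x' + h)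
    (c * k) (2 * e * (h + k)).
  rewrite [x' + h - x']addrC addKr; apply=> //; first by apply: seg_contB; exact: cv.
  move=> z zz.
  have [_ +] := near z (y' + k) zz ltac:(by rewrite yk lexx).
  have [_ +] := near z y' zz ltac:(by rewrite yk lexx).
  by rewrite !ler_norml -mulrA; set ee := e * _; clear; lra.
have -> : 2 * e * (h + k) ^+ 2 = 2 * e * (h + k) * k + 2 * e * (h + k) * h.
  by ring.
rewrite /flux; move: Iu Iv; set A := _ - seg_int (u x') _ _.
set B := _ - seg_int (v ^~ y') _ _.
have -> : c * k * h = c * h * k by ring.
by rewrite !ler_norml; clear; lra.
Qed.

Lemma Green_rectangle :
  seg_int (u s2) t1 t2 - seg_int (u s1) t1 t2 =
  seg_int (v ^~ t2) s1 s2 - seg_int (v ^~ t1) s1 s2.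
Proof.
set h := s2 - s1; set k := t2 - t1.
have h0 : 0 <= h by rewrite subr_ge0.
have k0 : 0 <= k by rewrite subr_ge0.
have Es2 : s1 + h = s2 by rewrite addrC subrK.
have Et2 : t1 + k = t2 by rewrite addrC subrK.
have hn_ge0 n : 0 <= h / 2 ^+ n by rewrite divr_ge0// exprn_ge0.
have kn_ge0 n : 0 <= k / 2 ^+ n by rewrite divr_ge0// exprn_ge0.
have halve (a : R) n : a / 2 ^+ n = a / 2 ^+ n.+1 + a / 2 ^+ n.+1.
  by rewrite exprS; field.
have small eta : 0 < eta -> `|flux s1 s2 t1 t2| <= eta.
  move=> eta0.
  (* Each quarter receives a quarter of the tolerance, the rate at which the quadratic bound of
     [flux_small] decreases. *)
  pose P n x y := s1 <= x -> x + h / 2 ^+ n <= s2 -> t1 <= y -> y + k / 2 ^+ n <= t2 ->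
    `|flux x (x + h / 2 ^+ n) y (y + k / 2 ^+ n)| <= eta / 4 ^+ n.
  suff : P 0%N s1 t1.
    by rewrite /P expr0 !divr1 Es2 Et2; apply.
  apply: (@bisection _ h k P h0 k0) => [n x y|x y xx yy].
    have := hn_ge0 n.+1; have := kn_ge0 n.+1.
    rewrite /P (halve h n) (halve k n).
    set h' := h / 2 ^+ n.+1; set k' := k / 2 ^+ n.+1 => k'0 h'0.
    move=> p1 p2 p3 p4 q1 q2 q3 q4.
    have E4 : eta / 4 ^+ n = eta / 4 ^+ n.+1 + eta / 4 ^+ n.+1 + eta / 4 ^+ n.+1
         + eta / 4 ^+ n.+1 by rewrite exprS; field.
    rewrite flux_quarters// E4.
    have xh : x + h' <= s2 by rewrite (le_trans _ q2)// lerD2l lerDl.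
    have xh2 : x + h' + h' <= s2 by rewrite -addrA.
    have yk : y + k' <= t2 by rewrite (le_trans _ q4)// lerD2l lerDl.
    have yk2 : y + k' + k' <= t2 by rewrite -addrA.
    have sx : s1 <= x + h' by rewrite (le_trans q1)// lerDl.
    have ty : t1 <= y + k' by rewrite (le_trans q3)// lerDl.
    rewrite (le_trans (ler_normD _ _))// lerD//; last exact: p4.
    rewrite (le_trans (ler_normD _ _))// lerD//; last exact: p3.
    rewrite (le_trans (ler_normD _ _))// lerD//; last exact: p2.
    exact: p1.
  rewrite Es2 in xx; rewrite Et2 in yy.
  have [b [c [d H]]] := diff_uv x y xx yy.
  (* Chosen to give [2 * e * (h + k) ^+ 2 <= eta]; the [+ 1] keeps the denominator positive for a
     degenerate rectangle. *)
  pose e := eta / (2 * (h + k + 1) ^+ 2).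
  have hk1 : 0 < h + k + 1 by rewrite ltr_wpDl// addr_ge0.
  have e0 : 0 < e by rewrite divr_gt0// mulr_gt0// exprn_gt0.
  have {H}[del del0 H] := H e e0.
  have [n [nd1 nd2]] : exists n, h / 2 ^+ n < del /\ k / 2 ^+ n < del.
    have : \forall n \near \oo, (h + k) / 2 ^+ n < del.
      have := @cvg_geometric R (h + k) (2^-1) ltac:(rewrite ger0_norm; lra).
      move/cvgr0_norm_lt => /(_ _ del0); apply: filterS => n.
      rewrite /geometric /= exprVn ger0_norm//.
      by rewrite divr_ge0// ?exprn_ge0// addr_ge0.
    case=> n _ /(_ n (leqnn n)) nd; exists n.
    by split; rewrite (le_lt_trans _ nd)// ler_pM2r ?invr_gt0 ?exprn_gt0// ?lerDl ?lerDr.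
  exists n => x' y' xx' yy' q1 q2 q3 q4.
  have := flux_small e b c d (u x y) (v x y) x y x' y' _ _ (hn_ge0 n) (kn_ge0 n) q1 q2 q3 q4.
  have ht : `|flux x' (x' + h / 2 ^+ n) y' (y' + k / 2 ^+ n)|
      <= 2 * e * (h / 2 ^+ n + k / 2 ^+ n) ^+ 2 ->
    `|flux x' (x' + h / 2 ^+ n) y' (y' + k / 2 ^+ n)| <= eta / 4 ^+ n.
    move/le_trans; apply.
    rewrite -mulrDl exprMn exprVn -exprM mulnC exprM.
    have -> : (2 : R) ^+ 2 = 4 by ring.
    rewrite mulrA ler_pM2r ?invr_gt0 ?exprn_gt0//.
    have -> : 2 * e * (h + k) ^+ 2 = eta * ((h + k) ^+ 2 / (h + k + 1) ^+ 2).
      by rewrite /e; field; rewrite gt_eqF.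
    rewrite ger_pMr// ler_pdivrMr ?exprn_gt0// mul1r lerXn2r ?nnegrE ?lerDl//.
      exact: addr_ge0.
    exact: ltW.
  move=> near; apply: ht; apply: near => z w zz ww.
  have zx : `|z - x| <= h / 2 ^+ n.
    exact: (dist_le_itv xx' zz).
  have wy : `|w - y| <= k / 2 ^+ n.
    exact: (dist_le_itv yy' ww).
  have [h1 h2] := H z w (le_lt_trans zx nd1) (le_lt_trans wy nd2).
  have le : e * (`|z - x| + `|w - y|) <= e * (h / 2 ^+ n + k / 2 ^+ n).
    by rewrite ler_pM2l// lerD.
  by split; [exact: le_trans h1 le|exact: le_trans h2 le].
have : flux s1 s2 t1 t2 = 0.
  apply/eqP; rewrite -normr_le0; apply/ler_addgt0Pl => eta eta0.
  by rewrite addr0; exact: small.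
by rewrite /flux => /subr0_eq.
Qed.

End Green.

(** * The mean value property *)

Section ComplexDerivative.
Context {R : realType}.
Implicit Types (f g : R[i] -> R[i]) (z l m h : R[i]).

(** Complex derivative as a first-order expansion, free of quotients, so that the chain rule needs
    no case for a vanishing inner increment. *)
Definition cdiff f z l := forall e : R, 0 < e -> exists2 d : R, 0 < d &
    forall h, cmod h < d -> cmod (f (z + h) - f z - l * h) <= e * cmod h.

Lemma analytic_cdiff f z : analytic_disc f -> cmod z < 1 -> exists l, cdiff f z l.
Proof. by move=> fa z1; exact: cderivP (fa z z1). Qed.

Lemma cdiff_comp f g z l m : cdiff g z l -> cdiff f (g z) m ->
  cdiff (f \o g) z (m * l).
Proof.
move=> gl fm e e0.
have lp : 0 < cmod l + 1 by rewrite ltr_wpDl// cmod_ge0.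
have mp : 0 < cmod m + 1 by rewrite ltr_wpDl// cmod_ge0.
have [d1 d10 fm1] := fm (e / 2 / (cmod l + 1)) ltac:(by rewrite !divr_gt0).
have [d2 d20 gl1] := gl 1 ltr01.
have [d3 d30 gl2] := gl (e / 2 / (cmod m + 1)) ltac:(by rewrite !divr_gt0).
exists (Num.min (Num.min d2 d3) (d1 / (cmod l + 1))).
  by rewrite !lt_min d20 d30 divr_gt0.
move=> h; rewrite !lt_min => /andP[/andP[hd2 hd3] hd1] /=.
set k := g (z + h) - g z.
have kh : cmod k <= (cmod l + 1) * cmod h.
  have -> : k = (g (z + h) - g z - l * h) + l * h by rewrite /k; ring.
  rewrite (le_trans (cmodD _ _))// cmodM mulrDl addrC lerD2l.
  by rewrite mul1r -[leRHS]mul1r; exact: gl1.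
have -> : g (z + h) = g z + k by rewrite /k; ring.
have -> : f (g z + k) - f (g z) - m * l * h =
   (f (g z + k) - f (g z) - m * k) + m * (g (z + h) - g z - l * h).
  by rewrite -/k; ring.
rewrite (le_trans (cmodD _ _))// [e]splitr mulrDl lerD//.
  apply: (le_trans (fm1 _ _)).
    by rewrite (le_lt_trans kh)// mulrC -ltr_pdivlMr.
  rewrite -mulrA ler_pM2l ?divr_gt0//.
  by rewrite ler_pdivrMl.
rewrite cmodM.
apply: (@le_trans _ _ (cmod m * (e / 2 / (cmod m + 1) * cmod h))).
  by rewrite ler_wpM2l ?cmod_ge0// gl2.
rewrite mulrA ler_wpM2r ?cmod_ge0// mulrCA ger_pMr ?divr_gt0//.
by rewrite ler_pdivrMr// mul1r lerDl.
Qed.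

Lemma is_derive_small (g : R -> R) (x l : R) : is_derive x 1 g l ->
  forall e, 0 < e -> exists2 d : R, 0 < d &
  forall h : R, `|h| < d -> `|g (x + h) - g x - l * h| <= e * `|h|.
Proof.
move=> [/cvg_ex[/= l' gl']] E e e0.
have El : l' = l by rewrite -E; apply/esym/cvg_lim => //; exact: norm_hausdorff.
rewrite {}El in gl'.
move/cvgrPdist_lt: gl' => /(_ e e0).
move=> /nbhs_ballP[d /= d0 dP]; exists d => // h hd.
have [->|h0] := eqVneq h 0; first by rewrite addr0 subrr mulr0 subr0 normr0 mulr0.
have := dP h; rewrite /ball /= sub0r normrN => /(_ hd h0) le.
have -> : g (x + h) - g x - l * h = - (h * (l - h^-1 *: (g (h *: 1 + x) - g x))).
  rewrite /GRing.scale /= mulr1 [h + x]addrC.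
  by field.
by rewrite normrN normrM mulrC ler_wpM2r// ltW.
Qed.

Lemma cdiff_cexp0 : cdiff (@cexp R) 0 1.
Proof.
move=> e e0.
(* The real and the imaginary part each cost [3 * n * cmod h], hence 6; the bound 1 gives
   [expR x <= 2]. *)
pose n := Num.min (e / 6) 1.
have n0 : 0 < n by rewrite lt_min divr_gt0/=.
have ne : n <= e / 6 by rewrite ge_min lexx.
have n1 : n <= 1 by rewrite ge_min lexx orbT.
have [d1 d10 ex] := is_derive_small _ _ _ (is_derive_expR (0 : R)) n n0.
have [d2 d20 co] := is_derive_small _ _ _ (is_derive_cos (0 : R)) n n0.
have [d3 d30 si] := is_derive_small _ _ _ (is_derive_sin (0 : R)) n n0.
exists (Num.min (Num.min d1 d2) (Num.min d3 (n / 3))).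
  by rewrite !lt_min d10 d20 d30/=; apply: divr_gt0.
move=> h; rewrite !lt_min => /andP[/andP[hd1 hd2] /andP[hd3 hn]].
have xh := normRe_cmod h; have yh := normIm_cmod h.
rewrite add0r mul1r (le_trans (cmod_le _))//.
have -> : cexp (0 : R[i]) = 1 by rewrite cexpE expi0 mulr1 expR0.
have Er : Re (cexp h) = expR (Re h) * cos (Im h).
  by rewrite cexpE ReM Re_expi mul0r subr0.
have Ei : Im (cexp h) = expR (Re h) * sin (Im h).
  by rewrite cexpE ImM Im_expi mul0r addr0.
rewrite !ReD !ImD !ReN !ImN Er Ei [Re 1]/= [Im 1]/= subr0.
move: (Re h) (Im h) xh yh => x y xh yh.
have {ex} := ex x (le_lt_trans xh hd1); rewrite add0r expR0 mul1r => ex.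
have {co} := co y (le_lt_trans yh hd2); rewrite add0r cos0 sin0 oppr0 mul0r subr0 => co.
have {si} := si y (le_lt_trans yh hd3); rewrite add0r cos0 sin0 mul1r subr0 => si.
have ch0 := cmod_ge0 h.
have ex1 : `|expR x - 1| <= n.
  rewrite -[expR x - 1](subrK x) (le_trans (ler_normD _ _))//.
  apply: (@le_trans _ _ (1 * `|x| + `|x|)); last by lra.
  by rewrite lerD2r (le_trans ex)// ler_wpM2r.
have ex2 : expR x <= 2 by move: ex1; rewrite ler_norml; lra.
have exp0 : 0 < expR x by exact: expR_gt0.
have nx : n * `|x| <= n * cmod h by rewrite ler_pM2l.
have ny : n * `|y| <= n * cmod h by rewrite ler_pM2l.
have A1 : `|expR x * cos y - 1 - x| <= n * cmod h + 2 * (n * cmod h).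
  have -> : expR x * cos y - 1 - x = (expR x - 1 - x) + expR x * (cos y - 1) by ring.
  rewrite (le_trans (ler_normD _ _))// lerD//; first exact: le_trans ex nx.
  rewrite normrM gtr0_norm//; apply: ler_pM => //.
  exact: le_trans co ny.
have A2 : `|expR x * sin y - y| <= 2 * (n * cmod h) + n * cmod h.
  have -> : expR x * sin y - y = expR x * (sin y - y) + (expR x - 1) * y by ring.
  rewrite (le_trans (ler_normD _ _))// lerD//.
    rewrite normrM gtr0_norm//; apply: ler_pM => //.
    exact: le_trans si ny.
  by rewrite normrM; apply: ler_pM.
have : n * cmod h <= e / 6 * cmod h by rewrite ler_wpM2r.
lra.
Qed.

Lemma cdiff_cexp z : cdiff (@cexp R) z (cexp z).
Proof.
move=> e e0.
have c0 : 0 < cmod (cexp z) by rewrite cmod_cexp expR_gt0.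
have [d d0 H] := cdiff_cexp0 _ (divr_gt0 e0 c0).
exists d => // h /H; rewrite add0r mul1r [cexp 0]cexpE expi0 /= expR0 mulr1 => le.
have -> : cexp (z + h) - cexp z - cexp z * h = cexp z * (cexp h - 1 - h).
  by rewrite cexpD; ring.
by rewrite cmodM mulrC -ler_pdivlMr// mulrAC.
Qed.

Lemma cdiff_translate (a z : R[i]) : cdiff (fun w => a + w) z 1.
Proof.
move=> e e0; exists 1 => // h _.
have -> : a + (z + h) - (a + z) - 1 * h = 0 by ring.
by rewrite cmod0 mulr_ge0 ?cmod_ge0// ltW.
Qed.

End ComplexDerivative.

Section MeanValue.
Context {R : realType}.
Variable f : R[i] -> R[i].
Hypothesis fa : analytic_disc f.

(** In the coordinates z = a + exp(s + it), circles about [a] become vertical sides of a rectangle.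
    The horizontal sides t = 0 and t = 2 pi carry the same values by periodicity, so Green's formula
    equates the integrals over the vertical ones. *)
Lemma circle_mean_const (a : R[i]) (s1 s2 : R) : s1 <= s2 ->
  cmod a + expR s2 < 1 ->
  (forall t, {for t, continuous (fun t => Re (f (a + (expR s1)%:C * expi t)))}) /\
  seg_int (fun t => Re (f (a + (expR s2)%:C * expi t))) 0 (2 * pi) =
  seg_int (fun t => Re (f (a + (expR s1)%:C * expi t))) 0 (2 * pi).
Proof.
move=> s12 as2.
pose F (s t : R) := f (a + cexp (s +i* t)).
have FE s t : F s t = f (a + (expR s)%:C * expi t) by rewrite /F cexpE.
have diffF s t : s <= s2 -> exists b c d : R, forall e, 0 < e ->
    exists2 del : R, 0 < del &
    forall s' t', `|s' - s| < del -> `|t' - t| < del ->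
    `|Re (F s' t') - Re (F s t) - (c * (s' - s) + b * (t' - t))|
       <= e * (`|s' - s| + `|t' - t|) /\
    `|Im (F s' t') - Im (F s t) - (d * (s' - s) + c * (t' - t))|
       <= e * (`|s' - s| + `|t' - t|).
  move=> ss2; pose z := s +i* t.
  have az1 : cmod (a + cexp z) < 1.
    rewrite (le_lt_trans (cmodD _ _))// (le_lt_trans _ as2)// lerD2l.
    by rewrite cmod_cexp ler_expR.
  have [m fm] := analytic_cdiff _ _ fa az1.
  have := cdiff_comp _ _ _ _ _ (cdiff_comp _ _ _ _ _ (cdiff_cexp z)
     (cdiff_translate a (cexp z))) fm.
  rewrite mul1r; move: (m * cexp z) => l Fl.
  (* Multiplication by [l] sends ds + i dt to (Re l ds - Im l dt) + i (Im l ds + Re l dt). *)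
  exists (- Im l), (Re l), (Im l) => e e0.
  have [del del0 H] := Fl e e0; exists (del / 2); first by rewrite divr_gt0.
  move=> s' t' ss' tt'; pose h := (s' - s) +i* (t' - t).
  have hle : cmod h <= `|s' - s| + `|t' - t| := cmod_le h.
  have hd : cmod h < del by rewrite (le_lt_trans hle)// [del]splitr ltrD.
  have := H h hd; rewrite /=.
  have -> : z + h = s' +i* t'.
    by apply/eqP; rewrite eq_complex /= [s + _]addrC [t + _]addrC !subrK !eqxx.
  rewrite -/(F s' t') -/(F s t); set W := _ - l * h => Wle.
  have {}Wle : cmod W <= e * (`|s' - s| + `|t' - t|).
    by rewrite (le_trans Wle)// ler_pM2l.
  split.
    have -> : Re (F s' t') - Re (F s t) - (Re l * (s' - s) + - Im l * (t' - t)) = Re W.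
      by rewrite /W !ReD !ReN [Re (l * h)]ReM /=; ring.
    exact: le_trans (normRe_cmod _) Wle.
  have -> : Im (F s' t') - Im (F s t) - (Im l * (s' - s) + Re l * (t' - t)) = Im W.
    by rewrite /W !ImD !ImN [Im (l * h)]ImM /=; ring.
  exact: le_trans (normIm_cmod _) Wle.
have dF (t1 t2 : R) s t : s1 <= s <= s2 -> t1 <= t <= t2 -> _ :=
  fun ss _ => diffF s t (proj2 (andP ss)).
have pi20 : 0 <= 2 * pi :> R by rewrite mulr_ge0// pi_ge0.
have FR s : (fun t => Re (f (a + (expR s)%:C * expi t))) = (fun t => Re (F s t)).
  by apply/funext => t'; rewrite FE.
rewrite !FR; split.
  move=> t.
  have [_ cR _ _] := Green_cont _ _ _ _ _ _ (dF t t).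
  by apply: (cR s1); rewrite lexx.
have G := Green_rectangle _ _ _ _ _ _ s12 pi20 (dF 0 (2 * pi)).
have IE : (fun s => Im (F s (2 * pi))) = (fun s => Im (F s 0)).
  by apply/funext => s; rewrite !FE expi2pi expi0.
apply: subr0_eq; apply: (etrans G); rewrite IE; exact: subrr.
Qed.

(** The logarithmic coordinate never reaches the centre, so the integral is moved to circles of
    arbitrarily small radius, where continuity of [f] at [a] determines it; radius 0 is treated
    apart. *)
Lemma mean_value (a : R[i]) (r : R) : 0 <= r -> cmod a + r < 1 ->
  seg_int (fun t => Re (f (a + r%:C * expi t))) 0 (2 * pi) = 2 * pi * Re (f a).
Proof.
have pi20 : 0 < 2 * pi :> R by rewrite mulr_gt0// pi_gt0.
rewrite le_eqVlt => /predU1P[<- _|r0 ar1].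
  under [X in seg_int X]eq_fun do rewrite mul0r addr0.
  by rewrite seg_int_cst ?ltW// subr0 mulrC.
have a1 : cmod a < 1 by rewrite (le_lt_trans _ ar1)// lerDl ltW.
have key e : 0 < e ->
    `|seg_int (fun t => Re (f (a + r%:C * expi t))) 0 (2 * pi) - Re (f a) * (2 * pi - 0)|
      <= e * (2 * pi - 0).
  move=> e0.
  have [d d0 dP] := analytic_eps _ _ fa a1 _ e0.
  pose s1 := ln (Num.min r (d / 2)).
  have m0 : 0 < Num.min r (d / 2) by rewrite lt_min r0 divr_gt0.
  have es1 : expR s1 = Num.min r (d / 2) by rewrite lnK ?posrE.
  have es2 : expR (ln r) = r by rewrite lnK ?posrE.
  have s12 : s1 <= ln r by rewrite ler_ln ?posrE// ge_min lexx.
  have [ct E] := circle_mean_const a _ _ s12 ltac:(by rewrite es2).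
  rewrite es2 in E; rewrite E.
  apply: seg_int_near_cst; first exact: ltW.
    by move=> t _; exact: ct.
  move=> t _; apply: ltW; rewrite -ReN -ReD.
  apply: (le_lt_trans (normRe_cmod _)); apply: dP.
  rewrite addrC addKr cmodM cmod_expi mulr1 cmodC gtr0_norm ?expR_gt0//.
  rewrite es1 (@le_lt_trans _ _ (d / 2)) ?ge_min ?lexx ?orbT//.
  by rewrite ltr_pdivrMr// mulr_natr mulr2n ltrDl.
apply/eqP; rewrite -subr_eq0 -normr_le0; apply/ler_addgt0Pl => e e0.
have := key (e / (2 * pi)) ltac:(by rewrite divr_gt0).
by rewrite subr0 divfK ?gt_eqF// addr0 [Re _ * _]mulrC.
Qed.

End MeanValue.

(** * Measurability and Tonelli on an interval *)

Section RealLemmas.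
Context {R : realType}.

Lemma cvg_powR (T : Type) (F : set_system T) {FF : Filter F} (g : T -> R) (l p : R) :
  0 < p -> (forall x, 0 <= g x) -> g x @[x --> F] --> l ->
  (g x) `^ p @[x --> F] --> l `^ p.
Proof.
move=> p0 g0 gl.
have [l0|l0|l0] := ltgtP l 0.
(* Since [g] is nonnegative, a negative limit is possible only along the improper filter. *)
- move=> A _.
  have H : \forall x \near F, False.
    have /cvgrPdist_lt/(_ (- l)) := gl; rewrite oppr_gt0 => /(_ l0).
    apply: filterS => x; rewrite ltr_norml => /andP[h _]; have := g0 x; lra.
  by apply: filterS H.
- have cp : {for l, continuous (fun y : R => y `^ p)}.
    apply: differentiable_continuous; apply/derivable1_diffP.
    by apply: derivable_powR; rewrite in_itv /= l0.
  exact: (cvg_comp _ _ gl cp).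
- rewrite l0 powR0 ?gt_eqF//; apply/cvgr0Pnorm_lt => e e0.
  have e'0 : 0 < e `^ p^-1 by rewrite powR_gt0.
  move: gl; rewrite l0 => /cvgr0Pnorm_lt/(_ _ e'0); apply: filterS => x.
  rewrite ger0_norm// ger0_norm ?powR_ge0// => h.
  have : (g x) `^ p < (e `^ p^-1) `^ p by rewrite gt0_ltr_powR// nnegrE ?powR_ge0.
  by rewrite -powRrM mulVf ?gt_eqF// powRr1// ltW.
Qed.

(** The product sigma-algebra is generated by rectangles rather than by open sets of the plane. An
    open preimage is a countable union of boxes with rational centre and radius. *)
Lemma continuous2_measurable (G : R * R -> R) :
  (forall x, {for x, continuous G}) ->
  measurable_fun [set: measurableTypeR R * measurableTypeR R] G.
Proof.
move=> cG; apply: (measurability _ (RGenOpens.measurableE R)).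
move=> _ [_ [a [b ->] <-]]; rewrite setTI.
set O := G @^-1` _.
have oO : open (O : set (R * R)).
  apply: open_comp; last exact: interval_open.
  by move=> x _; exact: cG.
pose box (q : rat * rat * rat) : set (R * R) :=
  [set z | `|z.1 - ratr q.1.1| < ratr q.2 /\ `|z.2 - ratr q.1.2| < ratr q.2].
have -> : O = \bigcup_q (if `[< box q `<=` O >] then box q else set0).
  apply/seteqP; split => [[x y] Oxy|[x y] [q _]]; last first.
    by case: ifPn => // /asboolP; exact.
  have [d d0 dO] : exists2 d : R, 0 < d &
      forall x' y', `|x' - x| < d -> `|y' - y| < d -> O (x', y').
    have : nbhs (x, y) O by apply: open_nbhs_nbhs; split.
    move=> [[A B] /= [/nbhs_ballP[a' /= a'0 aA] /nbhs_ballP[b' /= b'0 bB]] AB].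
    exists (Num.min a' b') => [|x' y']; first by rewrite lt_min a'0.
    rewrite !lt_min => /andP[xa _] /andP[_ yb]; apply: AB; split => /=.
      by apply: aA; rewrite /ball /= distrC.
    by apply: bB; rewrite /ball /= distrC.
  have [e /itvP he] := @rat_in_itvoo _ (d / 4) (d / 2) ltac:(lra).
  have [q1 /itvP h1] := @rat_in_itvoo _ (x - d / 4) (x + d / 4) ltac:(lra).
  have [q2 /itvP h2] := @rat_in_itvoo _ (y - d / 4) (y + d / 4) ltac:(lra).
  have [{}he1 {}he2] : d / 4 < ratr e /\ ratr e < d / 2 by rewrite !he.
  have [h1a h1b] : x - d / 4 < ratr q1 /\ ratr q1 < x + d / 4 by rewrite !h1.
  have [h2a h2b] : y - d / 4 < ratr q2 /\ ratr q2 < y + d / 4 by rewrite !h2.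
  have xb : box ((q1, q2), e) (x, y).
    by split => /=; rewrite ltr_norml; lra.
  exists ((q1, q2), e) => //; rewrite ifT//.
  apply/asboolP => -[x' y'] [/= + +]; rewrite !ltr_norml => hx hy.
  by apply: dO; rewrite ltr_norml; lra.
apply: countable_bigcupT_measurable; first exact: countableP.
move=> q; case: ifPn => // _.
have -> : box q = [set x | `|x - ratr q.1.1| < ratr q.2] `*`
    [set y | `|y - ratr q.1.2| < ratr q.2] by [].
by apply: measurableX; apply: open_measurable;
  under [X in open X]eq_set do rewrite distrC; exact: ball_open.
Qed.

(** Extension of [G] by zero off [A] x [B] reduces this to Tonelli on the whole plane. *)
Lemma tonelli_on
    (m1 m2 : {sigma_finite_measure set (measurableTypeR R) -> \bar R})
    (A B : set (measurableTypeR R)) (G : R * R -> \bar R) :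
  measurable A -> measurable B -> (forall z, (0 <= G z)%E) ->
  measurable_fun [set: measurableTypeR R * measurableTypeR R] G ->
  (\int[m1]_(x in A) \int[m2]_(y in B) G (x, y) =
   \int[m2]_(y in B) \int[m1]_(x in A) G (x, y))%E.
Proof.
move=> mA mB G0 mG.
pose H := (G \_ (A `*` B)) : measurableTypeR R * measurableTypeR R -> \bar R.
have mH : measurable_fun setT H.
  apply/(measurable_restrictT _ _).1; first exact: measurableX.
  exact: measurable_funTS.
have H0 z : (0 <= H z)%E by apply: erestrict_ge0 => ? _; exact: G0.
have HE x y : H (x, y) = if (x \in A) && (y \in B) then G (x, y) else 0%E.
  by rewrite /H patchE in_setX.
transitivity (\int[m1]_x \int[m2]_y H (x, y))%E.
  rewrite integral_mkcond; apply: eq_integral => x _; rewrite patchE.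
  case: ifPn => xA.
    rewrite integral_mkcond; apply: eq_integral => y _.
    by rewrite HE xA patchE.
  by rewrite integral0_eq// => y _; rewrite HE (negbTE xA).
rewrite (fubini_tonelli H mH H0).
rewrite [RHS]integral_mkcond; apply: eq_integral => y _; rewrite patchE.
case: ifPn => yB.
  rewrite [RHS]integral_mkcond; apply: eq_integral => x _.
  by rewrite HE yB andbT patchE.
by rewrite integral0_eq// => x _; rewrite HE (negbTE yB) andbF.
Qed.

Lemma measurable_int_on
    (m2 : {sigma_finite_measure set (measurableTypeR R) -> \bar R})
    (B : set (measurableTypeR R)) (G : R * R -> \bar R) :
  measurable B -> (forall z, (0 <= G z)%E) ->
  measurable_fun [set: measurableTypeR R * measurableTypeR R] G ->
  measurable_fun [set: measurableTypeR R] (fun x => \int[m2]_(y in B) G (x, y))%E.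
Proof.
move=> mB G0 mG.
pose H := (G \_ (setT `*` B)) : measurableTypeR R * measurableTypeR R -> \bar R.
have mH : measurable_fun setT H.
  apply/(measurable_restrictT _ _).1; first exact: measurableX.
  exact: measurable_funTS.
have H0 z : (0 <= H z)%E by apply: erestrict_ge0 => ? _; exact: G0.
have := @measurable_fun_fubini_tonelli_F _ _ _ _ _ m2 H mH H0.
congr (measurable_fun _ _); apply/funext => x; rewrite /fubini_F [RHS]integral_mkcond.
by apply: eq_integral => y _; rewrite /H !patchE in_setX in_setT.
Qed.

Lemma seg_int_translate (g : R -> R) (a b c : R) : a <= b ->
  seg_cont g (a + c) (b + c) ->
  seg_int g (a + c) (b + c) = seg_int (fun x => g (x + c)) a b.
Proof.
move=> ab cg; rewrite /seg_int /Rintegral; congr fine.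
have dF : derive1 (fun x : R => x + c) = fun=> 1.
  apply/funext => x; rewrite derive1E deriveD//.
  by rewrite derive_id derive_cst addr0.
rewrite (@integration_by_substitution_increasing _ (fun x => x + c) g a b ab).
- by apply: eq_integral => x _; rewrite dF /= fctE mulr1.
- by move=> x y _ _; rewrite ltrD2r.
- by rewrite dF => x _; exact: cvg_cst.
- by rewrite dF; exact: is_cvg_cst.
- by rewrite dF; exact: is_cvg_cst.
- split.
  + by move=> x _; exact: ex_derive.
  + apply: cvgD; last exact: cvg_cst.
    exact: cvg_at_right_filter.
  + apply: cvgD; last exact: cvg_cst.
    exact: cvg_at_left_filter.
- by apply: continuous_in_subspaceT => x; rewrite inE /= in_itv /=; exact: cg.
Qed.

Lemma seg_int_periodic (g : R -> R) (T c : R) : 0 <= T -> 0 <= c ->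
  (forall x, {for x, continuous g}) -> (forall x, g (x + T) = g x) ->
  seg_int (fun x => g (x + c)) 0 T = seg_int g 0 T.
Proof.
move=> T0 c0 cg gT.
have sg a b : seg_cont g a b by move=> x _; exact: cg.
rewrite -seg_int_translate// add0r.
have h1 : seg_int g 0 (T + c) = seg_int g 0 c + seg_int g c (T + c).
  by apply: seg_int_split => //; rewrite lerDr.
have h2 : seg_int g 0 (T + c) = seg_int g 0 T + seg_int g T (T + c).
  by apply: seg_int_split => //; rewrite lerDl.
have h3 : seg_int g T (T + c) = seg_int g 0 c.
  rewrite -[X in seg_int g X _]add0r [T + c]addrC seg_int_translate//.
  by rewrite /seg_int; apply: eq_Rintegral => x _; rewrite gT.
lra.
Qed.

End RealLemmas.

(** * Integrals of powers of the modulus over circles *)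

Section SegMore.
Context {R : realType}.

Lemma seg_intE (g : R -> R) a b : seg_cont g a b ->
  (\int[lebesgue_measure]_(x in `[a, b]) (g x)%:E)%E = (seg_int g a b)%:E.
Proof.
move=> cg; rewrite /seg_int /Rintegral fineK//.
by apply: integrable_fin_num => //; exact: seg_cont_integrable.
Qed.

Lemma seg_intZ (g : R -> R) a b c : seg_cont g a b ->
  seg_int (fun x => c * g x) a b = c * seg_int g a b.
Proof. by move=> cg; rewrite /seg_int RintegralZl//; exact: seg_cont_integrable. Qed.

Lemma seg_intD (g1 g2 : R -> R) a b : seg_cont g1 a b -> seg_cont g2 a b ->
  seg_int (fun x => g1 x + g2 x) a b = seg_int g1 a b + seg_int g2 a b.
Proof.
by move=> h1 h2; rewrite /seg_int RintegralD//; exact: seg_cont_integrable.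
Qed.

Lemma seg_contD (g1 g2 : R -> R) a b : seg_cont g1 a b -> seg_cont g2 a b ->
  seg_cont (fun x => g1 x + g2 x) a b.
Proof. by move=> h1 h2 x xab; apply: cvgD; [exact: h1|exact: h2]. Qed.

Lemma seg_contZ (g : R -> R) a b c : seg_cont g a b ->
  seg_cont (fun x => c * g x) a b.
Proof. by move=> h x xab; apply: cvgM; [exact: cvg_cst|exact: h]. Qed.

(** The graph of y^p lies above its tangent at 1; this is Young's inequality for [y] and 1 with
    exponents p and p / (p - 1). *)
Lemma bernoulli_powR (p y : R) : 1 <= p -> 0 <= y -> 1 + p * (y - 1) <= y `^ p.
Proof.
move=> p1 y0; have p0 : 0 < p by lra.
have [pE|pN] := eqVneq p 1; first by rewrite pE powRr1//; lra.
have pp : 1 < p by rewrite lt_neqAle eq_sym pN.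
have q0 : 0 < (1 - p^-1)^-1 by rewrite invr_gt0 subr_gt0 invf_lt1.
have := @conjugate_powR _ y 1 p _ y0 ler01 p0 q0.
rewrite invrK addrC subrK => /(_ erefl).
rewrite mulr1 powR1 mul1r => h.
have : p * y <= p * (y `^ p / p + (1 - p^-1)) by rewrite ler_pM2l.
rewrite mulrDr mulrBr mulr1 mulfV ?gt_eqF// mulrCA mulfV ?gt_eqF//; lra.
Qed.

End SegMore.

Section CircleIntegral.
Context {R : realType}.
Implicit Types (f : R[i] -> R[i]) (z a b : R[i]) (p r x : R).

Lemma cmod_cvg (T : Type) (F : set_system T) {FF : Filter F} (g : T -> R[i]) z :
  Re (g x) @[x --> F] --> Re z -> Im (g x) @[x --> F] --> Im z ->
  cmod (g x) @[x --> F] --> cmod z.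
Proof.
move=> gr gi; apply/cvgrPdist_lt => e e0.
have /ccvgP/(_ e e0) := conj gr gi; apply: filterS => x; apply: le_lt_trans.
have E1 : g x - (g x - z) = z by ring.
have E2 : (g x - z) + z = g x by ring.
have := cmodB (g x) (g x - z); have := cmodD (g x - z) z.
by rewrite E1 E2 ler_norml; lra.
Qed.

Lemma cvg_analytic_powR f p (T : Type) (F : set_system T) {FF : Filter F}
    (g : T -> R[i]) z :
  analytic_disc f -> 0 < p -> cmod z < 1 ->
  Re (g x) @[x --> F] --> Re z -> Im (g x) @[x --> F] --> Im z ->
  cmod (f (g x)) `^ p @[x --> F] --> cmod (f z) `^ p.
Proof.
move=> fa p0 z1 gr gi.
have [fr fi] := analytic_cvg _ _ _ _ _ fa z1 gr gi.
by apply: cvg_powR => //; [move=> x; exact: cmod_ge0|exact: cmod_cvg].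
Qed.

Lemma cvg_polar (T : Type) (F : set_system T) {FF : Filter F} (b : T -> R[i])
    (t : T -> R) z t0 :
  Re (b x) @[x --> F] --> Re z -> Im (b x) @[x --> F] --> Im z ->
  t x @[x --> F] --> t0 ->
  Re (b x * expi (t x)) @[x --> F] --> Re (z * expi t0) /\
  Im (b x * expi (t x)) @[x --> F] --> Im (z * expi t0).
Proof.
move=> br bi tt.
have ct : cos (t x) @[x --> F] --> cos t0 by apply: (cvg_comp _ _ tt); exact: continuous_cos.
have st : sin (t x) @[x --> F] --> sin t0 by apply: (cvg_comp _ _ tt); exact: continuous_sin.
rewrite ReM ImM Re_expi Im_expi; split.
  under eq_fun do rewrite ReM Re_expi Im_expi.
  by apply: cvgB; apply: cvgM.
under eq_fun do rewrite ImM Re_expi Im_expi.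
by apply: cvgD; apply: cvgM.
Qed.

Lemma cmod_mul_expi z (t : R) : cmod (z * expi t) = cmod z.
Proof. by rewrite cmodM cmod_expi mulr1. Qed.

(** Unnormalised p-th power of the circle mean. Only the modulus of [z] matters, but a complex
    argument makes this a function on the disc, whose own means over off-centre circles can be
    taken. *)
Definition circ p f z : R := seg_int (fun t => cmod (f (z * expi t)) `^ p) 0 (2 * pi).

Lemma twopi_gt0 : 0 < 2 * pi :> R. Proof. by rewrite mulr_gt0// pi_gt0. Qed.

Lemma circ_integrand_cont f p z : analytic_disc f -> 0 < p -> cmod z < 1 ->
  forall t : R, {for t, continuous (fun t => cmod (f (z * expi t)) `^ p)}.
Proof.
move=> fa p0 z1 t.
have [h1 h2] := @cvg_polar _ (nbhs t) _ (fun=> z) id z t (cvg_cst _) (cvg_cst _) cvg_id.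
by apply: cvg_analytic_powR => //; rewrite cmod_mul_expi.
Qed.

Lemma circ_ge0 f p z : 0 <= circ p f z.
Proof. by apply: Rintegral_ge0 => t _; exact: powR_ge0. Qed.

Lemma polar_form z : exists2 s : R, 0 <= s <= 2 * pi & z = (cmod z)%:C * expi s.
Proof.
have [->|z0] := eqVneq z 0.
  by exists 0; rewrite ?cmod0 ?mul0r// lexx mulr_ge0// pi_ge0.
have m0 : 0 < cmod z by rewrite lt_def cmod_ge0 cmod_eq0 z0.
set x := Re z / cmod z.
have x1 : -1 <= x <= 1.
  have := normRe_cmod z; rewrite ler_norml => /andP[h1 h2].
  by rewrite /x ler_pdivlMr// ler_pdivrMr// mulN1r mul1r h1.
have sE : sin (acos x) = `|Im z| / cmod z.
  rewrite sin_acos//; have -> : 1 - x ^+ 2 = (Im z / cmod z) ^+ 2.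
    rewrite /x !expr_div_n; apply: (mulIf (lt0r_neq0 (exprn_gt0 2 m0))).
    rewrite mulrBl !mulfVK ?expf_neq0 ?gt_eqF// mul1r cmod_sqr; lra.
  by rewrite sqrtr_sqr normrM normfV (gtr0_norm m0).
have cE : cos (acos x) = x by rewrite acosK// in_itv.
have E s : cos s = x -> sin s = Im z / cmod z -> z = (cmod z)%:C * expi s.
  move=> cs ss; apply/eqP; rewrite eq_complex [Re (_%:C * _)]ReM
    [Im (_%:C * _)]ImM Re_expi Im_expi /= cs ss.
  have A y : cmod z * (y / cmod z) = y by rewrite mulrC divfK// gt_eqF.
  by rewrite !mul0r subr0 addr0 !A !eqxx.
have [i0|i0] := leP 0 (Im z).
  exists (acos x).
    by rewrite acos_ge0//= (le_trans (acos_lepi x1))// ler_peMl ?pi_ge0// ler1n.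
  by apply: E => //; rewrite sE ger0_norm.
exists (- acos x + pi *+ 2).
  by have := acos_lepi x1; have := acos_ge0 x1; have := @pi_gt0 R; lra.
apply: E; first by rewrite cosD2pi cosN.
by rewrite sinD2pi sinN sE ltr0_norm// mulNr opprK.
Qed.

Lemma circ_radial f p z : analytic_disc f -> 0 < p -> cmod z < 1 ->
  circ p f z = circ p f (cmod z)%:C.
Proof.
move=> fa p0 z1; have [s /andP[s0 _] zE] := polar_form z.
have m1 : cmod (cmod z)%:C < 1 by rewrite cmodC ger0_norm// cmod_ge0.
have := seg_int_periodic (fun t => cmod (f ((cmod z)%:C * expi t)) `^ p) _ _
  (ltW twopi_gt0) s0 (circ_integrand_cont _ _ _ fa p0 m1).
rewrite /circ => <-; last by move=> t; rewrite expi_periodic.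
have E t : z * expi t = (cmod z)%:C * expi (t + s).
  by rewrite {1}zE -mulrA -expiD addrC.
have -> : (fun t => cmod (f (z * expi t)) `^ p) =
    (fun t => cmod (f ((cmod z)%:C * expi (t + s))) `^ p).
  by apply/funext => t; rewrite E.
by [].
Qed.

(** The closed disc is the image of a rectangle under polar coordinates, so compactness of real
    segments is enough. The exponent 1 gives access to [cvg_analytic_powR]. *)
Lemma analytic_bounded f r : analytic_disc f -> 0 <= r < 1 ->
  exists2 M : R, 0 < M & forall z, cmod z <= r -> cmod (f z) <= M.
Proof.
move=> fa /andP[r0 r1].
have p0 : 0 < 1 :> R by [].
have rx x : 0 <= x <= 1 -> cmod (r * x)%:C < 1.
  move=> /andP[x0 x1]; rewrite cmodC ger0_norm ?mulr_ge0// (le_lt_trans _ r1)//.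
  by rewrite ler_piMr.
have pi20 := @twopi_gt0.
have [|||[x t] _ Hm] := @compact_EVT_max (R * R)%type R
  (fun w => cmod (f ((r * w.1)%:C * expi w.2)) `^ 1) (`[0, 1] `*` `[0, 2 * pi]).
- by exists (0, 0); split; rewrite /= in_itv /= lexx ?ler01// ltW.
- by apply: compact_setX; exact: segment_compact.
- apply: continuous_in_subspaceT => -[x t]; rewrite inE => -[/= + _].
  rewrite in_itv /= => x01.
  have [|||h1 h2] := @cvg_polar _ (nbhs (x, t)) _ (fun w => (r * w.1)%:C) (fun w => w.2)
    (r * x)%:C t.
  + apply: cvgM; [exact: cvg_cst|exact: cvg_fst].
  + exact: cvg_cst.
  + exact: cvg_snd.
  by apply: cvg_analytic_powR => //; rewrite cmod_mul_expi; exact: rx.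
exists (cmod (f ((r * x)%:C * expi t)) `^ 1 + 1); first by rewrite ltr_wpDl// powR_ge0.
move=> z zr; have [s s0 zE] := polar_form z.
have rz : r * (cmod z / r) = cmod z.
  have [r00|rn0] := eqVneq r 0; last by rewrite mulrC divfK.
  by rewrite r00 mul0r; apply/eqP; rewrite eq_le cmod_ge0 -r00 zr.
have := Hm (cmod z / r, s); rewrite inE /= rz -zE !powRr1 ?cmod_ge0// => H.
rewrite (le_trans (H _))// ?lerDl// !in_itv /= s0; split => //.
rewrite divr_ge0 ?cmod_ge0//=; have [->|rn0] := eqVneq r 0.
  by rewrite invr0 mulr0.
by rewrite ler_pdivrMr ?mul1r// lt_def rn0.
Qed.

Lemma circ_continuous f p x : analytic_disc f -> 0 < p -> `|x| < 1 ->
  {for x, continuous (fun y : R => circ p f y%:C)}.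
Proof.
move=> fa p0 x1.
pose r := (`|x| + 1) / 2.
have r01 : 0 <= r < 1.
  by apply/andP; split; [rewrite divr_ge0// addr_ge0|rewrite ltr_pdivrMr//; lra].
have xr : `|x| < r by rewrite ltr_pdivlMr//; lra.
have [M M0 HM] := analytic_bounded _ _ fa r01.
have rl l : l \in `]-r, r[ -> cmod l%:C <= r.
  by rewrite in_itv /= cmodC ler_norml => /andP[h1 h2]; rewrite !ltW.
have rl1 l : l \in `]-r, r[ -> cmod l%:C < 1.
  by move=> /rl h; rewrite (le_lt_trans h)//; case/andP: r01.
have contI l : `]-r, r[%classic l ->
    seg_cont (fun t => cmod (f (l%:C * expi t)) `^ p) 0 (2 * pi).
  by move=> lr t _; apply: circ_integrand_cont => //; exact: rl1.
have := @continuity_under_integral R _ (measurableTypeR R) lebesgue_measure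
  (fun l t => cmod (f (l%:C * expi t)) `^ p) `[0, 2 * pi] (measurable_itv _) (- r) r
  _ _ (fun=> M `^ p) _ _ x.
apply.
- by move=> l lr; apply: seg_cont_integrable; exact: contI.
- apply: aeW => t _ l; rewrite inE => lr.
  have [|h1 h2] := @cvg_polar _ (nbhs l) _ (fun l => l%:C) (fun=> t) l%:C t cvg_id (cvg_cst _).
    exact: cvg_cst.
  by apply: cvg_analytic_powR => //; rewrite cmod_mul_expi; exact: rl1.
- exact: (@seg_cont_integrable _ (fun=> M `^ p) _ _ (seg_cont_cst _ _ _)).
- move=> l lr; apply: aeW => t _.
  rewrite ger0_norm ?powR_ge0// ge0_ler_powR ?nnegrE ?cmod_ge0//; try exact: ltW.
  by apply: HM; rewrite cmod_mul_expi; exact: rl.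
- by rewrite inE /= in_itv /= -ltr_norml.
Qed.

Lemma analytic_scale f (c : R[i]) : analytic_disc f -> analytic_disc (fun z => c * f z).
Proof.
move=> fa z z1.
have := @derivableZ R[i] R[i]^o R[i]^o f c z 1 (fa z z1).
by [].
Qed.

(** Subharmonicity of |f|^p by a supporting line: with A = |f(b)| and [c] the unimodular constant
    for which c f(b) = A, Bernoulli's inequality gives |w|^p >= A^p (1 - p) + k Re(c w), where [k] =
    p A^(p - 1) is the slope of y^p at A. The right side with w = f has mean A^p by the mean value
    property of c f. *)
Lemma submean_powR f p b (d : R) : analytic_disc f -> 1 <= p -> 0 <= d ->
  cmod b + d < 1 ->
  2 * pi * cmod (f b) `^ p <=
  seg_int (fun t => cmod (f (b + d%:C * expi t)) `^ p) 0 (2 * pi).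
Proof.
move=> fa p1 d0 bd; have p0 : 0 < p by rewrite (lt_le_trans ltr01).
have [A0|A0] := eqVneq (cmod (f b)) 0.
  rewrite A0 powR0 ?gt_eqF// mulr0.
  by apply: Rintegral_ge0 => t _; exact: powR_ge0.
have {}A0 : 0 < cmod (f b) by rewrite lt_def A0 cmod_ge0.
set A := cmod (f b) in A0 *.
pose c : R[i] := ((f b)^*)%C / A%:C.
have fc : c * f b = A%:C.
  have -> : c * f b = f b * ((f b)^*)%C / A%:C by rewrite /c; ring.
  rewrite -sqr_normc cmod_normc -/A expr2 mulfK//.
  by rewrite eq_complex /= eqxx andbT gt_eqF.
have c1 : cmod c = 1.
  apply: (mulIf (lt0r_neq0 A0)); rewrite -cmodM fc mul1r cmodC gtr0_norm//.
have cb t : cmod (b + d%:C * expi t) < 1.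
  rewrite (le_lt_trans (cmodD _ _))// cmod_mul_expi cmodC ger0_norm//.
have bt t : Re (b + d%:C * expi s) @[s --> t] --> Re (b + d%:C * expi t) /\
    Im (b + d%:C * expi s) @[s --> t] --> Im (b + d%:C * expi t).
  have [h1 h2] := @cvg_polar _ (nbhs t) _ (fun=> d%:C) id d%:C t (cvg_cst _) (cvg_cst _) cvg_id.
  rewrite ReD ImD; split.
    by under eq_fun do rewrite ReD; apply: cvgD => //; exact: cvg_cst.
  by under eq_fun do rewrite ImD; apply: cvgD => //; exact: cvg_cst.
have cfa := analytic_scale _ c fa.
have Rc : seg_cont (fun t => Re (c * f (b + d%:C * expi t))) 0 (2 * pi).
  move=> t _; have [h1 h2] := bt t.
  by have [] := analytic_cvg _ _ _ _ _ cfa (cb t) h1 h2.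
have := mean_value _ cfa b d d0 bd; rewrite fc /= => MV.
pose k := A `^ p * p / A.
have -> : 2 * pi * A `^ p =
   seg_int (fun t => A `^ p * (1 - p) + k * Re (c * f (b + d%:C * expi t))) 0 (2 * pi).
  rewrite seg_intD; [|exact: seg_cont_cst|exact: seg_contZ].
  rewrite seg_int_cst ?ltW ?twopi_gt0// (seg_intZ _ _ _ k Rc) MV /k; field; exact: lt0r_neq0.
apply: le_seg_int.
- by apply: seg_contD; [exact: seg_cont_cst|exact: seg_contZ].
- by move=> t _; have [h1 h2] := bt t; exact: cvg_analytic_powR.
move=> t _; set w := f _.
have y0 : 0 <= cmod w / A by rewrite divr_ge0 ?cmod_ge0// ltW.
have := bernoulli_powR p _ p1 y0.
rewrite powRM ?cmod_ge0 ?invr_ge0 ?(ltW A0)// => Be.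
have Rw : Re (c * w) <= cmod w by rewrite (le_trans (Re_le_cmod _))// cmodM c1 mul1r.
have Ap : 0 < A `^ p by rewrite powR_gt0.
have Ai : A^-1 `^ p = (A `^ p)^-1.
  by rewrite -powR_inv1 ?ltW// -powRrM mulN1r powRN.
have -> : cmod w `^ p = A `^ p * (cmod w `^ p * A^-1 `^ p).
  by rewrite Ai; field; exact: lt0r_neq0.
apply: (@le_trans _ _ (A `^ p * (1 + p * (cmod w / A - 1)))); last first.
  by rewrite ler_pM2l.
have -> : A `^ p * (1 + p * (cmod w / A - 1)) = A `^ p * (1 - p) + k * cmod w.
  by rewrite /k; field; exact: lt0r_neq0.
by rewrite lerD2l ler_pM2l// /k !divr_gt0// mulr_gt0.
Qed.

End CircleIntegral.

(** * Monotonicity of the circle means *)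

Section CircleMonotone.
Context {R : realType}.
Implicit Types (f : R[i] -> R[i]) (c d p r x : R).

Lemma cvg_translate_expi (a : R[i]) d (T : Type) (F : set_system T) {FF : Filter F}
    (s : T -> R) (t : R) : s x @[x --> F] --> t ->
  Re (a + d%:C * expi (s x)) @[x --> F] --> Re (a + d%:C * expi t) /\
  Im (a + d%:C * expi (s x)) @[x --> F] --> Im (a + d%:C * expi t).
Proof.
move=> st.
have [h1 h2] := @cvg_polar R T F _ (fun=> d%:C) s d%:C t (cvg_cst _) (cvg_cst _) st.
rewrite ReD ImD; split.
  by under eq_fun do rewrite ReD; apply: cvgD => //; exact: cvg_cst.
by under eq_fun do rewrite ImD; apply: cvgD => //; exact: cvg_cst.
Qed.

Lemma cmod_translate_expi c d t : 0 <= c -> 0 <= d ->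
  cmod (c%:C + d%:C * expi t) <= c + d.
Proof.
move=> c0 d0; rewrite (le_trans (cmodD _ _))// cmod_mul_expi !cmodC !ger0_norm//.
Qed.

Lemma circ_shifted_continuous f p c d : analytic_disc f -> 0 < p ->
  0 <= c -> 0 <= d -> c + d < 1 ->
  forall t : R, {for t, continuous (fun t => circ p f (c%:C + d%:C * expi t))}.
Proof.
move=> fa p0 c0 d0 cd t.
have cd1 s : cmod (c%:C + d%:C * expi s) < 1.
  exact: le_lt_trans (cmod_translate_expi _ _ _ c0 d0) cd.
have -> : (fun t => circ p f (c%:C + d%:C * expi t)) =
    (fun t => circ p f (cmod (c%:C + d%:C * expi t))%:C).
  by apply/funext => s; rewrite -circ_radial.
have [h1 h2] := @cvg_translate_expi c%:C d R (nbhs t) _ id t cvg_id.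
have cc := cmod_cvg _ _ _ _ h1 h2.
apply: (@continuous_comp _ _ _ (fun s => cmod (c%:C + d%:C * expi s))
  (fun y : R => circ p f y%:C)); first exact: cc.
apply: circ_continuous => //; by rewrite ger0_norm// cmod_ge0.
Qed.

(** After Tonelli, for a fixed rotation e^(it), the shift of [s] by [t] turns (c + d e^(is)) e^(it)
    into the circle of centre c e^(it) and radius d, to which [submean_powR] applies; then one
    integrates in [t]. *)
Lemma circ_submean f p c d : analytic_disc f -> 1 <= p ->
  0 <= c -> 0 <= d -> c + d < 1 ->
  2 * pi * circ p f c%:C <=
  seg_int (fun s => circ p f (c%:C + d%:C * expi s)) 0 (2 * pi).
Proof.
move=> fa p1 c0 d0 cd; have p0 : 0 < p by rewrite (lt_le_trans ltr01).
have cd1 s : cmod (c%:C + d%:C * expi s) < 1.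
  exact: le_lt_trans (cmod_translate_expi _ _ _ c0 d0) cd.
have c1 : cmod c%:C < 1.
  by rewrite cmodC ger0_norm// (le_lt_trans _ cd)// lerDl.
pose G (z : R * R) := cmod (f ((c%:C + d%:C * expi z.1) * expi z.2)) `^ p.
have cG z : {for z, continuous G}.
  case: z => s t.
  have [h1 h2] := @cvg_translate_expi c%:C d _ (nbhs (s, t)) _ fst s cvg_fst.
  have [h3 h4] := @cvg_polar R _ (nbhs (s, t)) _ _ snd _ t h1 h2 cvg_snd.
  by apply: cvg_analytic_powR => //; rewrite cmod_mul_expi.
have mG : measurable_fun [set: measurableTypeR R * measurableTypeR R] (EFin \o G).
  by apply/measurable_EFinP; exact: continuous2_measurable.
have G0 z : (0 <= (EFin \o G) z)%E by rewrite lee_fin powR_ge0.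
have mG' : measurable_fun [set: measurableTypeR R * measurableTypeR R]
    (fun z => (EFin \o G) (z.2, z.1)).
  apply: (measurableT_comp mG (measurable_fun_pair measurable_snd measurable_fst)).
rewrite -lee_fin -seg_intE; last by move=> s _; exact: circ_shifted_continuous.
pose D : set (measurableTypeR R) := `[0, 2 * pi]%classic.
have mD : measurable D by exact: measurable_itv.
rewrite -/D.
have -> : (\int[lebesgue_measure]_(s in D)
      (circ p f (c%:C + d%:C * expi s))%:E =
    \int[lebesgue_measure]_(s in D)
      \int[lebesgue_measure]_(t in D) (EFin \o G) (s, t))%E.
  apply: eq_integral => s _; rewrite /circ -seg_intE//.
  by move=> t _; exact: circ_integrand_cont.
rewrite (tonelli_on lebesgue_measure lebesgue_measure D D
  (EFin \o G))//.
have cf := circ_integrand_cont f p _ fa p0 c1.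
rewrite -seg_intZ; last by move=> t _; exact: cf.
rewrite -seg_intE; last by apply: seg_contZ => t _; exact: cf.
apply: ge0_le_integral => //.
- by move=> t _; rewrite lee_fin mulr_ge0 ?powR_ge0// ltW// twopi_gt0.
- apply/measurable_EFinP; apply: measurable_funTS.
  apply: measurable_funM => //.
  by apply: continuous_measurable_fun => t; exact: cf.
- apply: measurable_funTS.
  exact: (measurable_int_on lebesgue_measure D _ mD
    (fun z => G0 _) mG').
move=> t; rewrite /= in_itv /= => /andP[t0 _].
have ct1 s : cmod (c%:C * expi t + d%:C * expi s) < 1.
  by rewrite (le_lt_trans (cmodD _ _))// !cmod_mul_expi !cmodC !ger0_norm.
pose g s := cmod (f (c%:C * expi t + d%:C * expi s)) `^ p.
have cg s : {for s, continuous g}.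
  have [h1 h2] := @cvg_translate_expi (c%:C * expi t) d _ (nbhs s) _ id s cvg_id.
  by apply: cvg_analytic_powR => //; exact: ct1.
have Gg s : G (s, t) = g (s + t).
  by rewrite /G /g /= expiD mulrDl !mulrA.
have -> : (\int[lebesgue_measure]_(s in D) (G (s, t))%:E)%E =
    (seg_int g 0 (2 * pi))%:E.
  rewrite -(seg_int_periodic g (2 * pi) t)//; last first.
  - by move=> s; rewrite /g expi_periodic.
  - exact/ltW/twopi_gt0.
  rewrite -seg_intE.
    by apply: eq_integral => s _; rewrite Gg.
  move=> s _; apply: (@continuous_comp _ _ _ (fun s => s + t)) => //.
  by apply: cvgD; [exact: cvg_id|exact: cvg_cst].
rewrite lee_fin; apply: submean_powR => //.
by rewrite cmod_mul_expi cmodC ger0_norm.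
Qed.

(** The mean value property of the identity function at 0. *)
Lemma seg_int_cos : seg_int (@cos R) 0 (2 * pi) = 0.
Proof.
have ida : @analytic_disc R id by move=> z _; exact: derivable_id.
have h1 : cmod (0 : R[i]) + 2^-1 < 1 :> R by rewrite cmod0 add0r invf_lt1 ?ltr1n.
have h0 : 0 <= 2^-1 :> R by [].
have := mean_value id ida 0 2^-1 h0 h1.
have -> : (fun t : R => Re (0 + (2^-1 : R)%:C * expi t)) = (fun t => 2^-1 * cos t).
  by apply/funext => t; rewrite add0r ReM /= Re_expi mul0r subr0.
rewrite seg_intZ; last by move=> t _; exact: continuous_cos.
by rewrite mulr0 => /eqP; rewrite mulf_eq0 invr_eq0 pnatr_eq0 => /eqP.
Qed.

Lemma cmod_sqr_shift c d t :
  cmod (c%:C + d%:C * expi t) ^+ 2 = c ^+ 2 + d ^+ 2 + 2 * c * d * cos t.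
Proof.
rewrite cmod_sqr ReD ImD ReM ImM Re_expi Im_expi /= add0r !mul0r subr0 addr0.
have := cos2Dsin2 t => h.
have -> : c ^+ 2 + d ^+ 2 + 2 * c * d * cos t =
    c ^+ 2 + d ^+ 2 * (cos t ^+ 2 + sin t ^+ 2) + 2 * c * d * cos t.
  by rewrite h mulr1.
by ring.
Qed.

(* A maximum of the perturbed circle integral at an interior radius [c] would
   contradict the sub-mean value property, the squared modulus having mean
   [c ^+ 2 + d ^+ 2] over the circle of centre [c] and radius [d]. *)
Lemma circ_monotone f p r x : analytic_disc f -> 1 <= p -> 0 <= r <= x -> x < 1 ->
  circ p f r%:C <= circ p f x%:C.
Proof.
move=> fa p1 /andP[r0 rx] x1; have p0 : 0 < p by rewrite (lt_le_trans ltr01).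
have x0 : 0 <= x by rewrite (le_trans r0).
apply/ler_addgt0Pr => e e0.
pose v y := circ p f y%:C + e * y ^+ 2.
have cv : {within `[0, x], continuous v}.
  apply: continuous_in_subspaceT => y; rewrite inE /= in_itv /= => /andP[y0 yx].
  apply: cvgD.
    by apply: circ_continuous => //; rewrite ger0_norm// (le_lt_trans yx).
  apply: cvgM; first exact: cvg_cst.
  by apply: cvgM; exact: cvg_id.
have [c cx Hc] := EVT_max x0 cv.
move: cx; rewrite in_itv /= => /andP[c0 cx].
suff cE : c = x.
  have := Hc r; rewrite in_itv /= r0 rx => /(_ isT); rewrite cE /v => h.
  rewrite -lerBlDr (le_trans _ (_ : circ p f r%:C + e * r ^+ 2 - e <= _))//.
    by rewrite lerD2r lerDl mulr_ge0 ?sqr_ge0// ltW.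
  rewrite lerBlDr (le_trans h)// lerD2l ger_pMr//.
  by rewrite expr_le1// ltW.
apply/eqP; rewrite eq_le cx leNgt; apply/negP => cltx.
pose d := x - c.
have d0 : 0 < d by rewrite subr_gt0.
have cd : c + d < 1 by rewrite /d addrC subrK.
have cd1 s : cmod (c%:C + d%:C * expi s) <= x.
  by rewrite (le_trans (cmod_translate_expi _ _ _ c0 (ltW d0)))// /d addrC subrK.
have ub s : circ p f (c%:C + d%:C * expi s) +
    (e * (c ^+ 2 + d ^+ 2) + e * (2 * c * d) * cos s) <= v c.
  have := Hc (cmod (c%:C + d%:C * expi s)); rewrite in_itv /= cmod_ge0 cd1 => /(_ isT).
  by rewrite /v -circ_radial ?(le_lt_trans (cd1 s))// cmod_sqr_shift mulrDr mulrA.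
have ccos : seg_cont (fun s : R => e * (2 * c * d) * cos s) 0 (2 * pi).
  by apply: seg_contZ => s _; exact: continuous_cos.
have ccirc : seg_cont (fun s => circ p f (c%:C + d%:C * expi s)) 0 (2 * pi).
  by move=> s _; apply: circ_shifted_continuous => //; exact: ltW.
have cc2 : seg_cont (fun s : R => e * (c ^+ 2 + d ^+ 2) + e * (2 * c * d) * cos s) 0 (2 * pi).
  by apply: seg_contD => //; exact: seg_cont_cst.
have : seg_int (fun s => circ p f (c%:C + d%:C * expi s) +
    (e * (c ^+ 2 + d ^+ 2) + e * (2 * c * d) * cos s)) 0 (2 * pi) <=
    seg_int (fun=> v c) 0 (2 * pi).
  by apply: le_seg_int => //; [exact: seg_contD|exact: seg_cont_cst].
have pi2 := @twopi_gt0 R.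
have Icos : seg_int (fun s : R => e * (c ^+ 2 + d ^+ 2) + e * (2 * c * d) * cos s) 0 (2 * pi)
    = e * (c ^+ 2 + d ^+ 2) * (2 * pi).
  rewrite (seg_intD (fun=> e * (c ^+ 2 + d ^+ 2)) (fun s => e * (2 * c * d) * cos s))//;
    last exact: seg_cont_cst.
  rewrite (seg_intZ (@cos R)); last by move=> s _; exact: continuous_cos.
  by rewrite seg_int_cos mulr0 addr0 seg_int_cst ?ltW// subr0.
rewrite seg_intD// Icos seg_int_cst; last exact: ltW.
rewrite subr0.
have := circ_submean f p c d fa p1 c0 (ltW d0) cd => h1 h2.
have := le_trans (lerD h1 (lexx _)) h2.
rewrite [2 * pi * _]mulrC -mulrDl ler_pM2r// /v lerD2l ler_pM2l// gerDl leNgt.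
by rewrite exprn_gt0.
Qed.

End CircleMonotone.

(** * Integral estimates by dyadic decomposition *)

Section IntegralBounds.
Context {R : realType}.

(* No measurability is required because the integral of a nonnegative function
   is a supremum over the simple functions below it. *)
Lemma ge0_le_integral_all d (T : measurableType d)
    (m : {measure set T -> \bar R}) (D : set T) (f g : T -> \bar R) :
  (forall x, D x -> (0 <= f x)%E) -> (forall x, D x -> (f x <= g x)%E) ->
  (\int[m]_(x in D) f x <= \int[m]_(x in D) g x)%E.
Proof.
move=> f0 fg.
have g0 x : D x -> (0 <= g x)%E by move=> Dx; exact: le_trans (f0 x Dx) (fg x Dx).
rewrite integral_mkcond [leRHS]integral_mkcond.
rewrite !ge0_integralTE; [|by move=> x; exact: erestrict_ge0..].
apply: ereal_sup_le => _ [h hf <-]; exists h => // x.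
by rewrite (le_trans (hf x))//; exact: lee_restrict.
Qed.

Lemma geometric_sum_le (q : R) n : 0 <= q < 1 ->
  \sum_(0 <= j < n) q ^+ j <= (1 - q)^-1.
Proof.
move=> /andP[q0 q1].
have := @geometric_seriesE R 1 q; rewrite lt_eqF// => /(_ isT)/(congr1 (@^~ n)).
rewrite /series /geometric /=; under eq_bigr do rewrite mul1r.
move=> ->; rewrite mul1r ler_piMl//; last by rewrite gerBl exprn_ge0.
by rewrite invr_ge0 subr_ge0 ltW.
Qed.

(** Common mechanism of the kernel estimates: [g] is dominated by the sum of the [c j] on [A j],
    sets that cover but may overlap, and the contributions decay geometrically. *)
Lemma dyadic_bound (m : {measure set (measurableTypeR R) -> \bar R})
    (D : set (measurableTypeR R)) (A : nat -> set (measurableTypeR R))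
    (c : nat -> R) (g w : measurableTypeR R -> R) (K q : R) :
  measurable D -> (forall j, measurable (A j)) -> (forall j, 0 <= c j) ->
  (forall t, D t -> 0 <= w t) -> (forall t, D t -> 0 <= g t) ->
  measurable_fun D w -> 0 <= K -> 0 <= q < 1 ->
  (forall j, (c j)%:E * \int[m]_(t in D `&` A j) (w t)%:E <= (K * q ^+ j)%:E)%E ->
  (forall t, D t -> exists2 j, A j t & g t <= c j) ->
  (\int[m]_(t in D) (w t * g t)%:E <= (K / (1 - q))%:E)%E.
Proof.
move=> mD mA c0 w0 g0 mw K0 q01 cA cover.
pose h j t := (w t * (c j * \1_(A j) t))%:E.
have mh j : measurable_fun D (h j).
  apply/measurable_EFinP; apply: measurable_funM => //.
  by apply: measurable_funM => //; apply: measurable_funTS; exact: measurable_indic.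
have h0 j t : D t -> (0 <= h j t)%E.
  by move=> Dt; rewrite lee_fin !mulr_ge0 ?w0.
apply: (@le_trans _ _ (\int[m]_(t in D) \sum_(j <oo) h j t)%E).
  apply: ge0_le_integral_all => t Dt.
    by rewrite lee_fin mulr_ge0 ?w0 ?g0.
  have [j Ajt gc] := cover t Dt.
  apply: (@le_trans _ _ (h j t)).
    by rewrite lee_fin ler_wpM2l ?w0// indicE mem_set// mulr1.
  have := @nneseries_lim_ge R (h ^~ t) xpredT 0%N j.+1 (fun n _ _ => h0 n t Dt).
  apply: le_trans; rewrite big_nat_recr//= leeDr// sume_ge0// => n _.
  exact: h0.
rewrite integral_nneseries//.
have hI j : (\int[m]_(t in D) h j t <= (K * q ^+ j)%:E)%E.
  apply: le_trans (cA j).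
  rewrite integral_mkcondr -ge0_integralZl_EFin//.
  - apply: ge0_le_integral_all => t Dt; first exact: h0.
    rewrite /h patchE indicE; case: ifPn => _ /=; last by rewrite !mulr0 mule0.
    by rewrite mulr1 -EFinM mulrC.
  - by move=> t Dt; rewrite patchE; case: ifPn => // _; rewrite lee_fin w0.
  - apply: (iffLR (measurable_restrict _ (mA j) mD)).
    apply: (measurable_funS mD); first exact: subIsetl.
    exact/measurable_EFinP.
have hIge0 j : (0 <= \int[m]_(t in D) h j t)%E.
  by apply: integral_ge0 => t Dt; exact: h0.
apply: lime_le; first exact: is_cvg_nneseries.
apply: nearW => n.
apply: (@le_trans _ _ (\sum_(0 <= j < n) (K * q ^+ j)%:E)%E).
  by apply: lee_sum => j _; exact: hI.
rewrite sumEFin lee_fin -mulr_sumr ler_wpM2l//.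
exact: geometric_sum_le.
Qed.

Lemma powR_double (u y k : R) : 0 < y -> y / 2 <= u <= y ->
  u `^ k <= (1 + 2 `^ (- k)) * y `^ k.
Proof.
move=> y0 /andP[yu uy].
have u0 : 0 < u by rewrite (lt_le_trans _ yu)// divr_gt0.
rewrite mulrDl mul1r; have [k0|k0] := leP 0 k.
  rewrite -[leLHS]addr0 lerD ?mulr_ge0 ?powR_ge0//.
  by rewrite ge0_ler_powR// nnegrE ltW.
rewrite -[leLHS]add0r lerD ?powR_ge0//.
have -> : 2 `^ (- k) * y `^ k = (y / 2) `^ k.
  rewrite powRM ?invr_ge0// ?ltW// mulrC; congr (_ * _).
  by rewrite -powR_inv1// -powRrM mulN1r.
have y20 : 0 < y / 2 by rewrite divr_gt0.
rewrite -[k]opprK [u `^ _]powRN [(y / 2) `^ _]powRN.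
rewrite lef_pV2 ?posrE ?powR_gt0// ge0_ler_powR// ?nnegrE ?oppr_ge0; exact: ltW.
Qed.

Lemma powR_half (u y k : R) : 0 < y -> y / 2 <= u <= y ->
  y `^ k <= (1 + 2 `^ k) * u `^ k.
Proof.
move=> y0 yu; have := powR_double u y (- k) y0 yu.
have u0 : 0 < u by case/andP: yu => + _; apply: lt_le_trans; rewrite divr_gt0.
rewrite opprK !powRN ler_pdivlMr ?powR_gt0// mulrC ler_pdivrMr ?powR_gt0//.
Qed.

Lemma geometric_scale (e : R) : 0 < e -> forall D, e <= D ->
  exists j, 2 ^+ j * e <= D <= 2 ^+ j.+1 * e.
Proof.
move=> e0 D eD.
have [n nP] : exists n, D <= 2 ^+ n.+1 * e.
  exists (Num.truncn (D / e)).
  rewrite -ler_pdivrMr//; apply: (le_trans (ltW (truncnS_gt _))).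
  rewrite -natrX ler_nat; exact/ltnW/ltn_expl.
elim: n => [|n IH] in nP *.
  by exists 0%N; rewrite nP expr0 mul1r eD.
have [/IH//|h] := leP D (2 ^+ n.+1 * e).
by exists n.+1; rewrite nP (ltW h).
Qed.

Lemma powR2_lt1 (k : R) : k < 0 -> 2 `^ k < 1 :> R.
Proof.
by move=> k0; rewrite /powR pnatr_eq0 /= expR_lt1 pmulr_llt0// ln_gt0// ltr1n.
Qed.

Lemma powR_exp2 (j : nat) (k : R) : (2 ^+ j) `^ k = (2 `^ k) ^+ j.
Proof.
by rewrite -powR_mulrn// -powRrM mulrC powRrM powR_mulrn// powR_ge0.
Qed.

(** The tail of length [x] at 1, which is all of [0, 1) once [x >= 1]; every dyadic scale is thus
    meaningful. *)
Definition near1 (x : R) : set (measurableTypeR R) := `[0, 1[ `&` [set t | 1 - t <= x].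

Lemma near1E (x : R) : [set t : measurableTypeR R | 1 - t <= x] = `[1 - x, +oo[%classic.
Proof. by apply/seteqP; split => t /=; rewrite in_itv /= andbT; lra. Qed.

Lemma measurable_near1 (x : R) : measurable (near1 x).
Proof. by apply: measurableI => //; rewrite near1E. Qed.

Lemma measurable_powR_onem (D : set (measurableTypeR R)) (k : R) :
  measurable_fun D (fun t : measurableTypeR R => (1 - t) `^ k).
Proof.
apply: measurable_funTS.
apply: (measurableT_comp (measurable_powR k)).
by apply: measurable_funB.
Qed.

(** The exact value for [x <= 1] is x^al / al. Cutting where [1 - t] is about [x / 2 ^+ j] also
    covers [al < 1], where the integrand is unbounded; the piece j contributes at most a multiple of
    x^al 2^(- al j). *)
Lemma int_powR_near1 (al : R) : 0 < al -> exists2 C : R, 0 < C &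
  forall x, 0 < x ->
  (\int[lebesgue_measure]_(t in near1 x) ((1 - t) `^ (al - 1))%:E <= (C * x `^ al)%:E)%E.
Proof.
move=> al0.
pose K := 1 + 2 `^ (- (al - 1)) : R.
have K0 : 0 < K by rewrite ltr_wpDr// powR_ge0.
pose q := (2 `^ al)^-1 : R.
have q0 : 0 <= q by rewrite invr_ge0 powR_ge0.
have q1 : q < 1.
  by rewrite /q -powRN powR2_lt1// oppr_lt0.
exists (K / (1 - q)) => [|x x0]; first by rewrite divr_gt0// subr_gt0.
pose A j : set (measurableTypeR R) := `[1 - x / 2 ^+ j, 1 - x / 2 ^+ j.+1]%classic.
pose c j := K * (x / 2 ^+ j) `^ (al - 1).
have xj j : 0 < x / 2 ^+ j by rewrite divr_gt0// exprn_gt0.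
have xjS j : x / 2 ^+ j.+1 = x / 2 ^+ j / 2.
  by rewrite exprSr invfM mulrA.
have := @dyadic_bound lebesgue_measure (near1 x) A c (fun t => (1 - t) `^ (al - 1))
  (fun=> 1) (K * x `^ al) q (measurable_near1 x).
have -> : K / (1 - q) * x `^ al = K * x `^ al / (1 - q) by rewrite mulrAC.
under eq_integral do rewrite mul1r; apply => //.
- by move=> j; exact: measurable_itv.
- by move=> j; rewrite mulr_ge0 ?powR_ge0// ltW.
- by move=> t _; exact: powR_ge0.
- by rewrite mulr_ge0 ?powR_ge0// ltW.
- by rewrite q0 q1.
- move=> j.
  have h : (\int[lebesgue_measure]_(t in near1 x `&` A j) 1%:E <= (x / 2 ^+ j)%:E)%E.
    rewrite integral_cst; last first.
      by apply: measurableI; [exact: measurable_near1|exact: measurable_itv].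
    rewrite mul1e; apply: (@le_trans _ _ (lebesgue_measure (A j))).
      apply: le_measure; rewrite ?inE; [|exact: measurable_itv|exact: subIsetr].
      by apply: measurableI; [exact: measurable_near1|exact: measurable_itv].
    rewrite /A lebesgue_measure_itv /= lte_fin.
    case: ifPn => _; last by rewrite lee_fin ltW.
    by rewrite -EFinD lee_fin xjS; have := xj j; lra.
  apply: (@le_trans _ _ ((c j)%:E * (x / 2 ^+ j)%:E)%E).
    by rewrite lee_pmul2l// ?lte_fin// mulr_gt0// powR_gt0.
  have E : (x / 2 ^+ j) `^ (al - 1) * (x / 2 ^+ j) = (x / 2 ^+ j) `^ al.
    by rewrite mulrC mulr_powRB1//; exact: ltW.
  rewrite -EFinM lee_fin /c -[leLHS]mulrA E.
  rewrite powRM ?(ltW x0) ?invr_ge0 ?exprn_ge0// -mulrA ler_pM2l// ler_pM2l ?powR_gt0//.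
  by rewrite -powR_inv1 ?exprn_ge0// -powRrM mulN1r powRN powR_exp2 exprVn.
move=> t [/=]; rewrite in_itv /= => /andP[t0 t1] tx.
have t1' : 0 < 1 - t by rewrite subr_gt0.
have [j /andP[j1 j2]] := geometric_scale (1 - t) t1' x tx.
have h1 : 1 - t <= x / 2 ^+ j by rewrite ler_pdivlMr ?exprn_gt0// mulrC.
have h2 : x / 2 ^+ j.+1 <= 1 - t by rewrite ler_pdivrMr ?exprn_gt0// mulrC.
exists j; first by rewrite /A /= in_itv /=; lra.
by apply: powR_double => //; rewrite h1 -xjS h2.
Qed.

(** Stated for [w dm] so as to cover both [mu] with [w] = 1 and Lebesgue measure with a power
    weight. Where max(1 - t, 1 - r) is about 2^j (1 - r), so at least is [1 - t * r], and the
    corresponding tail has mass of order (2^j (1 - r))^s; the ratio of consecutive scales is 2^(s -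
    a) < 1. *)
Lemma int_kernel_bound (m : {measure set (measurableTypeR R) -> \bar R})
    (w : measurableTypeR R -> R) (s a C : R) : 0 <= a -> s < a -> 0 <= C ->
  measurable_fun (`[0, 1[%classic : set (measurableTypeR R)) w -> (forall t, 0 <= w t) ->
  (forall x, 0 < x -> (\int[m]_(t in near1 x) (w t)%:E <= (C * x `^ s)%:E)%E) ->
  forall r, 0 <= r < 1 ->
  (\int[m]_(t in `[0%R, 1%R[%classic) (w t * (1 - t * r) `^ (- a))%:E <=
   (C * 2 `^ s / (1 - 2 `^ (s - a)) * (1 - r) `^ (s - a))%:E)%E.
Proof.
move=> a0 sa C0 mw w0 H r /andP[r0 r1].
pose e := 1 - r; have e0 : 0 < e by rewrite subr_gt0.
pose A j : set (measurableTypeR R) := [set t | 1 - t <= 2 ^+ j.+1 * e].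
pose c j := (2 ^+ j * e) `^ (- a).
pose q := 2 `^ (s - a) : R.
have q0 : 0 <= q by rewrite powR_ge0.
have q1 : q < 1.
  by rewrite powR2_lt1// subr_lt0.
have -> : C * 2 `^ s / (1 - 2 `^ (s - a)) * (1 - r) `^ (s - a) =
   C * 2 `^ s * e `^ (s - a) / (1 - q) by rewrite mulrAC.
apply: (@dyadic_bound m `[0, 1[%classic A c) => //.
- by move=> j; rewrite /A near1E.
- by move=> j; exact: powR_ge0.
- by move=> t _; exact: powR_ge0.
- by rewrite !mulr_ge0// powR_ge0.
- by rewrite q0 q1.
- move=> j; have je : 0 < 2 ^+ j * e by rewrite mulr_gt0// exprn_gt0.
  have jSe : 0 < 2 ^+ j.+1 * e by rewrite mulr_gt0// exprn_gt0.
  apply: (@le_trans _ _ ((c j)%:E * (C * (2 ^+ j.+1 * e) `^ s)%:E)%E).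
    rewrite lee_pmul2l// ?lte_fin ?powR_gt0//; exact: H.
  rewrite -EFinM lee_fin /c exprS -mulrA (powRM s _ (ltW je))//.
  have -> : (2 ^+ j * e) `^ (- a) * (C * (2 `^ s * (2 ^+ j * e) `^ s)) =
     C * 2 `^ s * ((2 ^+ j * e) `^ s * (2 ^+ j * e) `^ (- a)) by ring.
  rewrite -powRD; last by rewrite (gt_eqF je) implybT.
  by rewrite powRM ?(ltW e0) ?exprn_ge0// powR_exp2 -/q [q ^+ j * _]mulrC !mulrA.
move=> t /=; rewrite in_itv /= => /andP[t0 t1].
(* Both [1 - t] and [1 - r] are lower bounds of [1 - t * r]; their maximum fixes the dyadic
   scale. *)
have eD : e <= Num.max (1 - t) e by rewrite le_max lexx orbT.
have [j /andP[j1 j2]] := geometric_scale e e0 _ eD.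
exists j; first by rewrite /A /=; move: j2; rewrite ge_max => /andP[].
have tr1 : t * r <= t by rewrite ler_piMr// ltW.
have tr2 : t * r <= r by rewrite ler_piMl// ltW.
have Dtr : 2 ^+ j * e <= 1 - t * r.
  by rewrite (le_trans j1)// ge_max /e !lerD2l !lerN2 tr1 tr2.
have je : 0 < 2 ^+ j * e by rewrite mulr_gt0// exprn_gt0.
rewrite /c !powRN lef_pV2 ?posrE ?powR_gt0//; last exact: lt_le_trans Dtr.
by rewrite ge0_ler_powR// nnegrE ltW// (lt_le_trans je).
Qed.

(** The density (1 - t)^(al - 1) makes Lebesgue measure al-Carleson. *)
Lemma int_kernel_lebesgue (al b : R) : 0 < al -> al < b ->
  exists2 C : R, 0 < C & forall r, 0 <= r < 1 ->
  (\int[lebesgue_measure]_(t in `[0%R, 1%R[%classic)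
     ((1 - t) `^ (al - 1) * (1 - t * r) `^ (- b))%:E <=
   (C * (1 - r) `^ (al - b))%:E)%E.
Proof.
move=> al0 alb; have [C C0 HC] := int_powR_near1 al al0.
have q1 : 0 < 1 - 2 `^ (al - b) :> R.
  by rewrite subr_gt0 powR2_lt1// subr_lt0.
exists (C * 2 `^ al / (1 - 2 `^ (al - b))); first by rewrite divr_gt0// mulr_gt0// powR_gt0.
apply: (@int_kernel_bound lebesgue_measure (fun t => (1 - t) `^ (al - 1))) => //.
- by rewrite ltW// (lt_trans al0).
- exact: ltW.
- exact: measurable_powR_onem.
- by move=> t; exact: powR_ge0.
Qed.

Lemma int_kernel_carleson (mu : {finite_measure set (measurableTypeR R) -> \bar R})
    (s a : R) : 0 < s -> s < a -> carleson mu s ->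
  exists2 C : R, 0 < C & forall r, 0 <= r < 1 ->
  (\int[mu]_(t in `[0%R, 1%R[%classic) ((1 - t * r) `^ (- a))%:E <=
   (C * (1 - r) `^ (s - a))%:E)%E.
Proof.
move=> s0 sa [C C0 HC].
have mD : measurable (`[0, 1[%classic : set (measurableTypeR R)) by exact: measurable_itv.
have fM : mu `[0, 1[%classic \is a fin_num by exact: fin_num_measure.
set M := fine (mu `[0, 1[%classic).
have M0 : 0 <= M by rewrite fine_ge0.
have q1 : 0 < 1 - 2 `^ (s - a) :> R.
  by rewrite subr_gt0 powR2_lt1// subr_lt0.
have CM0 : 0 < C + M by rewrite ltr_wpDr.
exists ((C + M) * 2 `^ s / (1 - 2 `^ (s - a))); first by rewrite divr_gt0// mulr_gt0// powR_gt0.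
move=> r r01.
have := @int_kernel_bound mu (fun=> 1) s a (C + M) _ sa (ltW CM0) _ _ _ r r01.
under eq_integral do rewrite mul1r; apply => //.
- by rewrite ltW// (lt_trans s0).
move=> x x0; rewrite integral_cst; last exact: measurable_near1.
rewrite mul1e; have [x1|x1] := ltP x 1.
  have -> : near1 x = `[1 - x, 1[%classic.
    apply/seteqP; split => t /=; rewrite /near1 /= !in_itv /=; first by move=> []; lra.
    by move=> ?; split; lra.
  have := HC (1 - x); rewrite subKr => /(_ ltac:(lra)) h.
  apply: (le_trans h); rewrite lee_fin ler_pM2r ?powR_gt0//.
  by rewrite lerDl.
apply: (@le_trans _ _ (mu `[0, 1[%classic)).
  by apply: le_measure; rewrite ?inE//; [exact: measurable_near1|exact: subIsetl].
rewrite -(fineK fM) -/M lee_fin.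
apply: (@le_trans _ _ ((C + M) * 1)); first by rewrite mulr1 lerDr ltW.
rewrite ler_pM2l//.
have -> : 1 = 1 `^ s :> R by rewrite powR1.
by rewrite ge0_ler_powR// ?nnegrE// ltW.
Qed.

End IntegralBounds.

(** * The Cesaro integrand *)

Section ComplexPower.
Context {R : realType}.
Implicit Types (z w : R[i]) (b : R).

Lemma carg_cos_sin z : 0 < Re z ->
  [/\ cos (carg z) = Re z / cmod z, sin (carg z) = Im z / cmod z &
      - (pi / 2) < carg z < pi / 2].
Proof.
move=> z0.
have m0 : 0 < cmod z by rewrite (lt_le_trans z0)// Re_le_cmod.
set x := Re z / cmod z.
have x0 : 0 < x by rewrite divr_gt0.
have x1 : -1 <= x <= 1.
  rewrite /x ler_pdivrMr// mul1r Re_le_cmod andbT.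
  by rewrite (le_trans _ (ltW x0))// oppr_le0.
have sE : sin (acos x) = `|Im z| / cmod z.
  rewrite sin_acos//; have -> : 1 - x ^+ 2 = (Im z / cmod z) ^+ 2.
    rewrite /x !expr_div_n; apply: (mulIf (lt0r_neq0 (exprn_gt0 2 m0))).
    rewrite mulrBl !mulfVK ?expf_neq0 ?gt_eqF// mul1r cmod_sqr; lra.
  by rewrite sqrtr_sqr normrM normfV (gtr0_norm m0).
have cE : cos (acos x) = x by rewrite acosK// in_itv.
have pi20 : 0 < pi / 2 :> R by rewrite divr_gt0// pi_gt0.
have ap : acos x < pi / 2.
  rewrite -ltr_cos ?in_itv /= ?acos_ge0 ?acos_lepi ?cE ?cos_pihalf//.
  by rewrite (ltW pi20) ler_pdivrMr// ler_peMr ?pi_ge0// ler1n.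
have a0 := acos_ge0 x1.
rewrite /carg -/x; case: ifPn => [i0|]; last rewrite -ltNge => i0.
  split=> //; first by rewrite sE ger0_norm.
  by rewrite ap andbT (lt_le_trans _ a0)// oppr_lt0.
rewrite cosN sinN; split=> //; first by rewrite sE ltr0_norm// mulNr opprK.
by rewrite ltrN2 ap/= (le_lt_trans _ pi20)// oppr_le0.
Qed.

(** On the right half-plane, where 1 - tz lives, the case distinction in [carg] gives way to one
    formula, visibly continuous and easy to bound. *)
Lemma carg_atan z : 0 < Re z -> carg z = atan (Im z / Re z).
Proof.
move=> z0; have [ce se cp] := carg_cos_sin z z0.
have m0 : 0 < cmod z by rewrite (lt_le_trans z0)// Re_le_cmod.
rewrite -[LHS]tanK ?in_itv//; congr atan.
by rewrite /tan ce se; field; rewrite !gt_eqF.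
Qed.

Lemma polar_atan z : 0 < Re z -> z = (cmod z)%:C * expi (atan (Im z / Re z)).
Proof.
move=> z0; have [ce se cp] := carg_cos_sin z z0.
have m0 : 0 < cmod z by rewrite (lt_le_trans z0)// Re_le_cmod.
have A y : cmod z * (y / cmod z) = y by rewrite mulrC divfK// gt_eqF.
rewrite -carg_atan//; apply/eqP; rewrite eq_complex.
rewrite [Re (_%:C * _)]ReM [Im (_%:C * _)]ImM Re_expi Im_expi ce se /=.
by rewrite !mul0r subr0 addr0 !A !eqxx.
Qed.

Lemma cexpN z : cexp (- z) = (cexp z)^-1.
Proof.
have h : cexp z * cexp (- z) = 1 by rewrite -cexpD subrr cexpE expi0 expR0 mulr1.
have z0 : cexp z != 0 by rewrite -cmod_eq0 cmod_cexp gt_eqF// expR_gt0.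
by apply: (mulfI z0); rewrite h mulfV.
Qed.

Lemma cpow_inv z b : 0 < Re z ->
  (cpow z b)^-1 = ((cmod z) `^ (- b))%:C * expi (- (b * atan (Im z / Re z))).
Proof.
move=> z0; rewrite -cexpN cexpE -carg_atan//.
have m0 : 0 < cmod z by rewrite (lt_le_trans z0)// Re_le_cmod.
rewrite ReN ImN ReM ImM /= !mul0r subr0 addr0; congr (_%:C * expi _).
by rewrite /powR gt_eqF// mulNr.
Qed.

Lemma cmod_cpow_inv z b : 0 < Re z -> cmod (cpow z b)^-1 = (cmod z) `^ (- b).
Proof. by move=> z0; rewrite cpow_inv// cmod_mul_expi cmodC ger0_norm ?powR_ge0. Qed.

Lemma atan_le (y : R) : 0 <= y -> atan y <= y.
Proof.
rewrite le_eqVlt => /predU1P[<-|y0]; first by rewrite atan0.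
have [|c _] := @MVT R atan (fun x => (1 + x ^+ 2)^-1) 0 y y0 (fun x _ => is_derive1_atan x).
  by apply: continuous_in_subspaceT => x _; exact: continuous_atan.
rewrite atan0 !subr0 => ->; rewrite ler_piMl ?(ltW y0)// invf_le1 ?ltr_wpDr ?sqr_ge0//.
by rewrite lerDl sqr_ge0.
Qed.

Lemma norm_atan_le (y : R) : `|atan y| <= `|y|.
Proof.
have [y0|y0] := leP 0 y.
  by rewrite !ger0_norm ?atan_le// -atan0 le_atan.
rewrite ltr0_norm; last by rewrite -atan0 lt_atan.
by rewrite ltr0_norm// -atanN atan_le// oppr_ge0 ltW.
Qed.

End ComplexPower.

Section FiniteMeasure.
Context {R : realType} (mu : {finite_measure set (measurableTypeR R) -> \bar R}).

Lemma seg_cont_finite_integrable (g : R -> R) : seg_cont g 0 1 ->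
  mu.-integrable `[0, 1[ (EFin \o g).
Proof.
move=> cg.
have cg' : {within `[0, 1], continuous g}.
  by apply: continuous_in_subspaceT => x; rewrite inE /= in_itv /=; exact: cg.
have : mu.-integrable `[0, 1] (EFin \o g).
  apply: measurable_bounded_integrable => //.
  - by rewrite ltey_eq fin_num_measure.
  - by apply: subspace_continuous_measurable_fun => //; exact: measurable_itv.
  - have /compact_bounded[M [_ mrt]] := continuous_compact cg' (@segment_compact R 0 1).
    by exists M; split; rewrite ?num_real // => ? ? ? ?; exact: mrt.
by apply: integrableS => //; apply: subset_itvl; rewrite bnd_simp.
Qed.

End FiniteMeasure.

Section CesaroIntegrand.
Context {R : realType}.
Implicit Types (f : R[i] -> R[i]) (z : R[i]) (b t r : R).

Lemma ReB1 z : Re (1 - z) = 1 - Re z. Proof. by rewrite ReD ReN. Qed.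
Lemma ImB1 z : Im (1 - z) = - Im z. Proof. by rewrite ImD ImN /= add0r. Qed.

Lemma cmod_scale t z : 0 <= t -> cmod (t%:C * z) = t * cmod z.
Proof. by move=> t0; rewrite cmodM cmodC ger0_norm. Qed.

Lemma cmod_scale_lt1 t z : 0 <= t <= 1 -> cmod z < 1 -> cmod (t%:C * z) < 1.
Proof.
move=> /andP[t0 t1] z1; rewrite cmod_scale// (le_lt_trans _ z1)//.
by rewrite ler_piMl// cmod_ge0.
Qed.

Lemma Re1B_gt0 z : cmod z < 1 -> 0 < Re (1 - z).
Proof. by move=> z1; rewrite ReB1 subr_gt0 (le_lt_trans (Re_le_cmod _)). Qed.

Lemma cmod1B_ge z : 1 - cmod z <= cmod (1 - z).
Proof. by rewrite (le_trans _ (Re_le_cmod _))// ReB1 lerD2l lerN2 Re_le_cmod. Qed.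

Definition cesaro_integrand b f z t := f (t%:C * z) / cpow (1 - t%:C * z) b.

Lemma cvg_scale z t : Re (s%:C * z) @[s --> t] --> Re (t%:C * z) /\
  Im (s%:C * z) @[s --> t] --> Im (t%:C * z).
Proof.
rewrite ReM ImM /= !mul0r subr0 addr0; split.
  under eq_fun do rewrite ReM /= mul0r subr0.
  by apply: cvgM; [exact: cvg_id|exact: cvg_cst].
under eq_fun do rewrite ImM /= mul0r addr0.
by apply: cvgM; [exact: cvg_id|exact: cvg_cst].
Qed.

Lemma cvg_cpow_inv b (T : Type) (F : set_system T) {FF : Filter F}
    (g : T -> R[i]) z : 0 < Re z ->
  Re (g x) @[x --> F] --> Re z -> Im (g x) @[x --> F] --> Im z ->
  Re (cpow (g x) b)^-1 @[x --> F] --> Re (cpow z b)^-1 /\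
  Im (cpow (g x) b)^-1 @[x --> F] --> Im (cpow z b)^-1.
Proof.
move=> z0 gr gi.
pose K w : R[i] := ((cmod w) `^ (- b))%:C * expi (- (b * atan (Im w / Re w))).
have gpos : \forall x \near F, 0 < Re (g x).
  have := cvgr_gt _ gr; exact.
have KE : \forall x \near F, K (g x) = (cpow (g x) b)^-1.
  by apply: filterS gpos => x gx; rewrite cpow_inv.
have m0 : 0 < cmod z by rewrite (lt_le_trans z0)// Re_le_cmod.
have c1 : (cmod (g x)) `^ (- b) @[x --> F] --> (cmod z) `^ (- b).
  have cp : {for cmod z, continuous (fun y : R => y `^ (- b))}.
    apply: differentiable_continuous; apply/derivable1_diffP.
    by apply: derivable_powR; rewrite in_itv /= m0.
  exact: (cvg_comp _ _ (cmod_cvg _ _ _ _ gr gi) cp).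
have c2 : - (b * atan (Im (g x) / Re (g x))) @[x --> F] --> - (b * atan (Im z / Re z)).
  apply: cvgN; apply: cvgM; first exact: cvg_cst.
  have q : Im (g x) / Re (g x) @[x --> F] --> Im z / Re z.
    by apply: cvgM => //; apply: cvgV => //; rewrite gt_eqF.
  exact: (cvg_comp _ _ q (@continuous_atan R _)).
have [k1 k2] := @cvg_polar R T F _ (fun x => ((cmod (g x)) `^ (- b))%:C)
  (fun x => - (b * atan (Im (g x) / Re (g x)))) ((cmod z) `^ (- b))%:C _ c1 (cvg_cst _) c2.
rewrite cpow_inv//; split.
  apply: cvg_trans k1; apply: near_eq_cvg; apply: filterS KE => x; rewrite /K => ->.
  by [].
apply: cvg_trans k2; apply: near_eq_cvg; apply: filterS KE => x; rewrite /K => ->.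
by [].
Qed.

Lemma cvg_cmul (T : Type) (F : set_system T) {FF : Filter F}
    (g h : T -> R[i]) (z w : R[i]) :
  Re (g x) @[x --> F] --> Re z -> Im (g x) @[x --> F] --> Im z ->
  Re (h x) @[x --> F] --> Re w -> Im (h x) @[x --> F] --> Im w ->
  Re (g x * h x) @[x --> F] --> Re (z * w) /\ Im (g x * h x) @[x --> F] --> Im (z * w).
Proof.
move=> gr gi hr hi; rewrite ReM ImM; split.
  by under eq_fun do rewrite ReM; apply: cvgB; apply: cvgM.
by under eq_fun do rewrite ImM; apply: cvgD; apply: cvgM.
Qed.

Lemma cesaro_integrand_cont b f z : analytic_disc f -> cmod z < 1 ->
  seg_cont (fun t => Re (cesaro_integrand b f z t)) 0 1 /\
  seg_cont (fun t => Im (cesaro_integrand b f z t)) 0 1.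
Proof.
move=> fa z1.
suff h t : 0 <= t <= 1 ->
    Re (cesaro_integrand b f z s) @[s --> t] --> Re (cesaro_integrand b f z t) /\
    Im (cesaro_integrand b f z s) @[s --> t] --> Im (cesaro_integrand b f z t).
  by split => t t01; have [] := h t t01.
move=> t01; have tz := cmod_scale_lt1 t z t01 z1.
have [s1 s2] := cvg_scale z t.
have [f1 f2] := analytic_cvg _ _ _ _ _ fa tz s1 s2.
have w0 := Re1B_gt0 _ tz.
have [||k1 k2] := @cvg_cpow_inv b R (nbhs t) _ (fun s => 1 - s%:C * z) _ w0.
- by rewrite ReB1; under eq_fun do rewrite ReB1; apply: cvgB => //; exact: cvg_cst.
- by rewrite ImB1; under eq_fun do rewrite ImB1; exact: cvgN.
exact: cvg_cmul.
Qed.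

Lemma cmod_cesaro_integrand b f z t : 0 <= t <= 1 -> cmod z < 1 -> 0 <= b ->
  cmod (cesaro_integrand b f z t) <=
  cmod (f (t%:C * z)) * (1 - t * cmod z) `^ (- b).
Proof.
move=> t01 z1 b0; have tz := cmod_scale_lt1 t z t01 z1.
have := cmod1B_ge (t%:C * z); rewrite cmod_scale; last by case/andP: t01.
move=> h; have d0 : 0 < 1 - t * cmod z.
  by rewrite subr_gt0 -cmod_scale//; case/andP: t01.
rewrite /cesaro_integrand cmodM cmod_cpow_inv ?Re1B_gt0// ler_wpM2l ?cmod_ge0//.
rewrite !powRN lef_pV2 ?posrE ?powR_gt0// ?(lt_le_trans d0)//.
by rewrite ge0_ler_powR// nnegrE ltW// (lt_le_trans d0).
Qed.

Lemma kernel_cont r (k : R) : 0 <= r < 1 -> seg_cont (fun t => (1 - t * r) `^ k) 0 1.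
Proof.
move=> /andP[r0 r1] t /andP[t0 t1].
have tr : 0 < 1 - t * r.
  by rewrite subr_gt0 (le_lt_trans _ r1)// ler_piMl.
apply: (@continuous_comp _ _ _ (fun t => 1 - t * r) (fun y : R => y `^ k)).
  by apply: cvgB; [exact: cvg_cst|apply: cvgM; [exact: cvg_id|exact: cvg_cst]].
apply: differentiable_continuous; apply/derivable1_diffP.
by apply: derivable_powR; rewrite in_itv /= tr.
Qed.

Lemma seg_contM (g1 g2 : R -> R) a c : seg_cont g1 a c -> seg_cont g2 a c ->
  seg_cont (fun x => g1 x * g2 x) a c.
Proof. by move=> h1 h2 x xac; apply: cvgM; [exact: h1|exact: h2]. Qed.

Lemma cmod_scale_cont f z p : analytic_disc f -> 0 < p -> cmod z < 1 ->
  seg_cont (fun t => cmod (f (t%:C * z)) `^ p) 0 1.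
Proof.
move=> fa p0 z1 t t01; have [s1 s2] := cvg_scale z t.
by apply: cvg_analytic_powR => //; exact: cmod_scale_lt1.
Qed.

Lemma cmod_scale_cont1 f z : analytic_disc f -> cmod z < 1 ->
  seg_cont (fun t => cmod (f (t%:C * z))) 0 1.
Proof.
move=> fa z1.
have -> : (fun t : R => cmod (f (t%:C * z))) = (fun t => cmod (f (t%:C * z)) `^ 1).
  by apply/funext => t; rewrite powRr1// cmod_ge0.
exact: cmod_scale_cont.
Qed.

Variable mu : {finite_measure set (measurableTypeR R) -> \bar R}.

(** The factor 2 is the price of estimating the real and imaginary integrals separately. *)
Lemma cmod_cesaro_le b f z : analytic_disc f -> cmod z < 1 -> 0 <= b ->
  ((cmod (cesaro_op mu b f z))%:E <=
   2%:E * \int[mu]_(t in `[0%R, 1%R[%classic)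
     (cmod (f (t%:C * z)) * (1 - t * cmod z) `^ (- b))%:E)%E.
Proof.
move=> fa z1 b0.
have [cR cI] := cesaro_integrand_cont b f z fa z1.
have z01 : 0 <= cmod z < 1 by rewrite cmod_ge0.
pose B t := cmod (f (t%:C * z)) * (1 - t * cmod z) `^ (- b).
have cB : seg_cont B 0 1 by apply: seg_contM; [exact: cmod_scale_cont1|exact: kernel_cont].
have iB := seg_cont_finite_integrable mu _ cB.
have mD : measurable (`[0, 1[%classic : set (measurableTypeR R)) by exact: measurable_itv.
have key g : seg_cont g 0 1 -> (forall t, 0 <= t <= 1 -> `|g t| <= B t) ->
    `|Rintegral mu `[0, 1[ g| <= Rintegral mu `[0, 1[ B.
  move=> cg gB; have ig := seg_cont_finite_integrable mu _ cg.
  rewrite (le_trans (le_normr_Rintegral _ ig))// le_Rintegral//.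
    exact: integrable_norm.
  by move=> t; rewrite /= in_itv /= => /andP[t0 t1]; apply: gB; rewrite t0 ltW.
have BE : (\int[mu]_(t in `[0%R, 1%R[%classic) (B t)%:E)%E = (Rintegral mu `[0, 1[ B)%:E.
  by rewrite /Rintegral fineK//; exact: integrable_fin_num.
rewrite BE -EFinM lee_fin (le_trans (cmod_le _))// mulr_natl mulr2n lerD//.
  apply: key => // t t01; apply: le_trans (normRe_cmod _) _.
  exact: cmod_cesaro_integrand.
apply: key => // t t01; apply: le_trans (normIm_cmod _) _.
exact: cmod_cesaro_integrand.
Qed.

End CesaroIntegrand.

(** * Minkowski's inequality for the circle means *)

Section Minkowski.
Context {R : realType}.
Implicit Types (f : R[i] -> R[i]) (z : R[i]) (p r L : R).

Lemma circle_meanE f p r : analytic_disc f -> 0 < p -> 0 <= r < 1 ->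
  circle_mean p%:E f r = ((circ p f r%:C / (2 * pi)) `^ p^-1)%:E.
Proof.
move=> fa p0 /andP[r0 r1].
have cr : cmod r%:C < 1 by rewrite cmodC ger0_norm.
have cf := circ_integrand_cont f p _ fa p0 cr.
rewrite /circle_mean -poweR_EFin; congr (_ `^ _)%E.
have -> : circ p f r%:C / (2 * pi) =
    seg_int (fun t => (2 * pi)^-1 * cmod (f (r%:C * expi t)) `^ p) 0 (2 * pi).
  by rewrite seg_intZ; [rewrite mulrC|move=> t _; exact: cf].
rewrite -seg_intE; last by apply: seg_contZ => t _; exact: cf.
by apply: eq_integral => t _; rewrite cexp_expi mulrC.
Qed.

(* The two terms balance when [A `^ p = S / W]. *)
Lemma weighted_power_mean (X S W p : R) : 1 <= p -> 0 <= X -> 0 <= S -> 0 < W ->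
  (forall A, 0 < A -> X <= A * W + A `^ (1 - p) * S) ->
  X `^ p <= 2 `^ p * W `^ (p - 1) * S.
Proof.
move=> p1 X0 S0 W0 H; have p0 : 0 < p by rewrite (lt_le_trans ltr01).
have [SE|SN] := eqVneq S 0.
  have XE : X = 0.
    apply/eqP; rewrite eq_le X0 andbT; apply/ler_addgt0Pl => e e0; rewrite addr0.
    have := H (e / W) (divr_gt0 e0 W0).
    by rewrite SE mulr0 addr0 divfK// gt_eqF.
  by rewrite XE powR0 ?gt_eqF// SE mulr0.
have {}S0 : 0 < S by rewrite lt_def SN.
pose A := (S / W) `^ p^-1.
have A0 : 0 < A by rewrite powR_gt0// divr_gt0.
have Ap : A `^ p = S / W.
  by rewrite /A -powRrM mulVf ?gt_eqF// powRr1// ltW// divr_gt0.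
have A1 : A `^ (1 - p) * S = A * W.
  rewrite powRB; last by rewrite (gt_eqF A0) implybT.
  rewrite powRr1 ?(ltW A0)// Ap; field.
  by rewrite !gt_eqF.
have XA : X <= 2 * (A * W) by have := H A A0; rewrite A1; lra.
have -> : 2 `^ p * W `^ (p - 1) * S = (2 * (A * W)) `^ p.
  rewrite powRM// ?mulr_ge0 ?(ltW A0) ?(ltW W0)// powRM ?(ltW A0) ?(ltW W0)// Ap.
  rewrite -mulrA; congr (_ * _); rewrite powRB; last by rewrite (gt_eqF W0) implybT.
  by rewrite powRr1 ?(ltW W0)//; field; rewrite gt_eqF.
by rewrite ge0_ler_powR// ?nnegrE ?ltW// ?mulr_gt0.
Qed.

(** Either x <= A, or (x / A)^(p - 1) >= 1. Integrated and optimised in [A], this is Hölder's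
    inequality against the constant 1, up to the factor lost in [weighted_power_mean]. *)
Lemma le_add_powR (x A p : R) : 1 <= p -> 0 <= x -> 0 < A ->
  x <= A + x `^ p * A `^ (1 - p).
Proof.
move=> p1 x0 A0; have [xA|Ax] := leP x A.
  by rewrite (le_trans xA)// lerDl mulr_ge0// powR_ge0.
rewrite (@le_trans _ _ (x `^ p * A `^ (1 - p)))//; last by rewrite lerDr ltW.
have xp : 0 < x by rewrite (lt_trans A0).
rewrite -[1 - p]opprB powRN ler_pdivlMr ?powR_gt0//.
rewrite -(mulr_powRB1 x0); last by rewrite (lt_le_trans ltr01).
by rewrite ler_pM2l// ge0_ler_powR ?nnegrE ?subr_ge0// ltW.
Qed.

(* Composing with [clamp] makes the integrand below continuous on the whole
   plane, hence jointly measurable for Tonelli. *)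
Definition clamp (t : R) : R := (1 + `|t| - `|t - 1|) / 2.

Lemma clamp_itv t : 0 <= clamp t <= 1.
Proof.
rewrite /clamp; have [h1|h1] := leP 0 t; have [h2|h2] := leP 0 (t - 1);
  rewrite ?(ger0_norm h1) ?(ger0_norm h2) ?(ltr0_norm h1) ?(ltr0_norm h2); lra.
Qed.

Lemma clamp_id t : 0 <= t <= 1 -> clamp t = t.
Proof.
move=> /andP[t0 t1]; rewrite /clamp ger0_norm// ler0_norm ?subr_le0//; lra.
Qed.

Lemma clamp_cont : continuous clamp.
Proof.
move=> t; apply: cvgM; last exact: cvg_cst.
apply: cvgB; first by apply: cvgD; [exact: cvg_cst|exact: cvg_norm].
by apply: cvg_norm; apply: cvgB; [exact: cvg_id|exact: cvg_cst].
Qed.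

Variable mu : {finite_measure set (measurableTypeR R) -> \bar R}.

Let D : set (measurableTypeR R) := `[0, 1[%classic.

Let mD : measurable D. Proof. exact: measurable_itv. Qed.

Lemma seg_cont_int_fin (g : R -> R) : seg_cont g 0 1 ->
  (\int[mu]_(t in D) (g t)%:E)%E = (Rintegral mu D g)%:E.
Proof.
move=> cg; rewrite /Rintegral fineK//.
by apply: integrable_fin_num => //; exact: seg_cont_finite_integrable.
Qed.

(** Hölder's inequality for |f(tz)| (1 - tr)^a against the weight (1 - tr)^(-(a + b)), whose mass is
    at most [W]. The 4 is 2 from [cmod_cesaro_le] times 2 from balancing the two terms. *)
Lemma cesaro_power_mean f b p r a W z : analytic_disc f -> 1 <= p -> 0 <= r < 1 ->
  0 <= b -> 0 < W -> cmod z = r ->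
  (\int[mu]_(t in D) ((1 - t * r) `^ (- (a + b)))%:E <= W%:E)%E ->
  (((cmod (cesaro_op mu b f z)) `^ p)%:E <=
  (4 `^ p * W `^ (p - 1))%:E *
   \int[mu]_(t in D)
     (cmod (f (t%:C * z)) `^ p * (1 - t * r) `^ (a * p - (a + b)))%:E)%E.
Proof.
move=> fa p1 r01 b0 W0 zr HW; have p0 : 0 < p by rewrite (lt_le_trans ltr01).
have z1 : cmod z < 1 by rewrite zr; case/andP: r01.
pose X t := cmod (f (t%:C * z)) * (1 - t * r) `^ (- b).
pose S t := cmod (f (t%:C * z)) `^ p * (1 - t * r) `^ (a * p - (a + b)).
pose w t := (1 - t * r) `^ (- (a + b)).
have cX : seg_cont X 0 1 by apply: seg_contM; [exact: cmod_scale_cont1|exact: kernel_cont].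
have cS : seg_cont S 0 1 by apply: seg_contM; [exact: cmod_scale_cont|exact: kernel_cont].
have cw : seg_cont w 0 1 by exact: kernel_cont.
have iX := seg_cont_int_fin _ cX.
have iS := seg_cont_int_fin _ cS.
have iw := seg_cont_int_fin _ cw.
have X0 : 0 <= Rintegral mu D X.
  by apply: Rintegral_ge0 => t _; rewrite mulr_ge0 ?cmod_ge0// powR_ge0.
have S0 : 0 <= Rintegral mu D S.
  by apply: Rintegral_ge0 => t _; rewrite mulr_ge0// powR_ge0.
have wW : Rintegral mu D w <= W by rewrite -lee_fin -iw.
have TX : cmod (cesaro_op mu b f z) <= 2 * Rintegral mu D X.
  have := cmod_cesaro_le mu b f z fa z1 b0; rewrite zr -/D => h.
  by rewrite -lee_fin EFinM -iX.
have trp t : 0 <= t <= 1 -> 0 < 1 - t * r.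
  move=> /andP[t0 t1]; case/andP: r01 => r0 r1.
  by rewrite subr_gt0 (le_lt_trans _ r1)// ler_piMl.
have XS A : 0 < A -> Rintegral mu D X <= A * W + A `^ (1 - p) * Rintegral mu D S.
  move=> A0; apply: (@le_trans _ _ (A * Rintegral mu D w + A `^ (1 - p) * Rintegral mu D S)).
    rewrite -!RintegralZl//; [|exact: seg_cont_finite_integrable..].
    rewrite -RintegralD//; [|exact: (seg_cont_finite_integrable mu _ (seg_contZ _ _ _ _ _))..].
    apply: le_Rintegral => //; first exact: seg_cont_finite_integrable.
      apply: seg_cont_finite_integrable; apply: seg_contD; exact: seg_contZ.
    move=> t; rewrite /D /= in_itv /= => /andP[t0 t1].
    have tr := trp t ltac:(by rewrite t0 ltW).
    have := le_add_powR (cmod (f (t%:C * z)) * (1 - t * r) `^ a) A p p1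
      (mulr_ge0 (cmod_ge0 _) (powR_ge0 _ _)) A0.
    rewrite -(ler_pM2r (powR_gt0 (- (a + b)) tr)) -/(w t).
    have pw x y : (1 - t * r) `^ x * (1 - t * r) `^ y = (1 - t * r) `^ (x + y).
      by rewrite powRD// (gt_eqF tr) implybT.
    rewrite -mulrA pw opprD addrA subrr add0r -/(X t) mulrDl => h.
    apply: (le_trans h); rewrite lerD2l /S /w powRM ?cmod_ge0 ?powR_ge0// -powRrM.
    have -> : cmod (f (t%:C * z)) `^ p * (1 - t * r) `^ (a * p) * A `^ (1 - p) *
       (1 - t * r) `^ (- (a + b)) = A `^ (1 - p) * (cmod (f (t%:C * z)) `^ p *
       ((1 - t * r) `^ (a * p) * (1 - t * r) `^ (- (a + b)))) by ring.
    by rewrite pw opprD.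
  by rewrite lerD2r ler_pM2l.
have := weighted_power_mean _ _ _ _ p1 X0 S0 W0 XS => XSp.
rewrite iS -EFinM lee_fin; have := cmod_ge0 (cesaro_op mu b f z).
move: (cmod _) (Rintegral mu D X) (Rintegral mu D S) TX X0 XSp => T IX IS TX X0 XSp T0.
apply: (@le_trans _ _ ((2 * IX) `^ p)).
  rewrite ge0_ler_powR ?nnegrE// ?mulr_ge0//; exact: ltW.
rewrite powRM//.
have -> : 4 `^ p = 2 `^ p * 2 `^ p :> R by rewrite -powRM//; congr (_ `^ _); ring.
by rewrite -!mulrA ler_pM2l ?powR_gt0// mulrA.
Qed.

(** The pointwise bound is integrated over the circle; after Tonelli the inner integral is [circ] at
    radius tr. Its bound turns the exponent ap - (a + b) back into -(a + b), so a further factor [W]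
    completes W^(p - 1) to W^p. *)
Lemma cesaro_circle_mean f b p r a L W : analytic_disc f -> 1 <= p -> 0 <= r < 1 ->
  0 <= b -> 0 < W -> 0 <= L ->
  (forall t, 0 <= t < 1 ->
    circ p f (t * r)%:C <= 2 * pi * (L * (1 - t * r) `^ (- a)) `^ p) ->
  (\int[mu]_(t in D) ((1 - t * r) `^ (- (a + b)))%:E <= W%:E)%E ->
  (circle_mean p%:E (cesaro_op mu b f) r <= (4 * L * W)%:E)%E.
Proof.
move=> fa p1 r01 b0 W0 L0 HL HW; have p0 : 0 < p by rewrite (lt_le_trans ltr01).
have [r0 r1] := andP r01.
have pi2 := @twopi_gt0 R.
pose k := a * p - (a + b).
pose G (z : R * R) := cmod (f ((clamp z.1 * r)%:C * expi z.2)) `^ p *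
  (1 - clamp z.1 * r) `^ k.
have cl1 t : clamp t * r < 1.
  by have /andP[h1 h2] := clamp_itv t; rewrite (le_lt_trans _ r1)// ler_piMl.
have clr t : cmod (clamp t * r)%:C < 1.
  by have /andP[h1 h2] := clamp_itv t; rewrite cmodC ger0_norm// mulr_ge0.
have cG (y : R * R) : {for y, continuous G}.
  case: y => t s.
  have ct : (clamp u.1) * r @[u --> (t, s)] --> clamp t * r.
    apply: cvgM; last exact: cvg_cst.
    apply: (@cvg_comp _ _ _ fst clamp _ (nbhs t)); first exact: cvg_fst.
    exact: clamp_cont.
  apply: cvgM.
    have [h1 h2] := @cvg_polar R _ (nbhs (t, s)) _ (fun u => (clamp u.1 * r)%:C) snd
      (clamp t * r)%:C s ct (cvg_cst _) cvg_snd.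
    by apply: cvg_analytic_powR => //; rewrite cmod_mul_expi.
  apply: (@continuous_comp _ _ _ (fun u : R * R => 1 - clamp u.1 * r) (fun y : R => y `^ k)).
    by apply: cvgB => //; exact: cvg_cst.
  apply: differentiable_continuous; apply/derivable1_diffP.
  by apply: derivable_powR; rewrite in_itv /= subr_gt0 cl1.
have mG : measurable_fun [set: measurableTypeR R * measurableTypeR R] (EFin \o G).
  by apply/measurable_EFinP; exact: continuous2_measurable.
have G0 y : (0 <= (EFin \o G) y)%E by rewrite lee_fin mulr_ge0// powR_ge0.
have mG' : measurable_fun [set: measurableTypeR R * measurableTypeR R]
    (fun y => (EFin \o G) (y.2, y.1)).
  apply: (measurableT_comp mG (measurable_fun_pair measurable_snd measurable_fst)).
pose E : set (measurableTypeR R) := `[0, 2 * pi]%classic.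
have mE : measurable E by exact: measurable_itv.
pose c := 4 `^ p * W `^ (p - 1) / (2 * pi).
have c0 : 0 < c by rewrite divr_gt0// mulr_gt0// powR_gt0.
have step1 : (\int[lebesgue_measure]_(s in E)
    (cmod (cesaro_op mu b f (r%:C * cexp (0 +i* s))) `^ p / (2 * pi))%:E <=
    \int[lebesgue_measure]_(s in E) (c%:E * \int[mu]_(t in D) (EFin \o G) (t, s)))%E.
  apply: ge0_le_integral_all => s _.
    by rewrite lee_fin divr_ge0 ?powR_ge0// ltW.
  have zr : cmod (r%:C * cexp (0 +i* s)) = r.
    by rewrite cexp_expi cmod_mul_expi cmodC ger0_norm.
  have h := cesaro_power_mean f b p r a W _ fa p1 r01 b0 W0 zr HW.
  rewrite [_ / (2 * pi)]mulrC EFinM.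
  have i0 : (0 <= ((2 * pi)^-1 : R)%:E)%E by rewrite lee_fin invr_ge0 ltW.
  apply: (le_trans (lee_wpmul2l i0 h)).
  rewrite muleA -EFinM; have -> : (2 * pi)^-1 * (4 `^ p * W `^ (p - 1)) = c.
    by rewrite /c mulrC.
  have Ez t : t%:C * (r%:C * cexp (0 +i* s)) = (t * r)%:C * expi s.
    by rewrite cexp_expi rmorphM mulrA.
  apply: lee_wpmul2l; first by rewrite lee_fin ltW.
  apply: ge0_le_integral_all => t.
    by move=> _; rewrite lee_fin mulr_ge0// powR_ge0.
  rewrite /D /= in_itv /= => /andP[t0 t1].
  have ct : clamp t = t by rewrite clamp_id// t0 ltW.
  by rewrite Ez lee_fin /G /= ct.
have step2 : (\int[lebesgue_measure]_(s in E) (c%:E * \int[mu]_(t in D) (EFin \o G) (t, s)) =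
    c%:E * \int[mu]_(t in D) \int[lebesgue_measure]_(s in E) (EFin \o G) (t, s))%E.
  rewrite ge0_integralZl_EFin//; last 3 first.
  - by move=> s _; apply: integral_ge0 => t _; exact: G0.
  - apply: measurable_funTS.
    exact: (measurable_int_on mu D _ mD (fun y => G0 _) mG').
  - exact: ltW.
  by rewrite (tonelli_on mu lebesgue_measure D E (EFin \o G) mD mE G0 mG).
have step3 : (\int[mu]_(t in D) \int[lebesgue_measure]_(s in E) (EFin \o G) (t, s) <=
    (2 * pi * L `^ p)%:E * W%:E)%E.
  apply: (@le_trans _ _ ((2 * pi * L `^ p)%:E *
      \int[mu]_(t in D) ((1 - t * r) `^ (- (a + b)))%:E)%E); last first.
    by apply: lee_wpmul2l => //; rewrite lee_fin mulr_ge0 ?powR_ge0// ltW.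
  have cw : seg_cont (fun t => (1 - t * r) `^ (- (a + b))) 0 1 by exact: kernel_cont.
  rewrite -ge0_integralZl_EFin//; last 3 first.
  - by move=> t _; rewrite lee_fin powR_ge0.
  - exact: (measurable_int mu (seg_cont_finite_integrable mu _ cw)).
  - by rewrite mulr_ge0 ?powR_ge0// ltW.
  apply: ge0_le_integral_all => t; first by move=> _; exact: integral_ge0.
  rewrite /D /= in_itv /= => /andP[t0 t1].
  have ct : clamp t = t by rewrite clamp_id// t0 ltW.
  have tr0 : 0 < 1 - t * r by have := cl1 t; rewrite ct subr_gt0.
  have ctr : cmod (t * r)%:C < 1 by have := clr t; rewrite ct.
  have cf := circ_integrand_cont f p _ fa p0 ctr.
  have -> : (\int[lebesgue_measure]_(s in E) (G (t, s))%:E =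
      ((1 - t * r) `^ k * circ p f (t * r)%:C)%:E)%E.
    rewrite -seg_intZ; last by move=> s _; exact: cf.
    rewrite -seg_intE; last by apply: seg_contZ => s _; exact: cf.
    by apply: eq_integral => s _; rewrite /G /= ct mulrC.
  rewrite -EFinM lee_fin.
  apply: (@le_trans _ _ ((1 - t * r) `^ k * (2 * pi * (L * (1 - t * r) `^ (- a)) `^ p))).
    by rewrite ler_pM2l ?powR_gt0//; apply: HL; rewrite t0.
  rewrite powRM ?powR_ge0// -powRrM.
  have -> : (1 - t * r) `^ k * (2 * pi * (L `^ p * (1 - t * r) `^ (- a * p))) =
    2 * pi * L `^ p * ((1 - t * r) `^ k * (1 - t * r) `^ (- a * p)) by ring.
  rewrite -powRD; last by rewrite (gt_eqF tr0) implybT.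
  have -> : k + - a * p = - (a + b) by rewrite /k; ring.
  by [].
have fin : (\int[lebesgue_measure]_(s in E)
    (cmod (cesaro_op mu b f (r%:C * cexp (0 +i* s))) `^ p / (2 * pi))%:E <=
    ((4 * L * W) `^ p)%:E)%E.
  apply: (le_trans step1); rewrite step2.
  apply: (le_trans (lee_wpmul2l _ step3)); first by rewrite lee_fin ltW.
  rewrite -!EFinM lee_fin /c !powRM// ?mulr_ge0// ?(ltW W0)//.
  rewrite -(mulr_powRB1 (ltW W0) p0).
  have E4 (u v w x P : R) : 0 < P -> u * v / P * (P * w * x) = u * w * (x * v).
    by move=> P0; field; rewrite gt_eqF.
  by rewrite E4.
have -> : 4 * L * W = ((4 * L * W) `^ p) `^ p^-1.
  by rewrite -powRrM mulfV ?gt_eqF// powRr1// !mulr_ge0// ltW.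
rewrite /circle_mean -poweR_EFin; apply: gt0_ler_poweR => //.
- by rewrite invr_ge0 ltW.
- rewrite in_itv /= leey andbT; apply: integral_ge0 => s _.
  by rewrite lee_fin divr_ge0 ?powR_ge0// ltW.
- by rewrite in_itv /= leey andbT lee_fin powR_ge0.
Qed.

End Minkowski.

(** * Sufficiency for q = oo *)

Section SufficiencyInf.
Context {R : realType}.
Variable mu : {finite_measure set (measurableTypeR R) -> \bar R}.
Implicit Types (f : R[i] -> R[i]) (z : R[i]) (p r : R).

Lemma circle_mean_ge0 (p : \bar R) f r : 0 <= r -> (0 <= circle_mean p f r)%E.
Proof.
move=> r0; case: p => [p||]//=; first exact: poweR_ge0.
apply: le_ereal_sup_tmp; exists (cmod (f r%:C))%:E; last by rewrite lee_fin cmod_ge0.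
by exists r%:C => //=; rewrite cmodC ger0_norm.
Qed.

Lemma mixed_norm_inf_ge0 (p : \bar R) (g : R) f : (0 <= mixed_norm p +oo%E g f)%E.
Proof.
apply: le_ereal_sup_tmp; exists ((((1 - 2^-1) `^ g)%R)%:E * circle_mean p f 2^-1)%E.
  by exists 2^-1 => //=; rewrite in_itv /= invr_gt0 ltr0n invf_lt1 ?ltr1n.
by rewrite mule_ge0 ?lee_fin ?powR_ge0// circle_mean_ge0.
Qed.

Lemma mixed_norm_inf_circle (p : \bar R) (g N : R) f r :
  mixed_norm p +oo%E g f = N%:E -> 0 < r < 1 ->
  (circle_mean p f r <= (N * (1 - r) `^ (- g))%:E)%E.
Proof.
move=> Nf /andP[r0 r1].
have r1' : 0 < 1 - r by rewrite subr_gt0.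
have h : ((((1 - r) `^ g)%R)%:E * circle_mean p f r <= N%:E)%E.
  rewrite -Nf; apply: ereal_sup_ubound; exists r => //=.
  by rewrite in_itv /= r0.
have c0 := circle_mean_ge0 p f r (ltW r0).
by rewrite powRN EFinM lee_pdivlMr ?powR_gt0// muleC.
Qed.

Lemma circ_le_circle_mean f p r (B : R) : analytic_disc f -> 0 < p -> 0 <= r < 1 ->
  0 <= B -> (circle_mean p%:E f r <= B%:E)%E -> circ p f r%:C <= 2 * pi * B `^ p.
Proof.
move=> fa p0 r01 B0; rewrite circle_meanE// lee_fin => h.
have pi2 := @twopi_gt0 R.
have c0 : 0 <= circ p f r%:C / (2 * pi) by rewrite divr_ge0 ?circ_ge0// ltW.
rewrite mulrC -ler_pdivrMr//.
have -> : circ p f r%:C / (2 * pi) = ((circ p f r%:C / (2 * pi)) `^ p^-1) `^ p.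
  by rewrite -powRrM mulVf ?gt_eqF// powRr1.
by rewrite ge0_ler_powR// ?nnegrE ?powR_ge0// ltW.
Qed.

Lemma powR_half_inv (k : R) : (1 - 2^-1) `^ (- k) = 2 `^ k :> R.
Proof.
have -> : 1 - 2^-1 = 2^-1 :> R by lra.
by rewrite -powR_inv1// -powRrM mulrNN mul1r.
Qed.

Lemma growth_from_norm f (g N : R) z : analytic_disc f -> 0 <= N -> 0 <= g ->
  mixed_norm +oo%E +oo%E g f = N%:E -> cmod z < 1 ->
  cmod (f z) <= N * 2 `^ g * (1 - cmod z) `^ (- g).
Proof.
move=> fa N0 g0 Nf z1.
have main w : 0 < cmod w -> cmod w < 1 -> cmod (f w) <= N * (1 - cmod w) `^ (- g).
  move=> w0 w1; rewrite -lee_fin.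
  apply: le_trans (mixed_norm_inf_circle +oo%E g N f (cmod w) Nf _); last by rewrite w0.
  by apply: ereal_sup_ubound; exists w.
have g1 : 1 <= 2 `^ g :> R by rewrite -[leLHS](powRr0 2) ler_powR// ler1n.
have [z0|z0] := eqVneq (cmod z) 0; last first.
  apply: (le_trans (main z _ z1)); first by rewrite lt_def z0 cmod_ge0.
  by rewrite ler_wpM2r ?powR_ge0// ler_peMr.
move/eqP: (z0); rewrite cmod_eq0 => /eqP ->; rewrite cmod0 subr0 powR1 mulr1.
have h1 : cmod (0 : R[i]) + 2^-1 < 1 :> R by rewrite cmod0 add0r invf_lt1 ?ltr1n.
have h0 : 0 <= 2^-1 :> R by [].
have pi2 := @twopi_gt0 R.
have := submean_powR f 1 0 2^-1 fa (lexx _) h0 h1.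
rewrite powRr1 ?cmod_ge0// => h.
rewrite -(ler_pM2l pi2); apply: (le_trans h).
have ch : cmod (2^-1 : R)%:C < 1 :> R by rewrite cmodC ger0_norm// invf_lt1 ?ltr1n.
have -> : (fun t : R => cmod (f (0 + (2^-1 : R)%:C * expi t)) `^ 1) =
   (fun t => cmod (f ((2^-1 : R)%:C * expi t)) `^ 1).
  by apply/funext => t; rewrite add0r.
have -> : 2 * pi * (N * 2 `^ g) = seg_int (fun=> N * 2 `^ g) 0 (2 * pi) :> R.
  by rewrite seg_int_cst; [rewrite subr0 mulrC|exact: ltW].
apply: le_seg_int.
- by move=> t _; apply: circ_integrand_cont.
- exact: seg_cont_cst.
move=> t _; rewrite powRr1 ?cmod_ge0//.
have ce : cmod ((2^-1 : R)%:C * expi t) = 2^-1 by rewrite cmod_mul_expi cmodC ger0_norm.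
rewrite -powR_half_inv; have := main ((2^-1 : R)%:C * expi t).
by rewrite ce; apply; rewrite ?invr_gt0// invf_lt1 ?ltr1n.
Qed.

(** Radius 0, absent from the norm, is compared with radius 1/2 by monotonicity of the means. *)
Lemma circ_from_norm f p (g N : R) r : analytic_disc f -> 1 <= p -> 0 <= N -> 0 <= g ->
  mixed_norm p%:E +oo%E g f = N%:E -> 0 <= r < 1 ->
  circ p f r%:C <= 2 * pi * (N * 2 `^ g * (1 - r) `^ (- g)) `^ p.
Proof.
move=> fa p1 N0 g0 Nf /andP[r0 r1]; have p0 : 0 < p by rewrite (lt_le_trans ltr01).
have pi2 := @twopi_gt0 R.
have main x : 0 < x < 1 -> circ p f x%:C <= 2 * pi * (N * (1 - x) `^ (- g)) `^ p.
  move=> x01; have [x0 x1] := andP x01.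
  apply: circ_le_circle_mean => //; [by rewrite ltW|by rewrite mulr_ge0// powR_ge0|].
  exact: mixed_norm_inf_circle.
have g1 : 1 <= 2 `^ g :> R by rewrite -[leLHS](powRr0 2) ler_powR// ler1n.
move: r0; rewrite le_eqVlt => /predU1P[<-|r0].
  rewrite subr0 powR1 mulr1.
  have h2 : 0 < (2^-1 : R) < 1 by rewrite invr_gt0 ltr0n invf_lt1 ?ltr1n.
  have [h3 h4] := andP h2.
  apply: (@le_trans _ _ (circ p f (2^-1 : R)%:C)).
    by apply: circ_monotone => //; rewrite lexx ltW.
  by rewrite -powR_half_inv; exact: main.
apply: (le_trans (main r _)); first by rewrite r0.
rewrite ler_pM2l// ge0_ler_powR// ?nnegrE; first exact: ltW.
- by rewrite mulr_ge0// powR_ge0.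
- by rewrite !mulr_ge0// powR_ge0.
by rewrite ler_wpM2r ?powR_ge0// ler_peMr.
Qed.

(** With [a] = gam1 the kernel integral has exponent (beta + gam1 - gam2) - (gam1 + beta) = -gam2,
    exactly what the target norm compensates. For p = oo the estimate is pointwise; for finite p it
    is [cesaro_circle_mean]. *)
Lemma carleson_bounded_inf (p : \bar R) (gam1 gam2 beta : R) : (1%:E <= p)%E ->
  0 < gam1 -> 0 < gam2 -> 0 < beta -> gam2 < gam1 + beta ->
  carleson mu (beta + gam1 - gam2) ->
  bounded_mixed (cesaro_op mu beta) p +oo%E gam1 p +oo%E gam2.
Proof.
move=> p1 g1 g2 b0 g21 muC.
have s0 : 0 < beta + gam1 - gam2 by lra.
have sa : beta + gam1 - gam2 < gam1 + beta by lra.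
have [C C0 HC] := int_kernel_carleson mu _ _ s0 sa muC.
exists (4 * 2 `^ gam1 * C); first by rewrite !mulr_gt0// powR_gt0.
move=> f [fa ffin].
have fge0 := mixed_norm_inf_ge0 p gam1 f.
pose N := fine (mixed_norm p +oo%E gam1 f).
have NE : mixed_norm p +oo%E gam1 f = N%:E by rewrite /N fineK// ge0_fin_numE.
have N0 : 0 <= N by rewrite fine_ge0.
rewrite NE -EFinM.
pose M := N * 2 `^ gam1.
have M0 : 0 <= M by rewrite mulr_ge0// powR_ge0.
have key r : 0 < r < 1 -> (circle_mean p (cesaro_op mu beta f) r <=
    (4 * M * (C * (1 - r) `^ (beta + gam1 - gam2 - (gam1 + beta))))%:E)%E.
  move=> /andP[r0 r1].
  have r01 : 0 <= r < 1 by rewrite ltW.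
  have W0 : 0 < C * (1 - r) `^ (beta + gam1 - gam2 - (gam1 + beta)).
    by rewrite mulr_gt0// powR_gt0// subr_gt0.
  have HCr := HC r r01.
  set W := C * _ in W0 HCr *.
  case: p p1 {fge0 ffin} @N NE N0 @M M0 => [p||]// p1 N NE N0 M M0.
    apply: (cesaro_circle_mean mu f beta p r gam1 M W) => //; first exact: ltW.
    move=> t /andP[t0 t1]; apply: circ_from_norm => //; first exact: ltW.
    by rewrite mulr_ge0 ?(ltW r0)//= (le_lt_trans _ r1)// ler_piMl// ltW.
  apply: ge_ereal_sup => _ [z /= zr <-].
  have z1 : cmod z < 1 by rewrite zr.
  apply: (le_trans (cmod_cesaro_le mu beta f z fa z1 (ltW b0))).
  rewrite zr; apply: (@le_trans _ _ (2%:E * (M%:E * W%:E))%E); last first.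
    by rewrite -!EFinM lee_fin; have := mulr_ge0 M0 (ltW W0); lra.
  apply: lee_wpmul2l; first by rewrite lee_fin.
  apply: (@le_trans _ _ (M%:E * \int[mu]_(t in `[0%R, 1%R[%classic)
      ((1 - t * r) `^ (- (gam1 + beta)))%:E)%E); last first.
    by apply: lee_wpmul2l => //; rewrite lee_fin.
  have cw : seg_cont (fun t => (1 - t * r) `^ (- (gam1 + beta))) 0 1 by exact: kernel_cont.
  rewrite -ge0_integralZl_EFin//; last 2 first.
  - by move=> t _; rewrite lee_fin powR_ge0.
  - exact: (measurable_int mu (seg_cont_finite_integrable mu _ cw)).
  apply: ge0_le_integral_all => t.
    by move=> _; rewrite lee_fin mulr_ge0 ?cmod_ge0// powR_ge0.
  rewrite /= in_itv /= => /andP[t0 t1].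
  have tz : cmod (t%:C * z) = t * r by rewrite cmod_scale// zr.
  have tr : t * r < 1 by rewrite (le_lt_trans _ r1)// ler_piMl// ltW.
  have := growth_from_norm f gam1 N (t%:C * z) fa N0 (ltW g1) NE.
  rewrite tz => /(_ tr) h; rewrite -EFinM lee_fin.
  apply: (@le_trans _ _ (M * (1 - t * r) `^ (- gam1) * (1 - t * r) `^ (- beta))).
    by rewrite ler_wpM2r ?powR_ge0.
  have tr' : 0 < 1 - t * r by rewrite subr_gt0.
  rewrite -mulrA -powRD; last by rewrite (gt_eqF tr') implybT.
  by rewrite opprD.
apply: ge_ereal_sup => _ [r /= + <-]; rewrite in_itv /= => r01.
have [r0 r1] := andP r01; have r1' : 0 < 1 - r by rewrite subr_gt0.
apply: (@le_trans _ _ (((1 - r) `^ gam2)%:E * (4 * M *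
   (C * (1 - r) `^ (beta + gam1 - gam2 - (gam1 + beta))))%:E)%E).
  by apply: lee_wpmul2l; [rewrite lee_fin powR_ge0|exact: key].
rewrite -EFinM lee_fin.
have -> : beta + gam1 - gam2 - (gam1 + beta) = - gam2 by ring.
rewrite powRN; have q0 : (1 - r) `^ gam2 != 0 by rewrite gt_eqF// powR_gt0.
have -> : (1 - r) `^ gam2 * (4 * M * (C / (1 - r) `^ gam2)) = 4 * M * C by field.
by rewrite /M le_eqVlt; apply/orP; left; apply/eqP; ring.
Qed.

End SufficiencyInf.

(** * Sufficiency for finite q *)

Section SufficiencyFin.
Context {R : realType}.
Implicit Types (f : R[i] -> R[i]) (z : R[i]) (p q r x : R).

Definition pmean f p x : R := (circ p f x%:C / (2 * pi)) `^ p^-1.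

Lemma pmean_ge0 f p x : 0 <= pmean f p x.
Proof. exact: powR_ge0. Qed.

Lemma pmean_monotone f p r x : analytic_disc f -> 1 <= p -> 0 <= r <= x -> x < 1 ->
  pmean f p r <= pmean f p x.
Proof.
move=> fa p1 rx x1; have p0 : 0 < p by rewrite (lt_le_trans ltr01).
have pi2 := @twopi_gt0 R.
have c0 y : 0 <= circ p f y%:C / (2 * pi) by apply: divr_ge0; [exact: circ_ge0|exact: ltW].
apply: ge0_ler_powR; rewrite ?nnegrE; [|exact: c0|exact: c0|].
  by rewrite invr_ge0 ltW.
apply: ler_wpM2r; first by rewrite invr_ge0; exact: ltW.
exact: (circ_monotone f p r x fa p1 rx x1).
Qed.

Lemma circ_pmean f p x : 0 < p -> circ p f x%:C = 2 * pi * pmean f p x `^ p.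
Proof.
move=> p0; have pi2 := @twopi_gt0 R.
rewrite /pmean -powRrM mulVf ?gt_eqF// powRr1; last by rewrite divr_ge0 ?circ_ge0// ltW.
by rewrite mulrC divfK// gt_eqF.
Qed.

Let D : set (measurableTypeR R) := `]0, 1[%classic.

Let mD : measurable D. Proof. exact: measurable_itv. Qed.

Lemma measurable_pmean f p : analytic_disc f -> 0 < p ->
  measurable_fun D (pmean f p).
Proof.
move=> fa p0; apply: (measurableT_comp (measurable_powR p^-1)).
apply: measurable_funM => //.
apply: open_continuous_measurable_fun; first exact: interval_open.
move=> x; rewrite inE /D /= in_itv /= => /andP[x0 x1].
by apply: circ_continuous => //; rewrite gtr0_norm.
Qed.

Lemma mixed_norm_pmean f p q (g : R) : analytic_disc f -> 0 < p ->
  mixed_norm p%:E q%:E g f =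
  ((\int[lebesgue_measure]_(x in D) ((1 - x) `^ (g * q - 1) * pmean f p x `^ q)%:E)
   `^ q^-1)%E.
Proof.
move=> fa p0; rewrite /mixed_norm; congr (_ `^ _)%E; apply: eq_integral => x xD.
have /andP[x0 x1] : 0 < x < 1 by move: xD; rewrite inE /D /= in_itv.
by rewrite circle_meanE ?(ltW x0)// poweR_EFin -EFinM.
Qed.

(** * Truncated weighted integrals of the means *)

Section KernelEstimates.
Variables (f : R[i] -> R[i]) (p q k : R).
Hypotheses (fa : analytic_disc f) (p1 : 1 <= p) (q0 : 0 < q).

Let p0 : 0 < p. Proof. by rewrite (lt_le_trans ltr01). Qed.

(** Extended by zero off (0, 1), so that it is measurable on the whole line, as [tonelli_on]
    asks. *)
Definition mean_density : measurableTypeR R -> R :=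
  (fun x => pmean f p x `^ q * (1 - x) `^ (k - 1)) \_ D.

Lemma mean_density_ge0 x : 0 <= mean_density x.
Proof. by rewrite /mean_density patchE; case: ifPn => // _; rewrite mulr_ge0// powR_ge0. Qed.

Lemma mean_densityE x : 0 < x < 1 ->
  mean_density x = pmean f p x `^ q * (1 - x) `^ (k - 1).
Proof. by move=> x01; rewrite /mean_density patchE mem_set//= /D /= in_itv. Qed.

Lemma measurable_mean_density : measurable_fun setT mean_density.
Proof.
apply: (iffLR (measurable_restrictT _ _)) => //.
apply: measurable_funM; last exact: measurable_powR_onem.
by apply: (measurableT_comp (measurable_powR q)); exact: measurable_pmean.
Qed.

(** The cut is halfway between r and 1: far enough to contain (x, (1 + x)/2) for every x <= r, yet
    below it 1 - y stays above (1 - r)/2. *)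
Definition below_half r : set (measurableTypeR R) := [set x | 2 * x < 1 + r].

(** On (x, (1 + x)/2), of length (1 - x)/2, the mean is at least its value at [x] and 1 - y is
    comparable to 1 - x. Thus an integral up to the cut controls the mean at every radius up to
    [r]. *)
Lemma mean_density_mass x r : 0 <= x -> x <= r -> r < 1 ->
  (((1 - x) `^ k * pmean f p x `^ q / (2 * (1 + 2 `^ (k - 1))))%:E <=
   \int[lebesgue_measure]_(y in D) (mean_density y * \1_(below_half r) y)%:E)%E.
Proof.
move=> x0 xr r1; have x1 : x < 1 by rewrite (le_lt_trans xr).
have x1' : 0 < 1 - x by rewrite subr_gt0.
pose c := pmean f p x `^ q * ((1 - x) `^ (k - 1) / (1 + 2 `^ (k - 1))).
have K0 : 0 < 1 + 2 `^ (k - 1) :> R by rewrite ltr_wpDr// powR_ge0.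
have c0 : 0 <= c by rewrite mulr_ge0 ?powR_ge0// divr_ge0 ?powR_ge0// ltW.
pose A : set (measurableTypeR R) := `]x, (1 + x) / 2[%classic.
have mA : measurable A by exact: measurable_itv.
have AD : A `<=` D.
  by move=> y; rewrite /A /D /= !in_itv /=; lra.
have -> : ((1 - x) `^ k * pmean f p x `^ q / (2 * (1 + 2 `^ (k - 1))))%:E =
    (\int[lebesgue_measure]_(y in D) (c%:E * (\1_A y)%:E))%E.
  have mA' : measurable_fun D (fun y => (\1_A y)%:E : \bar R).
    by apply/measurable_EFinP; apply: measurable_funTS; exact: measurable_indic.
  have A0 y : D y -> (0 <= (\1_A y)%:E :> \bar R)%E by rewrite lee_fin.
  rewrite (ge0_integralZl_EFin _ mD A0 mA' c0).
  rewrite integral_indic// setIidl//.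
  have E : @lebesgue_measure R A = ((1 - x) / 2)%:E.
    rewrite /A lebesgue_measure_itv /= lte_fin ifT; last by lra.
    by rewrite -EFinD; congr (_%:E); lra.
  rewrite [X in _ = (_ * X)%E]E -EFinM; congr (_%:E).
  have -> : (1 - x) `^ k = (1 - x) * (1 - x) `^ (k - 1).
    rewrite -{2}[1 - x]powRr1 ?(ltW x1')// -powRD; last by rewrite (gt_eqF x1') implybT.
    by congr (_ `^ _); ring.
  by rewrite /c; field; rewrite gt_eqF.
apply: ge0_le_integral_all => y; first by move=> _; rewrite mule_ge0// lee_fin.
rewrite /D /= in_itv /= => y01; rewrite -EFinM lee_fin !indicE.
case: (boolP (y \in A)) => yA; last first.
  by rewrite mulr0 mulr_ge0// mean_density_ge0.
move: yA; rewrite inE /A /= in_itv /= => /andP[xy yx].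
have -> : y \in below_half r by rewrite inE /below_half /=; lra.
rewrite !mulr1 (mean_densityE _ y01) /c.
have [y0 y1] := andP y01.
apply: ler_pM; first exact: powR_ge0.
- by apply: divr_ge0; [exact: powR_ge0|exact: ltW].
- apply: ge0_ler_powR; rewrite ?nnegrE; [exact: ltW|exact: pmean_ge0..|].
  by apply: (pmean_monotone f p x y fa p1 _ y1); rewrite x0 ltW.
rewrite ler_pdivrMr// mulrC; apply: powR_half => //; lra.
Qed.

Lemma measurable_norm_density (a : R) :
  measurable_fun D (fun x => (1 - x) `^ a * pmean f p x `^ q).
Proof.
apply: measurable_funM; first exact: measurable_powR_onem.
by apply: (measurableT_comp (measurable_powR q)); exact: measurable_pmean.
Qed.

(** Serves to see that the truncated mass is finite for each r: below the cut, (1 - y)^d is at least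
    ((1 - r)/2)^d, so the missing power costs only a factor depending on r. *)
Lemma mean_density_below (d : R) r : 0 <= d -> r < 1 ->
  (\int[lebesgue_measure]_(y in D) (mean_density y * \1_(below_half r) y)%:E <=
   (((1 - r) / 2) `^ (- d))%:E *
   \int[lebesgue_measure]_(y in D) ((1 - y) `^ (k + d - 1) * pmean f p y `^ q)%:E)%E.
Proof.
move=> d0 r1; have r2 : 0 < (1 - r) / 2 by rewrite divr_gt0// subr_gt0.
have F0 y : D y -> (0 <= ((1 - y) `^ (k + d - 1) * pmean f p y `^ q)%:E)%E.
  by rewrite lee_fin mulr_ge0//; exact: powR_ge0.
have mF : measurable_fun D (fun y => ((1 - y) `^ (k + d - 1) * pmean f p y `^ q)%:E).
  by apply/measurable_EFinP; exact: measurable_norm_density.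
rewrite -(ge0_integralZl_EFin lebesgue_measure mD F0 mF (powR_ge0 _ _)).
apply: ge0_le_integral_all => y.
  by move=> _; rewrite lee_fin mulr_ge0//; exact: mean_density_ge0.
move=> Dy; have y01 : 0 < y < 1 by move: Dy; rewrite /D /= in_itv.
have [y0 y1] := andP y01; have y1' : 0 < 1 - y by rewrite subr_gt0.
rewrite -EFinM lee_fin indicE; case: (boolP (y \in below_half r)); last first.
  move=> _; rewrite mulr0; apply: mulr_ge0; first exact: powR_ge0.
  by apply: mulr_ge0; exact: powR_ge0.
rewrite inE /below_half /= => yr; rewrite mulr1 (mean_densityE _ y01) mulrA mulrC.
apply: ler_wpM2r; first exact: powR_ge0.
have -> : (1 - y) `^ (k + d - 1) = (1 - y) `^ (k - 1) * (1 - y) `^ d.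
  rewrite -powRD; last by rewrite (gt_eqF y1') implybT.
  by congr (_ `^ _); ring.
rewrite mulrCA; rewrite -[leLHS]mulr1; apply: ler_wpM2l; first exact: powR_ge0.
rewrite powRN mulrC ler_pdivlMr ?powR_gt0// mul1r.
apply: ge0_ler_powR; rewrite ?nnegrE//; [exact: ltW|exact: ltW|lra].
Qed.

(* Integrating first in [r], the truncation at [2 * y < 1 + r] only keeps
   [1 - r <= 2 * (1 - y)]. *)
Lemma mean_density_fubini (d C : R) : 0 < d -> 0 < C ->
  (forall x, 0 < x ->
    (\int[lebesgue_measure]_(t in near1 x) ((1 - t) `^ (d - 1))%:E <=
     (C * x `^ d)%:E)%E) ->
  measurable_fun D (fun r => ((1 - r) `^ (d - 1))%:E *
    \int[lebesgue_measure]_(y in D) (mean_density y * \1_(below_half r) y)%:E)%E /\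
  (\int[lebesgue_measure]_(r in D) (((1 - r) `^ (d - 1))%:E *
    \int[lebesgue_measure]_(y in D) (mean_density y * \1_(below_half r) y)%:E) <=
   (C * 2 `^ d)%:E *
   \int[lebesgue_measure]_(y in D) ((1 - y) `^ (k + d - 1) * pmean f p y `^ q)%:E)%E.
Proof.
move=> d0 C0 HC.
pose B : set (measurableTypeR R * measurableTypeR R) := [set z | 2 * z.2 < 1 + z.1].
have mB : measurable B.
  have -> : B = (fun z : measurableTypeR R * measurableTypeR R => 1 + z.1 - 2 * z.2)
      @^-1` `]0, +oo[%classic.
    by apply/seteqP; split => z /=; rewrite /B /= in_itv /= andbT subr_gt0.
  rewrite -[_ @^-1` _]setTI.
  have mS : measurable_fun setT
      (fun z : measurableTypeR R * measurableTypeR R => 1 + z.1 - 2 * z.2).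
    apply: measurable_funB.
      by apply: measurable_funD => //; exact: measurable_fst.
    by apply: measurable_funM => //; exact: measurable_snd.
  by apply: mS => //; exact: measurable_itv.
pose G (z : R * R) : \bar R :=
  ((1 - z.1) `^ (d - 1) * (mean_density z.2 * \1_B z))%:E.
have BE r y : \1_B (r, y) = \1_(below_half r) y :> R by rewrite !indicE.
have G0 (w : R * R) : (0 <= G w)%E.
  rewrite lee_fin mulr_ge0 ?powR_ge0// mulr_ge0//; exact: mean_density_ge0.
have mG : measurable_fun [set: measurableTypeR R * measurableTypeR R] G.
  apply/measurable_EFinP; apply: measurable_funM.
    exact: (measurableT_comp (measurable_powR_onem setT (d - 1)) measurable_fst).
  apply: measurable_funM; last exact: measurable_indic.
  exact: (measurableT_comp measurable_mean_density measurable_snd).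
have F0 y : D y -> (0 <= ((1 - y) `^ (k + d - 1) * pmean f p y `^ q)%:E)%E.
  by rewrite lee_fin mulr_ge0//; exact: powR_ge0.
have mF : measurable_fun D (fun y => ((1 - y) `^ (k + d - 1) * pmean f p y `^ q)%:E).
  by apply/measurable_EFinP; exact: measurable_norm_density.
have C20 : 0 <= C * 2 `^ d by apply: mulr_ge0; [exact: ltW|exact: powR_ge0].
rewrite -(ge0_integralZl_EFin lebesgue_measure mD F0 mF C20).
have JE r : (((1 - r) `^ (d - 1))%:E *
    \int[lebesgue_measure]_(y in D) (mean_density y * \1_(below_half r) y)%:E =
    \int[lebesgue_measure]_(y in D) G (r, y))%E.
  have m0 y : D y -> (0 <= (mean_density y * \1_(below_half r) y)%:E)%E.
    by move=> _; rewrite lee_fin mulr_ge0//; exact: mean_density_ge0.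
  have mm : measurable_fun D (fun y => (mean_density y * \1_(below_half r) y)%:E).
    apply/measurable_EFinP; apply: measurable_funTS; apply: measurable_funM.
      exact: measurable_mean_density.
    apply: measurable_indic.
    have -> : below_half r = `]-oo, (1 + r) / 2[%classic.
      by apply/seteqP; split => y; rewrite /below_half /= in_itv /=; lra.
    exact: measurable_itv.
  rewrite -(ge0_integralZl_EFin lebesgue_measure mD m0 mm (powR_ge0 _ _)).
  by apply: eq_integral => y _; rewrite /G /= BE -EFinM.
split.
  under eq_fun do rewrite JE.
  by apply: measurable_funTS; exact: (measurable_int_on _ D G mD G0 mG).
have -> : (\int[lebesgue_measure]_(r in D) (((1 - r) `^ (d - 1))%:E *
    \int[lebesgue_measure]_(y in D) (mean_density y * \1_(below_half r) y)%:E) =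
    \int[lebesgue_measure]_(r in D) \int[lebesgue_measure]_(y in D) G (r, y))%E.
  by apply: eq_integral => r _; exact: JE.
rewrite (tonelli_on lebesgue_measure lebesgue_measure D D G mD mD G0 mG).
apply: ge0_le_integral_all => y; first by move=> _; exact: integral_ge0.
move=> Dy; have y01 : 0 < y < 1 by move: Dy; rewrite /D /= in_itv.
have [y0 y1] := andP y01; have y1' : 0 < 1 - y by rewrite subr_gt0.
have y2 : 0 < 2 * (1 - y) by rewrite mulr_gt0.
have md0 := mean_density_ge0 y.
apply: (@le_trans _ _ ((mean_density y)%:E *
    \int[lebesgue_measure]_(r in near1 (2 * (1 - y))) ((1 - r) `^ (d - 1))%:E)%E).
  have mN := measurable_near1 (2 * (1 - y)).
  have N0 r : near1 (2 * (1 - y)) r -> (0 <= ((1 - r) `^ (d - 1))%:E :> \bar R)%E.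
    by move=> _; rewrite lee_fin; exact: powR_ge0.
  have mNf : measurable_fun (near1 (2 * (1 - y))) (fun r => ((1 - r) `^ (d - 1))%:E).
    by apply/measurable_EFinP; exact: measurable_powR_onem.
  rewrite -(ge0_integralZl_EFin lebesgue_measure mN N0 mNf md0).
  rewrite [leLHS]integral_mkcond [leRHS]integral_mkcond.
  apply: ge0_le_integral_all => r _; first by apply: erestrict_ge0 => s _; exact: G0.
  rewrite !patchE; case: ifPn => rD; last first.
    by case: ifPn => // _; rewrite mule_ge0 ?lee_fin//; exact: powR_ge0.
  rewrite /G /= BE indicE; case: (boolP (y \in below_half r)) => yr; last first.
    by rewrite !mulr0; case: ifPn => // _; rewrite mule_ge0 ?lee_fin//; exact: powR_ge0.
  rewrite mem_set; first by rewrite mulr1 -EFinM mulrC.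
  move: yr rD; rewrite !inE /below_half /near1 /D /= !in_itv /= => yr /andP[r0 r1].
  by split; [rewrite r1 ltW|lra].
apply: (@le_trans _ _ ((mean_density y)%:E * (C * (2 * (1 - y)) `^ d)%:E)%E).
  by apply: lee_wpmul2l; [rewrite lee_fin|exact: HC].
rewrite -!EFinM lee_fin (mean_densityE _ y01) (powRM d _ (ltW y1'))//.
have -> : (1 - y) `^ (k + d - 1) = (1 - y) `^ (k - 1) * (1 - y) `^ d.
  rewrite -powRD; last by rewrite (gt_eqF y1') implybT.
  by congr (_ `^ _); ring.
by rewrite le_eqVlt; apply/orP; left; apply/eqP; ring.
Qed.

End KernelEstimates.

Lemma carleson_bounded_fin (mu : {finite_measure set (measurableTypeR R) -> \bar R})
    (p q gam1 gam2 beta : R) : 1 <= p -> 0 < q ->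
  0 < gam1 -> 0 < gam2 -> 0 < beta -> gam2 < gam1 + beta ->
  carleson mu (beta + gam1 - gam2) ->
  bounded_mixed (cesaro_op mu beta) p%:E q%:E gam1 p%:E q%:E gam2.
Proof.
move=> p1 q0 g1 g2 b0 g21 muC; have p0 : 0 < p by rewrite (lt_le_trans ltr01).
(* Any value strictly between 0 and gam2 would do: positivity gives [d > 0], and [e < gam2] keeps
   the Carleson exponent below [a + beta]. Then [a] and [k] may be negative, which the estimates
   allow. *)
pose e := gam2 / 2; have e0 : 0 < e by rewrite divr_gt0.
pose a := gam1 - e; pose k := a * q; pose d := e * q.
have d0 : 0 < d by rewrite mulr_gt0.
have kd : k + d - 1 = gam1 * q - 1 by rewrite /k /d /a; ring.
have s0 : 0 < beta + gam1 - gam2 by lra.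
have sa : beta + gam1 - gam2 < a + beta by rewrite /a /e; lra.
have [CL CL0 HCL] := int_kernel_carleson mu _ _ s0 sa muC.
pose C1 : R := 2 * (1 + 2 `^ (k - 1)).
have C10 : 0 < C1 by rewrite mulr_gt0// ltr_wpDr// powR_ge0.
pose K := (4 * CL) `^ q * C1.
have K0 : 0 < K by rewrite mulr_gt0// powR_gt0// mulr_gt0.
suff [C C0 HC] : exists2 C : R, 0 < C & forall f, analytic_disc f ->
    (mixed_norm p%:E q%:E gam1 f < +oo)%E ->
    (\int[lebesgue_measure]_(r in D) (((1 - r) `^ (gam2 * q - 1))%:E *
       circle_mean p%:E (cesaro_op mu beta f) r `^ q) <=
    C%:E * \int[lebesgue_measure]_(x in D)
      ((1 - x) `^ (gam1 * q - 1) * pmean f p x `^ q)%:E)%E.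
  exists (C `^ q^-1); first by rewrite powR_gt0.
  move=> f [fa fI]; have I0 : (0 <= \int[lebesgue_measure]_(x in D)
      ((1 - x) `^ (gam1 * q - 1) * pmean f p x `^ q)%:E)%E.
    by apply: integral_ge0 => x _; rewrite lee_fin mulr_ge0//; exact: powR_ge0.
  rewrite (mixed_norm_pmean f p q gam1 fa p0) -poweR_EFin -poweRM//; last first.
    by rewrite lee_fin ltW.
  apply: gt0_ler_poweR; rewrite ?in_itv /= ?leey ?andbT.
  - by rewrite invr_ge0 ltW.
  - apply: integral_ge0 => r _; apply: mule_ge0; first by rewrite lee_fin powR_ge0.
    exact: poweR_ge0.
  - by rewrite mule_ge0// lee_fin ltW.
  - exact: HC.
have [C2 C20 HC2] := int_powR_near1 d d0.
exists (K * (C2 * 2 `^ d)).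
  by apply: mulr_gt0 => //; apply: mulr_gt0 => //; exact: powR_gt0.
move=> f fa fI.
set I := (\int[lebesgue_measure]_(x in D)
  ((1 - x) `^ (gam1 * q - 1) * pmean f p x `^ q)%:E)%E.
have I0 : (0 <= I)%E.
  by apply: integral_ge0 => x _; rewrite lee_fin mulr_ge0//; exact: powR_ge0.
have Ily : (I < +oo)%E.
  move: fI; rewrite (mixed_norm_pmean f p q gam1 fa p0) -/I.
  by apply: lty_poweRy; rewrite invr_eq0 gt_eqF.
pose J r := (\int[lebesgue_measure]_(y in D)
  (mean_density f p q k y * \1_(below_half r) y)%:E)%E.
have J0 r : (0 <= J r)%E.
  by apply: integral_ge0 => y _; rewrite lee_fin mulr_ge0//; exact: mean_density_ge0.
have [mJ JI] : measurable_fun D (fun r => ((1 - r) `^ (d - 1))%:E * J r)%E /\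
    (\int[lebesgue_measure]_(r in D) (((1 - r) `^ (d - 1))%:E * J r) <=
    (C2 * 2 `^ d)%:E * I)%E.
  by have := mean_density_fubini f p q k fa p1 d C2 d0 C20 HC2; rewrite kd.
have key r : D r -> (((1 - r) `^ (gam2 * q - 1))%:E *
    circle_mean p%:E (cesaro_op mu beta f) r `^ q <=
    K%:E * (((1 - r) `^ (d - 1))%:E * J r))%E.
  move=> Dr; have r01 : 0 < r < 1 by move: Dr; rewrite /D /= in_itv.
  have [r0 r1] := andP r01; have r1' : 0 < 1 - r by rewrite subr_gt0.
  have r01' : 0 <= r < 1 by rewrite ltW.
  have Jly : (J r < +oo)%E.
    apply: (le_lt_trans (mean_density_below f p q k fa p1 d r (ltW d0) r1)).
    rewrite kd -/I; apply: lte_mul_pinfty => //; rewrite lee_fin; exact: powR_ge0.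
  pose j := fine (J r).
  have jE : J r = j%:E by rewrite /j fineK// ge0_fin_numE.
  have j0 : 0 <= j by rewrite fine_ge0.
  (* With this choice [mean_density_mass] reads M_p(f, x) <= L (1 - x)^(-a) for all x <= r. *)
  pose L := (C1 * j) `^ q^-1.
  have L0 : 0 <= L by exact: powR_ge0.
  have Cj0 : 0 <= C1 * j by rewrite mulr_ge0// ltW.
  have Lq : L `^ q = C1 * j by rewrite /L -powRrM mulVf ?gt_eqF// powRr1.
  pose W := CL * (1 - r) `^ (beta + gam1 - gam2 - (a + beta)).
  have W0 : 0 < W by rewrite mulr_gt0// powR_gt0.
  have HL t : 0 <= t < 1 ->
      circ p f (t * r)%:C <= 2 * pi * (L * (1 - t * r) `^ (- a)) `^ p.
    move=> /andP[t0 t1]; have x0 : 0 <= t * r by rewrite mulr_ge0// ltW.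
    have xr : t * r <= r by rewrite ler_piMl// ltW.
    have x1' : 0 < 1 - t * r by rewrite subr_gt0 (le_lt_trans xr).
    have := mean_density_mass f p q k fa p1 q0 _ _ x0 xr r1.
    rewrite -/(J r) jE lee_fin -/C1 => mass.
    have x1a : 0 <= (1 - t * r) `^ (- a) by exact: powR_ge0.
    have h : pmean f p (t * r) <= L * (1 - t * r) `^ (- a).
      have La0 : 0 <= L * (1 - t * r) `^ (- a) by exact: mulr_ge0.
      have root y : 0 <= y -> y = (y `^ q) `^ q^-1.
        by move=> y0; rewrite -powRrM mulfV ?gt_eqF// powRr1.
      rewrite (root _ (pmean_ge0 f p (t * r))) (root _ La0).
      apply: ge0_ler_powR; rewrite ?nnegrE; [|exact: powR_ge0..|].
        by rewrite invr_ge0 ltW.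
      rewrite powRM// Lq -powRrM mulNr powRN -/k ler_pdivlMr ?powR_gt0//.
      by rewrite mulrC [leRHS]mulrC -ler_pdivrMr.
    have pi2 := @twopi_gt0 R.
    rewrite (circ_pmean f p _ p0) ler_pM2l//.
    apply: ge0_ler_powR; rewrite ?nnegrE; [exact: ltW|exact: pmean_ge0| |exact: h].
    exact: mulr_ge0.
  have := cesaro_circle_mean mu f beta p r a L W fa p1 r01' (ltW b0) W0 L0 HL (HCL r r01').
  move=> cm; have c0 := circle_mean_ge0 p%:E (cesaro_op mu beta f) r (ltW r0).
  have LW0 : 0 <= 4 * L * W by apply: mulr_ge0; [exact: mulr_ge0|exact: ltW].
  have cmq : (circle_mean p%:E (cesaro_op mu beta f) r `^ q <= ((4 * L * W) `^ q)%:E)%E.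
    rewrite -poweR_EFin; apply: gt0_ler_poweR => //; first exact: ltW.
      by rewrite in_itv /= leey andbT.
    by rewrite in_itv /= leey andbT lee_fin.
  apply: (@le_trans _ _ (((1 - r) `^ (gam2 * q - 1))%:E * ((4 * L * W) `^ q)%:E)%E).
    by apply: lee_wpmul2l => //; rewrite lee_fin; exact: powR_ge0.
  rewrite jE -!EFinM lee_fin.
  have -> : 4 * L * W = (4 * CL) * (L * (1 - r) `^ (beta + gam1 - gam2 - (a + beta))).
    by rewrite /W; ring.
  rewrite powRM; [|by rewrite mulr_ge0// ltW|by rewrite mulr_ge0//; exact: powR_ge0].
  rewrite [(L * _) `^ q]powRM; [|exact: L0|exact: powR_ge0].
  rewrite Lq -powRrM.
  have -> : (beta + gam1 - gam2 - (a + beta)) * q = d - gam2 * q by rewrite /d /a; ring.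
  have -> : (1 - r) `^ (gam2 * q - 1) *
      ((4 * CL) `^ q * (C1 * j * (1 - r) `^ (d - gam2 * q))) =
      (4 * CL) `^ q * C1 * ((1 - r) `^ (gam2 * q - 1) * (1 - r) `^ (d - gam2 * q) * j).
    by ring.
  rewrite -powRD; last by rewrite (gt_eqF r1') implybT.
  by have -> : gam2 * q - 1 + (d - gam2 * q) = d - 1 by ring.
apply: (@le_trans _ _ (\int[lebesgue_measure]_(r in D)
    (K%:E * (((1 - r) `^ (d - 1))%:E * J r)))%E).
  apply: ge0_le_integral_all => // r Dr.
  by apply: mule_ge0; [rewrite lee_fin; exact: powR_ge0|exact: poweR_ge0].
have dJ0 r : D r -> (0 <= ((1 - r) `^ (d - 1))%:E * J r)%E.
  by move=> _; rewrite mule_ge0// lee_fin; exact: powR_ge0.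
rewrite (ge0_integralZl_EFin lebesgue_measure mD dJ0 mJ (ltW K0)).
have -> : ((K * (C2 * 2 `^ d))%:E * I = K%:E * ((C2 * 2 `^ d)%:E * I))%E.
  by rewrite muleA -EFinM.
by apply: lee_wpmul2l => //; rewrite lee_fin ltW.
Qed.

End SufficiencyFin.

(** * The test functions *)

Section TestFunction.
Context {R : realType}.
Implicit Types (z w : R[i]) (r x t rho theta b : R) (n : nat).

(** An integer exponent avoids any choice of branch; how large it must be depends on the space
    tested. *)
Definition test_fun r n z : R[i] := ((1 - r%:C * z)^-1) ^+ n.

Lemma test_fun_analytic r n : 0 <= r <= 1 -> analytic_disc (test_fun r n).
Proof.
move=> r01 z z1.
have nz : 1 - r%:C * z != 0.
  rewrite -cmod_eq0 gt_eqF// (lt_le_trans _ (Re_le_cmod _))//.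
  by apply: Re1B_gt0; apply: cmod_scale_lt1.
have d1 : derivable (fun y : R[i]^o => 1 - r%:C * y : R[i]^o) z 1.
  have da : analytic_disc (fun y : R[i] => r%:C * y).
    by apply: analytic_scale => y _; exact: derivable_id.
  exact: (@derivableB _ R[i]^o R[i]^o (cst 1) _ z 1 (derivable_cst _ _ _) (da z z1)).
have d2 := @derivableV R[i] R[i]^o _ z 1 nz d1.
have := @derivableX R[i] R[i]^o _ n z 1 d2.
have -> // : ((fun y : R[i]^o => (1 - r%:C * y)^-1 : R[i]) ^+ n)%R = test_fun r n.
apply/funext => y; rewrite /test_fun.
by elim: n => [|n IH]; rewrite ?expr0// !exprS -IH.
Qed.

Lemma cmod_test_fun r n z : cmod (test_fun r n z) = (cmod (1 - r%:C * z)) ^- n.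
Proof. by rewrite /test_fun cmodX cmodV exprVn. Qed.

Lemma cmod_test_fun_le r n z : 0 <= r <= 1 -> cmod z < 1 ->
  cmod (test_fun r n z) <= (1 - r * cmod z) ^- n.
Proof.
move=> r01 z1; have [r0 r1] := andP r01.
have d0 : 0 < 1 - r * cmod z.
  by rewrite subr_gt0 -cmod_scale//; exact: cmod_scale_lt1.
have := cmod1B_ge (r%:C * z); rewrite cmod_scale// => h.
have d1 := lt_le_trans d0 h.
rewrite cmod_test_fun lef_pV2 ?posrE ?exprn_gt0//.
by apply: lerXn2r; rewrite ?nnegrE //; exact: ltW.
Qed.

Lemma sin_le theta : 0 <= theta -> `|sin theta| <= theta.
Proof.
rewrite le_eqVlt => /predU1P[<-|t0]; first by rewrite sin0 normr0.
have [|c _] := @MVT R sin cos 0 theta t0 (fun x _ => is_derive_sin x).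
  by apply: continuous_in_subspaceT => x _; exact: continuous_sin.
rewrite sin0 !subr0 => ->; rewrite normrM (gtr0_norm t0) ler_piMl ?(ltW t0)//.
exact: cos_max.
Qed.

Lemma onem_cos_le theta : 0 <= theta -> 1 - cos theta <= theta.
Proof.
rewrite le_eqVlt => /predU1P[<-|t0]; first by rewrite cos0 subrr.
have [|c _] := @MVT R cos (fun x => - sin x) 0 theta t0 (fun x _ => is_derive_cos x).
  by apply: continuous_in_subspaceT => x _; exact: continuous_cos.
rewrite cos0 subr0 => h; have -> : 1 - cos theta = sin c * theta by lra.
by rewrite ler_piMl ?(ltW t0)// sin_le1.
Qed.

(* Both factors of the integrand lie in a narrow sector around the positive
   axis when the argument of [z] is small compared with [1 - rho]. *)
Lemma sector_bounds s rho theta : 0 <= s <= 1 -> 0 <= rho < 1 -> 0 <= theta ->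
  let w := 1 - s%:C * (rho%:C * expi theta) in
  [/\ 1 - rho <= Re w, `|Im w| <= theta & cmod w <= 1 - s * rho + 2 * theta].
Proof.
move=> /andP[s0 s1] /andP[rho0 rho1] th0 w.
have sr0 : 0 <= s * rho by rewrite mulr_ge0.
have sr : s * rho <= rho by rewrite ler_piMl.
have sr1 : s * rho <= 1 by rewrite (le_trans sr)// ltW.
have wE : w = 1 - (s * rho)%:C * expi theta by rewrite /w rmorphM mulrA.
have rw : Re w = 1 - s * rho * cos theta.
  by rewrite wE ReB1 ReM Re_expi /= mul0r subr0.
have iw : Im w = - (s * rho * sin theta).
  by rewrite wE ImB1 ImM Im_expi /= mul0r addr0.
have h1 : s * rho * cos theta <= s * rho by rewrite ler_piMr// cos_le1.
have h2 : `|Im w| <= theta.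
  rewrite iw normrN normrM ger0_norm//.
  by rewrite (le_trans _ (sin_le _ th0))// ler_piMl.
split => //; first by rewrite rw; lra.
apply: (le_trans (cmod_le _)).
have rw0 : 0 <= Re w by rewrite rw; lra.
have h3 : s * rho * (1 - cos theta) <= theta.
  rewrite (le_trans _ (onem_cos_le _ th0))// ler_piMl// subr_ge0 cos_le1//.
rewrite ger0_norm// rw; rewrite rw in rw0; lra.
Qed.

(** Both factors are powers of some 1 - sz, with s = rt and s = t, so a single bound on the argument
    of 1 - sz controls the total phase. *)
Lemma test_integrandE r n b z t : cmod z < 1 -> 0 <= r <= 1 -> 0 <= t <= 1 ->
  let w1 := 1 - (r * t)%:C * z in let w2 := 1 - t%:C * z in
  Re (cesaro_integrand b (test_fun r n) z t) =
  (cmod w1) ^- n * (cmod w2) `^ (- b) *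
  cos (n%:R * atan (Im w1 / Re w1) + b * atan (Im w2 / Re w2)).
Proof.
move=> z1 r01 t01 w1 w2.
have [r0 r1] := andP r01; have [t0 t1] := andP t01.
have w1p : 0 < Re w1.
  by apply: Re1B_gt0; apply: cmod_scale_lt1 => //; rewrite mulr_ge0//= mulr_ile1.
have w2p : 0 < Re w2 by apply: Re1B_gt0; apply: cmod_scale_lt1.
have expiX m (s : R) : expi s ^+ m = expi (m%:R * s).
  elim: m => [|m IH]; first by rewrite expr0 mul0r expi0.
  by rewrite exprS IH -expiD -[m.+1%:R]natr1; congr expi; ring.
have expiV (s : R) : (expi s)^-1 = expi (- s).
  have h : expi s * expi (- s) = 1 by rewrite -expiD subrr expi0.
  have s0 : expi s != 0 by rewrite -cmod_eq0 cmod_expi oner_eq0.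
  by apply: (mulfI s0); rewrite h mulfV.
rewrite /cesaro_integrand -/w2 cpow_inv// /test_fun.
have -> : 1 - r%:C * (t%:C * z) = w1 by rewrite /w1 rmorphM mulrA.
rewrite [in X in Re (X * _)](polar_atan w1 w1p).
rewrite invfM expiV exprMn expiX -fmorphV -rmorphXn.
set p1 := atan _; set p2 := atan _.
have -> : ((cmod w1)^-1 ^+ n)%:C * expi (n%:R * - p1) *
    (((cmod w2) `^ (- b))%:C * expi (- (b * p2))) =
    ((cmod w1)^-1 ^+ n * (cmod w2) `^ (- b))%:C * expi (- (n%:R * p1 + b * p2)).
  rewrite rmorphM mulrACA -expiD; congr (_ * expi _); ring.
by rewrite ReM Re_expi /= mul0r subr0 cosN exprVn.
Qed.

Lemma cos_ge_cos1 (x : R) : `|x| <= 1 -> cos 1 <= cos x.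
Proof.
move=> x1; rewrite -[cos x]cos_norm leNgt; apply/negP.
have pi1 : 1 <= pi :> R by rewrite (le_trans _ (@pi_ge2 R))// ler1n.
have xpi : `|x| <= pi by rewrite (le_trans x1).
rewrite ltr_cos ?in_itv /= ?normr_ge0 ?ler01//= => x1'.
by have := le_lt_trans x1 x1'; rewrite ltxx.
Qed.

Variable mu : {finite_measure set (measurableTypeR R) -> \bar R}.

(** With e = 1 - r, the phase is at most (n + b) theta / (1 - rho) <= (e/4) / (e/2) < 1, so the real
    part of the integrand is nonnegative on all of [0, 1) and the integral may be restricted to [r,
    1). There both moduli are at most 3e + 2 theta <= 4e, which gives the power of 4e, and the
    cosine is at least cos 1. *)
Lemma cesaro_test_lower r n b rho theta : 0 < r < 1 -> 0 <= b ->
  r <= rho <= (1 + r) / 2 -> 0 <= theta ->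
  theta * (4 * (n%:R + b + 1)) <= 1 - r ->
  ((cos 1 * (4 * (1 - r)) `^ (- (n%:R + b)))%:E * mu `[r, 1%R[%classic <=
   (cmod (cesaro_op mu b (test_fun r n) (rho%:C * expi theta)))%:E)%E.
Proof.
move=> /andP[r0 r1] b0 /andP[rrho rhor] th0 thr.
pose e := 1 - r; have e0 : 0 < e by rewrite subr_gt0.
pose z := rho%:C * expi theta.
have rho0 : 0 <= rho by rewrite (le_trans _ rrho)// ltW.
have rho1 : rho < 1 by rewrite (le_lt_trans rhor)//; lra.
have zr : cmod z = rho by rewrite /z cmod_mul_expi cmodC ger0_norm.
have z1 : cmod z < 1 by rewrite zr.
have r01 : 0 <= r <= 1 by rewrite !ltW.
have nb0 : 0 <= n%:R + b by rewrite addr_ge0.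
have the : theta * 4 <= e.
  apply: le_trans thr; rewrite ler_wpM2l// -{1}[4]mulr1 ler_pM2l//.
  by rewrite lerDr.
have thnb : (n%:R + b) * theta <= e / 4.
  have : theta * (n%:R + b + 1) <= e / 4.
    by rewrite ler_pdivlMr// -mulrA [_ * 4]mulrC.
  by rewrite mulrDr mulr1 mulrC; lra.
have rhoe : e / 2 <= 1 - rho by rewrite /e; lra.
have [cR _] := cesaro_integrand_cont b _ _ (test_fun_analytic r n r01) z1.
pose F t := Re (cesaro_integrand b (test_fun r n) z t).
have mD : measurable (`[0, 1[%classic : set (measurableTypeR R)) by exact: measurable_itv.
have mA : measurable (`[r, 1[%classic : set (measurableTypeR R)) by exact: measurable_itv.
pose c := cos 1 * (4 * e) `^ (- (n%:R + b)).
have c0 : 0 <= c by rewrite mulr_ge0 ?powR_ge0// ltW// cos1_gt0.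
have e40 : 0 < 4 * e by rewrite mulr_gt0.
have sect s : 0 <= s <= 1 -> let w := 1 - s%:C * z in
    [/\ 0 < Re w, `|atan (Im w / Re w)| <= theta / (1 - rho) & cmod w <= 1 - s * rho + 2 * theta].
  move=> s01 w; have [|h1 h2 h3] := sector_bounds s rho theta s01 _ th0.
    by rewrite rho0.
  have w0 : 0 < Re w by rewrite (lt_le_trans _ h1)// subr_gt0.
  split=> //; apply: (le_trans (norm_atan_le _)).
  rewrite normrM normfV (gtr0_norm w0) ler_pM ?invr_ge0 ?(ltW w0)//.
  by rewrite lef_pV2 ?posrE// subr_gt0.
have phase s1 s2 : 0 <= s1 <= 1 -> 0 <= s2 <= 1 ->
    let w1 := 1 - s1%:C * z in let w2 := 1 - s2%:C * z in
    cos 1 <= cos (n%:R * atan (Im w1 / Re w1) + b * atan (Im w2 / Re w2)).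
  move=> s1P s2P /=; apply: cos_ge_cos1.
  have [_ a1 _] := sect s1 s1P; have [_ a2 _] := sect s2 s2P.
  apply: (le_trans (ler_normD _ _)); rewrite !normrM (ger0_norm b0) ger0_norm//.
  apply: (@le_trans _ _ ((n%:R + b) * (theta / (1 - rho)))).
    by rewrite mulrDl lerD// ler_wpM2l.
  rewrite mulrA ler_pdivrMr ?subr_gt0// mul1r (le_trans thnb)// (le_trans _ rhoe)//; lra.
have itv t : 0 <= t <= 1 -> 0 <= r * t <= 1.
  by move=> /andP[t0 t1]; rewrite mulr_ge0 ?(ltW r0)//= mulr_ile1// ltW.
have F0 t : 0 <= t <= 1 -> 0 <= F t.
  move=> t01; rewrite /F test_integrandE//.
  have := phase _ _ (itv t t01) t01; rewrite /= => ph.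
  rewrite !mulr_ge0 ?powR_ge0 ?invr_ge0 ?exprn_ge0 ?cmod_ge0//.
  by rewrite (le_trans _ ph)// ltW// cos1_gt0.
have Fc t : r <= t -> t < 1 -> c <= F t.
  move=> rt t1; have t0 : 0 <= t by rewrite (le_trans _ rt)// ltW.
  have t01 : 0 <= t <= 1 by rewrite t0 ltW.
  rewrite /F test_integrandE//.
  have := phase _ _ (itv t t01) t01; rewrite /= => ph.
  have [w1p _ w1b] := sect _ (itv t t01); have [w2p _ w2b] := sect _ t01.
  set w1 := 1 - (r * t)%:C * z in w1p w1b ph *; set w2 := 1 - t%:C * z in w2p w2b ph *.
  have r2 : r * r <= t * rho by rewrite ler_pM// ltW.
  have r3 : r * (r * r) <= r * t * rho by rewrite -mulrA ler_pM2l.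
  have rr1 : 1 - r * r <= 2 * e by rewrite /e; nra.
  have rr2 : 1 - r * (r * r) <= 3 * e.
    have -> : 1 - r * (r * r) = e * (1 + r + r * r) by rewrite /e; ring.
    rewrite mulrC ler_pM2r//.
    have : r * r <= 1 by rewrite mulr_ile1// ltW.
    lra.
  have w1e : cmod w1 <= 4 * e by rewrite (le_trans w1b)//; lra.
  have w2e : cmod w2 <= 4 * e by rewrite (le_trans w2b)//; lra.
  have w10 : 0 < cmod w1 by rewrite (lt_le_trans w1p)// Re_le_cmod.
  have w20 : 0 < cmod w2 by rewrite (lt_le_trans w2p)// Re_le_cmod.
  have -> : c = (4 * e) ^- n * (4 * e) `^ (- b) * cos 1.
    rewrite /c opprD powRD; last by rewrite (gt_eqF e40) implybT.
    by rewrite powR_invn ?(ltW e40)// mulrC.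
  apply: ler_pM; rewrite ?(ltW (cos1_gt0 _))//.
    by apply: mulr_ge0; [rewrite invr_ge0 exprn_ge0// ltW|exact: powR_ge0].
  apply: ler_pM; rewrite ?powR_ge0// ?invr_ge0 ?exprn_ge0 ?(ltW e40)//.
    rewrite lef_pV2 ?posrE ?exprn_gt0//; apply: lerXn2r; rewrite ?nnegrE//; exact: ltW.
  rewrite !powRN lef_pV2 ?posrE ?powR_gt0//.
  by apply: ge0_ler_powR; rewrite ?nnegrE//; exact: ltW.
have ReT : (Re (cesaro_op mu b (test_fun r n) z))%:E =
    (\int[mu]_(t in `[0%R, 1%R[%classic) (F t)%:E)%E.
  by rewrite (seg_cont_int_fin mu F cR).
rewrite -/z; apply: (@le_trans _ _ (Re (cesaro_op mu b (test_fun r n) z))%:E); last first.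
  by rewrite lee_fin Re_le_cmod.
rewrite ReT -/e -/c.
have AD : (`[r, 1[%classic : set R) `<=` `[0, 1[%classic.
  by move=> t; rewrite /= !in_itv /= => /andP[rt ->]; rewrite (le_trans _ rt)// ltW.
apply: (@le_trans _ _ (\int[mu]_(t in `[0%R, 1%R[%classic) (c%:E * (\1_(`[r, 1[%classic) t)%:E))%E).
  have m1 : measurable_fun (`[0, 1[%classic : set (measurableTypeR R))
      (fun t => (\1_(`[r, 1[%classic) t)%:E : \bar R).
    by apply/measurable_EFinP; apply: measurable_funTS; exact: measurable_indic.
  rewrite ge0_integralZl_EFin//.
  by rewrite integral_indic// setIidl.
apply: ge0_le_integral_all => t; first by move=> _; rewrite mule_ge0// lee_fin.
rewrite /= in_itv /= => /andP[t0 t1]; rewrite -EFinM lee_fin indicE.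
case: (boolP (t \in _)) => [|_]; last by rewrite mulr0 F0// t0 ltW.
by rewrite inE /= in_itv /= mulr1 => /andP[rt _]; exact: Fc.
Qed.

End TestFunction.

(** * Norms of the test functions *)

Section TestNorm.
Context {R : realType}.
Implicit Types (z w : R[i]) (r x t rho theta b s p q : R) (n : nat).

Lemma onem_mul_ge r rho : 0 <= r <= 1 -> 0 <= rho <= 1 ->
  1 - r <= 1 - r * rho /\ 1 - rho <= 1 - r * rho.
Proof. by move=> /andP[r0 r1] /andP[t0 t1]; split; nra. Qed.

Lemma le_powR_neg (x y k : R) : 0 < x -> x <= y -> k <= 0 -> y `^ k <= x `^ k.
Proof.
move=> x0 xy k0; have y0 := lt_le_trans x0 xy.
rewrite -[k]opprK (powRN y) (powRN x) lef_pV2 ?posrE ?powR_gt0//.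
by apply: ge0_ler_powR; rewrite ?nnegrE ?oppr_ge0// ltW.
Qed.

Lemma mixed_norm_inf_test r n (g : R) : 0 < r < 1 -> 0 <= g <= n%:R ->
  (mixed_norm +oo%E +oo%E g (test_fun r n) <= ((1 - r) `^ (g - n%:R))%:E)%E.
Proof.
move=> /andP[r0 r1] /andP[g0 gn].
apply: ge_ereal_sup => _ [rho /= + <-]; rewrite in_itv /= => /andP[t0 t1].
have r01 : 0 <= r <= 1 by rewrite !ltW.
have t01 : 0 <= rho <= 1 by rewrite !ltW.
have [h1 h2] := onem_mul_ge _ _ r01 t01.
have e0 : 0 < 1 - r by rewrite subr_gt0.
have y0 := lt_le_trans e0 h1.
have x0 : 0 < 1 - rho by rewrite subr_gt0.
apply: (@le_trans _ _ (((1 - rho) `^ g)%:E * ((1 - r * rho) ^- n)%:E)%E).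
  apply: lee_wpmul2l; first by rewrite lee_fin powR_ge0.
  apply: ge_ereal_sup => _ [z /= zr <-]; rewrite lee_fin -zr.
  by apply: cmod_test_fun_le => //; rewrite zr.
rewrite -EFinM lee_fin; apply: (@le_trans _ _ ((1 - r * rho) `^ (g - n%:R))).
  rewrite powRD; last by rewrite (gt_eqF y0) implybT.
  rewrite powR_invn ?(ltW y0)// ler_wpM2r ?invr_ge0 ?exprn_ge0 ?(ltW y0)//.
  by apply: ge0_ler_powR; rewrite ?nnegrE//; exact: ltW.
by apply: le_powR_neg => //; rewrite subr_le0.
Qed.

Lemma Re_inv z : Re z^-1 = Re z / cmod z ^+ 2.
Proof.
have [->|z0] := eqVneq z 0; first by rewrite invr0 /= mul0r.
have c0 : cmod z ^+ 2 != 0 by rewrite expf_eq0 /= cmod_eq0.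
have c0' : (cmod z ^+ 2)%:C != 0 :> R[i] by rewrite -cmod_eq0 cmodC normr_eq0.
have -> : z^-1 = (cmod z ^- 2)%:C * (Re z -i* Im z).
  apply: (mulfI z0); rewrite mulfV//.
  apply/eqP; rewrite eq_complex ReM ImM !ReM !ImM /= !mul0r.
  have e := cmod_sqr z; rewrite subr0 addr0 !mulrN opprK.
  apply/andP; split; apply/eqP; last by ring.
  have -> : Re z * (cmod z ^- 2 * Re z) + Im z * (cmod z ^- 2 * Im z) =
      cmod z ^- 2 * (Re z ^+ 2 + Im z ^+ 2) by ring.
  by rewrite -e mulVf.
by rewrite ReM /= mul0r subr0 mulrC.
Qed.

(** The Poisson kernel is the real part of (1 + w)/(1 - w). Being the real part of an analytic
    function with value 1 at the centre, it has mean 1. *)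
Lemma poisson_kernelE w : cmod w < 1 ->
  (1 - cmod w ^+ 2) / cmod (1 - w) ^+ 2 = 2 * Re (1 - w)^-1 - 1.
Proof.
move=> w1; have d0 : 0 < cmod (1 - w).
  by rewrite (lt_le_trans (Re1B_gt0 _ w1))// Re_le_cmod.
rewrite Re_inv; have c0 : cmod (1 - w) != 0 by rewrite gt_eqF.
apply: (mulIf (x := cmod (1 - w) ^+ 2)); first by rewrite expf_neq0.
rewrite mulfVK ?expf_neq0// mulrBl mul1r -mulrA divfK ?expf_neq0//.
by rewrite !cmod_sqr ReB1 ImB1; ring.
Qed.

Lemma poisson_mean s : 0 <= s < 1 ->
  seg_cont (fun t => 2 * Re (1 - s%:C * expi t)^-1 - 1) 0 (2 * pi) /\
  seg_int (fun t => 2 * Re (1 - s%:C * expi t)^-1 - 1) 0 (2 * pi) = 2 * pi.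
Proof.
move=> /andP[s0 s1].
have fa : analytic_disc (@test_fun R 1 1) by apply: test_fun_analytic; rewrite ler01 lexx.
have fE w : test_fun 1 1 w = (1 - w)^-1 by rewrite /test_fun expr1 mul1r.
have c1 : seg_cont (fun t => Re (1 - s%:C * expi t)^-1) 0 (2 * pi).
  move=> t _; have [h1 h2] := @cvg_polar R _ (nbhs t) _ (fun=> s%:C) id s%:C t
    (cvg_cst _) (cvg_cst _) cvg_id.
  have sc : cmod (s%:C * expi t) < 1 by rewrite cmod_mul_expi cmodC ger0_norm.
  have [h _] := analytic_cvg _ _ _ _ _ fa sc h1 h2.
  have -> : (fun t => Re (1 - s%:C * expi t)^-1) =
    (fun t => Re (test_fun 1 1 (s%:C * expi t))) by apply/funext => u; rewrite fE.
  exact: h.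
have c2 : seg_cont (fun t => 2 * Re (1 - s%:C * expi t)^-1) 0 (2 * pi) by exact: seg_contZ.
split; first by move=> t t01; apply: cvgB; [exact: c2|exact: cvg_cst].
have pi2 := @twopi_gt0 R.
rewrite seg_intB//; last exact: seg_cont_cst.
rewrite seg_intZ// seg_int_cst ?(ltW pi2)// subr0 mul1r.
have sc : cmod (0 : R[i]) + s < 1 by rewrite cmod0 add0r.
have := mean_value _ fa 0 s s0 sc; rewrite fE subr0 invr1 /= mulr1.
have -> : (fun t => Re (test_fun 1 1 (0 + s%:C * expi t))) =
          (fun t => Re (1 - s%:C * expi t)^-1).
  by apply/funext => t; rewrite fE add0r.
by move=> ->; ring.
Qed.

(** Put s = r rho and |w| = s. Two of the np factors |1 - w|^(-1) are kept for the Poisson kernel,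
    which costs 1 / (1 - s^2); the others are at most (1 - s)^(-1) each. As 1 - s <= 1 - s^2, the
    exponent is 1 - np. *)
Lemma circ_test_le r rho n p : 0 <= r < 1 -> 0 <= rho < 1 -> 0 < p -> 2 <= n%:R * p ->
  circ p (test_fun r n) rho%:C <= 2 * pi * (1 - r * rho) `^ (1 - n%:R * p).
Proof.
move=> /andP[r0 r1] /andP[t0 t1] p0 np.
have s0 : 0 <= r * rho by rewrite mulr_ge0.
have s1 : r * rho < 1 by rewrite (le_lt_trans _ t1)// ler_piMl// ltW.
have y0 : 0 < 1 - r * rho by rewrite subr_gt0.
have s01 : 0 <= r * rho < 1 by rewrite s0.
have [pc pI] := poisson_mean _ s01.
rewrite mulrC -pI -seg_intZ//; apply: le_seg_int.
- move=> t _; apply: circ_integrand_cont => //.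
    by apply: test_fun_analytic; rewrite r0 ltW.
  by rewrite cmodC ger0_norm.
- exact: seg_contZ.
move=> t _; rewrite cmod_test_fun.
have -> : r%:C * (rho%:C * expi t) = (r * rho)%:C * expi t by rewrite rmorphM mulrA.
set w := _ * expi t.
have ws : cmod w = r * rho by rewrite cmod_mul_expi cmodC ger0_norm.
have w1 : cmod w < 1 by rewrite ws.
rewrite -poisson_kernelE//.
have yd := cmod1B_ge w; rewrite ws in yd.
set d := cmod (1 - w) in yd *; have d0 := lt_le_trans y0 yd.
rewrite -powR_invn ?(ltW d0)// -powRrM mulNr ws.
have -> : d `^ (- (n%:R * p)) = d `^ (2 - n%:R * p) / d ^+ 2.
  rewrite -powR_invn ?(ltW d0)// -powRD; last by rewrite (gt_eqF d0) implybT.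
  by congr (_ `^ _); ring.
rewrite mulrA ler_wpM2r ?invr_ge0 ?exprn_ge0 ?(ltW d0)//.
apply: (@le_trans _ _ ((1 - r * rho) `^ (2 - n%:R * p))).
  by apply: le_powR_neg => //; rewrite subr_le0.
have -> : 2 - n%:R * p = (1 - n%:R * p) + 1 by ring.
rewrite [leLHS]powRD; last by rewrite (gt_eqF y0) implybT.
rewrite powRr1 ?(ltW y0)// ler_wpM2l ?powR_ge0//.
by rewrite lerD2l lerN2 expr2 ler_piMl// ltW.
Qed.

End TestNorm.

(** * Necessity *)

Section Necessity.
Context {R : realType}.
Variable mu : {finite_measure set (measurableTypeR R) -> \bar R}.
Implicit Types (f h : R[i] -> R[i]) (z w : R[i]) (r x t rho theta b s p q : R) (n : nat).

Lemma tail_finE r : exists2 m : R, 0 <= m & mu `[r, 1%R[%classic = m%:E.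
Proof.
have mA : measurable (`[r, 1[%classic : set (measurableTypeR R)) by exact: measurable_itv.
have fm : mu `[r, 1%R[%classic \is a fin_num by exact: fin_num_measure.
exists (fine (mu `[r, 1%R[%classic)); first by rewrite fine_ge0.
by rewrite fineK.
Qed.

Lemma ge0_le_poweR (x y : \bar R) (k : R) : 0 <= k -> (0 <= x)%E -> (x <= y)%E ->
  (x `^ k <= y `^ k)%E.
Proof.
move=> k0 x0 xy; apply: gt0_ler_poweR => //; rewrite in_itv /= leey andbT//.
exact: le_trans xy.
Qed.

(** Common end of both necessity arguments: the powers (1 - r)^(-n) on the two sides cancel, so the
    resulting exponent does not depend on [n]. *)
Lemma carleson_from_lower n b (g1 g2 C : R) : 0 < C ->
  (forall r, 0 < r < 1 -> ((((1 - r) `^ g2)%:E *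
     ((cos 1 * (4 * (1 - r)) `^ (- (n%:R + b)))%:E * mu `[r, 1%R[%classic)) <=
     (C * (1 - r) `^ (g1 - n%:R))%:E)%E) ->
  carleson mu (b + g1 - g2).
Proof.
move=> C0 H; have c10 := cos1_gt0 R.
exists (C * 4 `^ (n%:R + b) / cos 1).
  by rewrite divr_gt0// mulr_gt0// powR_gt0.
move=> r r01; have := H r r01; have [m m0 ->] := tail_finE r.
have [_ r1] := andP r01; have e0 : 0 < 1 - r by rewrite subr_gt0.
rewrite -!EFinM !lee_fin; set e := 1 - r in e0 *.
rewrite powRM ?(ltW e0)// !powRN.
have -> : b + g1 - g2 = (g1 - n%:R) + ((n%:R + b) - g2) by ring.
have ee : (e == 0) = false by rewrite gt_eqF.
rewrite [e `^ (_ + (_ - g2))]powRD ?ee ?implybT// [e `^ (_ + b - g2)]powRD ?ee ?implybT//.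
rewrite [e `^ (- g2)]powRN.
set E1 := e `^ (g1 - _); set E2 := e `^ g2; set E3 := e `^ (_ + b); set E4 := 4 `^ _ => h.
have E20 : 0 < E2 by exact: powR_gt0.
have E30 : 0 < E3 by exact: powR_gt0.
have E40 : 0 < E4 by exact: powR_gt0.
have q0 : 0 < E2^-1 * ((cos 1)^-1 * (E4 * E3)).
  by rewrite !(mulr_gt0, invr_gt0).
have := ler_wpM2r (ltW q0) h.
rewrite (_ : E2 * (cos 1 * (E4^-1 * E3^-1) * m) * _ = m); last first.
  by field; rewrite !gt_eqF.
by rewrite (_ : C * E1 * _ = C * E4 / cos 1 * (E1 * (E3 / E2)))//; ring.
Qed.

(** For the sup norm the single point z = r is enough, that is rho = r and theta = 0. *)
Lemma bounded_inf_carleson (g1 g2 b : R) : 0 < g1 -> 0 <= b ->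
  bounded_mixed (cesaro_op mu b) +oo%E +oo%E g1 +oo%E +oo%E g2 ->
  carleson mu (b + g1 - g2).
Proof.
move=> g10 b0 [C C0 HC].
pose n := Num.bound g1; have gn : g1 <= n%:R by rewrite ltW// archi_boundP// ltW.
apply: (carleson_from_lower n b g1 g2 C C0) => r r01; have [r0 r1] := andP r01.
have r01' : 0 <= r <= 1 by rewrite !ltW.
have fa := test_fun_analytic r n r01'.
have fn := mixed_norm_inf_test r n g1 r01; rewrite (ltW g10) gn in fn.
have := HC (test_fun r n) (conj fa (le_lt_trans (fn isT) (ltry _))).
move=> h; apply: (le_trans _ (le_trans h _)); last first.
  by rewrite EFinM; apply: lee_wpmul2l; [rewrite lee_fin ltW|exact: fn].
apply: (@le_trans _ _ (((1 - r) `^ g2)%:E *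
    circle_mean +oo%E (cesaro_op mu b (test_fun r n)) r)%E); last first.
  by apply: ereal_sup_ubound; exists r => //=; rewrite in_itv.
apply: lee_wpmul2l; first by rewrite lee_fin powR_ge0.
apply: (le_trans (cesaro_test_lower mu r n b r 0 r01 b0 _ (lexx _) _)).
- by rewrite lexx; lra.
- by rewrite mul0r subr_ge0 ltW.
apply: ereal_sup_ubound; exists (r%:C * expi 0) => //=.
by rewrite cmod_mul_expi cmodC gtr0_norm.
Qed.

Lemma circle_mean_lower p h rho (d m : R) : 0 < p -> 0 <= d <= 2 * pi -> 0 <= m ->
  (forall theta, 0 <= theta <= d -> m <= cmod (h (rho%:C * expi theta))) ->
  (((d / (2 * pi)) `^ p^-1 * m)%:E <= circle_mean p%:E h rho)%E.
Proof.
move=> p0 /andP[d0 dpi] m0 H.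
have pi2 := @twopi_gt0 R.
have -> : (d / (2 * pi)) `^ p^-1 * m = (m `^ p / (2 * pi) * d) `^ p^-1.
  have {1}-> : m = (m `^ p) `^ p^-1 by rewrite -powRrM mulfV ?gt_eqF// powRr1.
  rewrite -powRM ?powR_ge0//; last by rewrite divr_ge0// ltW.
  by congr (_ `^ _); ring.
have A0 : 0 <= m `^ p / (2 * pi) by rewrite divr_ge0 ?powR_ge0// ltW.
rewrite /circle_mean -poweR_EFin; apply: ge0_le_poweR.
- by rewrite invr_ge0 ltW.
- by rewrite lee_fin mulr_ge0.
have mD : measurable (`[0, 2 * pi]%classic : set (measurableTypeR R)) by exact: measurable_itv.
have mA : measurable (`[0, d]%classic : set (measurableTypeR R)) by exact: measurable_itv.
have AD : (`[0, d]%classic : set R) `<=` `[0, 2 * pi]%classic.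
  by move=> t; rewrite /= !in_itv /= => /andP[-> td]; rewrite (le_trans td).
have lA : @lebesgue_measure R `[0%R, d]%classic = d%:E.
  rewrite lebesgue_measure_itv /= lte_fin; case: ltP => [_|dl]; first by rewrite sube0.
  by congr EFin; apply/eqP; rewrite eq_le d0 dl.
rewrite EFinM -lA.
apply: (@le_trans _ _ (\int[lebesgue_measure]_(t in `[0%R, (2 * pi)%R]%classic)
    ((m `^ p / (2 * pi))%:E * (\1_(`[0, d]%classic) t)%:E))%E).
  have m1 : measurable_fun (`[0, 2 * pi]%classic : set (measurableTypeR R))
      (fun t => (\1_(`[0, d]%classic) t)%:E : \bar R).
    by apply/measurable_EFinP; apply: measurable_funTS; exact: measurable_indic.
  rewrite ge0_integralZl_EFin//.
  by rewrite integral_indic// setIidl.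
apply: ge0_le_integral_all => t _; first by rewrite mule_ge0// lee_fin.
rewrite -EFinM lee_fin indicE; case: (boolP (t \in _)) => [|_]; last first.
  by rewrite mulr0 divr_ge0 ?powR_ge0// ltW.
rewrite inE /= in_itv /= mulr1 => td; rewrite cexp_expi.
rewrite ler_wpM2r ?invr_ge0 ?(ltW pi2)//.
by apply: ge0_ler_powR; rewrite ?nnegrE ?cmod_ge0//; [exact: ltW|exact: H].
Qed.

(** For r <= rho <= (1 + r)/2 the weight is comparable to (1 - r)^(gq - 1); the radial width (1 -
    r)/2 supplies the missing power, so that the q-th root gives (1 - r)^g. *)
Lemma mixed_norm_lower p q (g : R) h r (d m : R) : 0 < p -> 0 < q -> 0 < r < 1 ->
  0 <= d <= 2 * pi -> 0 <= m ->
  (forall rho theta, r <= rho <= (1 + r) / 2 -> 0 <= theta <= d ->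
    m <= cmod (h (rho%:C * expi theta))) ->
  (((1 - r) `^ g * (2 * (1 + 2 `^ (g * q - 1))) `^ (- q^-1) *
    ((d / (2 * pi)) `^ p^-1 * m))%:E <= mixed_norm p%:E q%:E g h)%E.
Proof.
move=> p0 q0 /andP[r0 r1] d01 m0 H.
set B := _ `^ p^-1 * m; have B0 : 0 <= B by rewrite mulr_ge0// powR_ge0.
set k := g * q - 1; pose e := 1 - r; have e0 : 0 < e by rewrite subr_gt0.
pose K := 1 + 2 `^ k : R; have K0 : 0 < K by rewrite ltr_wpDr// powR_ge0.
have qV : 0 <= q^-1 by rewrite invr_ge0 ltW.
pose c := e `^ k / K * B `^ q; have c0 : 0 <= c.
  by rewrite mulr_ge0 ?powR_ge0// divr_ge0 ?powR_ge0// ltW.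
have -> : (1 - r) `^ g * (2 * (1 + 2 `^ k)) `^ (- q^-1) * B = (c * (e / 2)) `^ q^-1.
  have -> : c * (e / 2) = e `^ (g * q) * (2 * K)^-1 * B `^ q.
    rewrite /c; have -> : g * q = k + 1 by rewrite /k; ring.
    rewrite [in RHS]powRD; last by rewrite (gt_eqF e0) implybT.
    by rewrite powRr1 ?(ltW e0)//; field; rewrite gt_eqF.
  have K2 : 0 <= (2 * K)^-1 by rewrite invr_ge0 mulr_ge0// ltW.
  have mqV (x : R) : x * q * q^-1 = x by rewrite mulfK ?gt_eqF.
  have mqB : (B `^ q) `^ q^-1 = B by rewrite -powRrM mulfV ?gt_eqF// powRr1.
  rewrite (@powRM _ (_ * _) (B `^ q)) ?powR_ge0//; last by apply: mulr_ge0 => //; exact: powR_ge0.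
  rewrite mqB (@powRM _ (e `^ _)) ?powR_ge0// -powRrM mqV; congr (_ * _ * _).
  rewrite -[(2 * K)^-1]powR_inv1 -?powRrM ?mulN1r//.
  by rewrite mulr_ge0// ltW.
rewrite /mixed_norm -poweR_EFin; apply: ge0_le_poweR => //.
- by rewrite lee_fin mulr_ge0// divr_ge0// ltW.
have mD : measurable (`]0, 1[%classic : set (measurableTypeR R)) by exact: measurable_itv.
have mA : measurable (`[r, (1 + r) / 2]%classic : set (measurableTypeR R)) by exact: measurable_itv.
have AD : (`[r, (1 + r) / 2]%classic : set R) `<=` `]0, 1[%classic.
  move=> t; rewrite /= !in_itv /= => /andP[h1 h2].
  by rewrite (lt_le_trans r0 h1)/= (le_lt_trans h2)//; lra.
have lA : @lebesgue_measure R `[r, ((1 + r) / 2)%R]%classic = (e / 2)%:E.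
  rewrite lebesgue_measure_itv /= lte_fin ifT; last by lra.
  by rewrite -EFinB; congr EFin; rewrite /e; lra.
rewrite EFinM -lA.
apply: (@le_trans _ _ (\int[lebesgue_measure]_(t in `]0%R, 1%R[%classic)
    (c%:E * (\1_(`[r, (1 + r) / 2]%classic) t)%:E))%E).
  have m1 : measurable_fun (`]0, 1[%classic : set (measurableTypeR R))
      (fun t => (\1_(`[r, (1 + r) / 2]%classic) t)%:E : \bar R).
    by apply/measurable_EFinP; apply: measurable_funTS; exact: measurable_indic.
  rewrite ge0_integralZl_EFin//.
  by rewrite integral_indic// setIidl.
apply: ge0_le_integral_all => t _; first by rewrite mule_ge0// lee_fin.
rewrite indicE; case: (boolP (t \in _)) => [|_]; last first.
  by rewrite mule0 mule_ge0 ?poweR_ge0// lee_fin powR_ge0.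
rewrite inE /= in_itv /= mule1 => rt.
have [rt1 rt2] := andP rt.
have cm : (B%:E <= circle_mean p%:E h t)%E.
  by apply: circle_mean_lower => // theta td; exact: H.
rewrite /c EFinM; apply: lee_pmul; rewrite ?lee_fin ?powR_ge0 ?divr_ge0 ?powR_ge0 ?(ltW K0)//.
  rewrite ler_pdivrMr// mulrC; apply: powR_half => //.
  by rewrite /e; apply/andP; split; lra.
rewrite -poweR_EFin; apply: ge0_le_poweR => //; first exact: ltW.
Qed.

End Necessity.

(** * Necessity for finite p and q *)

Section NecessityFin.
Context {R : realType}.
Variable mu : {finite_measure set (measurableTypeR R) -> \bar R}.
Implicit Types (f h : R[i] -> R[i]) (z w : R[i]) (r x t rho theta b s p q : R) (n : nat).

Lemma pmean_test_le r x n p : 0 <= r < 1 -> 0 <= x < 1 -> 0 < p -> 2 <= n%:R * p ->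
  pmean (test_fun r n) p x <= (1 - r * x) `^ (p^-1 - n%:R).
Proof.
move=> r01 x01 p0 np; have pi2 := @twopi_gt0 R.
have -> : p^-1 - n%:R = (1 - n%:R * p) * p^-1 by field; rewrite gt_eqF.
rewrite powRrM /pmean; apply: ge0_ler_powR; rewrite ?nnegrE ?powR_ge0//.
- by rewrite invr_ge0 ltW.
- by rewrite divr_ge0 ?circ_ge0// ltW.
- by rewrite ler_pdivrMr// mulrC; exact: circ_test_le.
Qed.

(** By [pmean_test_le] the q-th power of the norm is at most a kernel integral with exponents gq and
    (n - 1/p) q; the condition g + 1/p < n puts it in the range of [int_kernel_lebesgue]. *)
Lemma mixed_norm_test n p q (g : R) : 0 < p -> 0 < q -> 0 < g ->
  2 <= n%:R * p -> g + p^-1 < n%:R ->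
  exists2 K : R, 0 < K & forall r, 0 < r < 1 ->
    (mixed_norm p%:E q%:E g (test_fun r n) <=
     (K * (1 - r) `^ (g - n%:R + p^-1))%:E)%E.
Proof.
move=> p0 q0 g0 np gn.
have al0 : 0 < g * q by rewrite mulr_gt0.
have alb : g * q < (n%:R - p^-1) * q by rewrite ltr_pM2r//; lra.
have [K K0 HK] := int_kernel_lebesgue _ _ al0 alb.
exists (K `^ q^-1); first exact: powR_gt0.
move=> r /andP[r0 r1]; have e0 : 0 < 1 - r by rewrite subr_gt0.
have r01 : 0 <= r < 1 by rewrite ltW.
rewrite mixed_norm_pmean//; last by apply: test_fun_analytic; rewrite !ltW.
have -> : K `^ q^-1 * (1 - r) `^ (g - n%:R + p^-1) =
    (K * (1 - r) `^ (g * q - (n%:R - p^-1) * q)) `^ q^-1.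
  rewrite powRM ?powR_ge0 ?(ltW K0)// -powRrM; congr (_ * _ `^ _).
  by field; rewrite !gt_eqF.
rewrite -poweR_EFin; apply: ge0_le_poweR; first by rewrite invr_ge0 ltW.
  by apply: integral_ge0 => t _; rewrite lee_fin mulr_ge0// powR_ge0.
apply: le_trans (HK r r01).
have mf : measurable_fun (`[0, 1[%classic : set (measurableTypeR R))
    (fun t : measurableTypeR R => ((1 - t) `^ (g * q - 1) *
       (1 - t * r) `^ (- ((n%:R - p^-1) * q)))%:E).
  apply/measurable_EFinP; apply: measurable_funM; first exact: measurable_powR_onem.
  apply: (measurableT_comp (measurable_powR _)).
  by apply: measurable_funB => //; apply: measurable_funM.
apply: (@le_trans _ _ (\int[lebesgue_measure]_(t in `]0%R, 1%R[%classic)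
   ((1 - t) `^ (g * q - 1) * (1 - t * r) `^ (- ((n%:R - p^-1) * q)))%:E)%E); last first.
  apply: ge0_subset_integral => //.
  - by move=> t _; rewrite lee_fin mulr_ge0// powR_ge0.
  - by move=> t; rewrite /= !in_itv /= => /andP[t0 ->]; rewrite ltW.
apply: ge0_le_integral_all => t; first by rewrite lee_fin mulr_ge0// powR_ge0.
rewrite /= in_itv /= => /andP[t0 t1]; rewrite lee_fin ler_wpM2l ?powR_ge0//.
have t01 : 0 <= t < 1 by rewrite ltW.
have -> : - ((n%:R - p^-1) * q) = (p^-1 - n%:R) * q by ring.
rewrite powRrM; apply: ge0_ler_powR; rewrite ?nnegrE ?powR_ge0 ?pmean_ge0//; first exact: ltW.
by rewrite [t * r]mulrC; exact: pmean_test_le.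
Qed.

Lemma bounded_fin_carleson p q (g1 g2 b : R) : 1 <= p -> 0 < q -> 0 < g1 -> 0 <= b ->
  bounded_mixed (cesaro_op mu b) p%:E q%:E g1 p%:E q%:E g2 ->
  carleson mu (b + g1 - g2).
Proof.
move=> p1 q0 g10 b0 [C C0 HC]; have p0 : 0 < p by rewrite (lt_le_trans ltr01).
(* As p >= 1, this meets both requirements on the exponent, np >= 2 and g1 + 1/p < n. *)
pose n := Num.bound (g1 + 2); have gn : g1 + 2 < n%:R.
  by rewrite archi_boundP// addr_ge0// ltW.
have n2 : 2 <= n%:R :> R by lra.
have np : 2 <= n%:R * p by rewrite (le_trans n2)// ler_peMr.
have pV : p^-1 <= 1 by rewrite invf_le1.
have gpn : g1 + p^-1 < n%:R by lra.
have [K K0 HK] := mixed_norm_test n p q g1 p0 q0 g10 np gpn.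
have pi2 := @twopi_gt0 R.
have N0 : 0 < 4 * (n%:R + b + 1) by rewrite mulr_gt0//; lra.
pose c := (4 * (n%:R + b + 1))^-1; have c0 : 0 < c by rewrite invr_gt0.
pose k1 := (2 * (1 + 2 `^ (g2 * q - 1))) `^ (- q^-1) : R.
have k10 : 0 < k1 by rewrite powR_gt0// mulr_gt0// ltr_wpDr// powR_ge0.
pose k2 := (c / (2 * pi)) `^ p^-1.
have k20 : 0 < k2 by rewrite powR_gt0// divr_gt0.
apply: (carleson_from_lower mu n b g1 g2 (C * K / (k1 * k2))).
  by rewrite divr_gt0 ?mulr_gt0.
move=> r r01; have [r0 r1] := andP r01.
have r01' : 0 <= r <= 1 by rewrite !ltW.
have e0 : 0 < 1 - r by rewrite subr_gt0.
have [M M0 ME] := tail_finE mu r; rewrite ME.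
have fa := test_fun_analytic r n r01'.
have fn := HK r r01.
have := HC (test_fun r n) (conj fa (le_lt_trans fn (ltry _))).
move=> h0; have h : (mixed_norm p%:E q%:E g2 (cesaro_op mu b (test_fun r n)) <=
   (C * (K * (1 - r) `^ (g1 - n%:R + p^-1)))%:E)%E.
  by rewrite (le_trans h0)// EFinM; apply: lee_wpmul2l => //; rewrite lee_fin ltW.
(* The largest angle that [cesaro_test_lower] admits. *)
pose d := c * (1 - r).
have d0 : 0 <= d by rewrite mulr_ge0 ?ltW.
have dN : d * (4 * (n%:R + b + 1)) = 1 - r.
  by rewrite /d /c mulrAC mulVf ?mul1r// gt_eqF.
have d01 : 0 <= d <= 2 * pi.
  have p2 := @pi_ge2 R; rewrite d0 /=.
  have h1 : d * 1 <= d * (4 * (n%:R + b + 1)) by rewrite ler_wpM2l//; lra.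
  lra.
pose m := cos 1 * (4 * (1 - r)) `^ (- (n%:R + b)) * M.
have m0 : 0 <= m by rewrite !mulr_ge0 ?powR_ge0// ltW// cos1_gt0.
have low rho theta : r <= rho <= (1 + r) / 2 -> 0 <= theta <= d ->
    m <= cmod (cesaro_op mu b (test_fun r n) (rho%:C * expi theta)).
  move=> rr /andP[t0 td]; rewrite -lee_fin /m EFinM -ME.
  apply: cesaro_test_lower => //.
  by rewrite -dN ler_wpM2r// ltW.
have := le_trans (mixed_norm_lower p q g2 _ r d m p0 q0 r01 d01 m0 low) h.
have dE : (d / (2 * pi)) `^ p^-1 = k2 * (1 - r) `^ p^-1.
  rewrite /k2 -powRM ?(ltW e0)// ?divr_ge0 ?(ltW c0) ?(ltW pi2)//.
  by congr (_ `^ _); rewrite /d mulrAC.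
rewrite -/k1 dE powRD; last by rewrite (gt_eqF e0) implybT.
rewrite -!EFinM !lee_fin -/m.
set E := (1 - r) `^ p^-1; have E0 : 0 < E by exact: powR_gt0.
set E1 := _ `^ (g1 - _); set E2 := _ `^ g2 => h2.
have q0' : 0 < (k1 * k2 * E)^-1 by rewrite invr_gt0 !mulr_gt0.
have := ler_wpM2r (ltW q0') h2.
rewrite (_ : E2 * k1 * _ * _ = E2 * m); last by field; rewrite !gt_eqF.
by rewrite (_ : C * (K * _) * _ = C * K / (k1 * k2) * E1)//; field; rewrite !gt_eqF.
Qed.

End NecessityFin.

Local Close Scope complex_scope.

Theorem theorem6p10 (R : realType)
    (mu : {finite_measure set (measurableTypeR R) -> \bar R})
    (mu_supp : mu (~` `[0%R, 1%R[%classic) = 0%E)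
    (gam1 gam2 beta : R)
    (gam1_gt0 : 0 < gam1) (gam2_gt0 : 0 < gam2) (beta_gt0 : 0 < beta)
    (gam2_lt : gam2 < gam1 + beta) :
  [<-> bounded_growth (cesaro_op mu beta) gam1 gam2;
       carleson mu (beta + gam1 - gam2);
       (forall p : \bar R, (1%:E <= p)%E ->
          bounded_mixed (cesaro_op mu beta) p +oo%E gam1 p +oo%E gam2);
       (forall p q : R, 1 <= p -> 0 < q ->
          bounded_mixed (cesaro_op mu beta) p%:E q%:E gam1 p%:E q%:E gam2);
       (exists p q : R, [/\ 1 <= p, 0 < q &
          bounded_mixed (cesaro_op mu beta) p%:E q%:E gam1 p%:E q%:E gam2]);
       (exists p delta q : R, [/\ 1 <= p, 0 < delta < gam1, 0 < q &
          bounded_mixed (cesaro_op mu (beta + delta))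
            p%:E q%:E (gam1 - delta) p%:E q%:E gam2])].
Proof.
(* The last condition moves beta and gam1 by opposite amounts, so it has the same Carleson exponent
   as the others. *)
have shift (delta : R) : beta + delta + (gam1 - delta) - gam2 = beta + gam1 - gam2 by ring.
have b0 := ltW beta_gt0; clear mu_supp.
tfae.
- exact: bounded_inf_carleson.
- by move=> muC p p1; exact: carleson_bounded_inf.
(* At p = oo the hypothesis is the boundedness between growth spaces, which returns the Carleson
   condition. *)
- move=> H p q p1 q0; apply: carleson_bounded_fin => //.
  by apply: bounded_inf_carleson => //; apply: H; exact: leey.
- by move=> H; exists 1, 1; split=> //; exact: H.
(* The Carleson condition yields every admissible triple; this one has delta strictly between 0 and
   gam1. *)
- move=> [p [q [p1 q0 H]]]; exists 1, (gam1 / 2), 1.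
  split=> //; first by rewrite divr_gt0//=; lra.
  apply: carleson_bounded_fin => //; [lra|lra|lra|].
  by rewrite shift; exact: bounded_fin_carleson H.
- move=> [p [delta [q [p1 /andP[d0 d1] q0 H]]]].
  apply: carleson_bounded_inf => //; first exact: leey.
  rewrite -(shift delta); apply: bounded_fin_carleson H => //; first lra.
  by rewrite addr_ge0// ltW.
Qed.
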